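(* Let $\mathbb{A}=L_a\mathbb{I}+D_a\mathbf{A}$, $\mathbb{B}=L_b\mathbb{I}+D_b\mathbf{B}$, $\mathbb{Q}=L_q\mathbb{I}+D_q\mathbf{Q}$ and $\mathbb{Q}_T=L_{q_T}\mathbb{I}+D_{q_T}\mathbf{Q}_T$, where $L_a,D_a,L_b,D_b,L_q,D_q,L_{q_T},D_{q_T}\in\mathbb{R}^{n\times n}$ and $\mathbf{A},\mathbf{B},\mathbf{Q},\mathbf{Q}_T\in\mathcal{W}_c$. Assume: (1) $\mathbb{Q}$ and $\mathbb{Q}_T$ are self-adjoint and non-negative on $(L^2[0,1])^n$; (2) there is a finite-dimensional subspace $\mathcal{S}\subset L^2[0,1]$ that is invariant under each of $\mathbf{A},\mathbf{B},\mathbf{Q},\mathbf{Q}_T$; (3) $\mathbf{A}\mathbf{v}=\mathbf{B}\mathbf{v}=\mathbf{Q}\mathbf{v}=\mathbf{Q}_T\mathbf{v}=0$ for all $\mathbf{v}\in\mathcal{S}^\perp$. Let $d=\dim\mathcal{S}$, let $\mathbf{f}_1,\dots,\mathbf{f}_d$ be an orthonormal basis of $\mathcal{S}$, and let $A,B,Q,Q_T\in\mathbb{R}^{d\times d}$ have entries $A_{\ell k}=\langle\mathbf{A}\mathbf{f}_\ell,\mathbf{f}_k\rangle$, $B_{\ell k}=\langle\mathbf{B}\mathbf{f}_\ell,\mathbf{f}_k\rangle$, $Q_{\ell k}=\langle\mathbf{Q}\mathbf{f}_\ell,\mathbf{f}_k\rangle$, $(Q_T)_{\ell k}=\langle\mathbf{Q}_T\mathbf{f}_\ell,\mathbf{f}_k\rangle$.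 Given $\mathbf{x}_0\in(L^2[0,1])^n$, consider minimizing $$J(\mathbf{u})=\int_0^T\big(\langle\mathbf{x}_t,\mathbb{Q}\mathbf{x}_t\rangle+\langle\mathbf{u}_t,\mathbf{u}_t\rangle\big)dt+\langle\mathbf{x}_T,\mathbb{Q}_T\mathbf{x}_T\rangle$$ over $\mathbf{u}\in L^2([0,T];(L^2[0,1])^n)$ subject to $\dot{\mathbf{x}}_t=\mathbb{A}\mathbf{x}_t+\mathbb{B}\mathbf{u}_t$, $t\in[0,T]$. Then the optimal control $\mathbf{u}^o$ (with optimal state $\mathbf{x}^o$) is given nodewise as follows: for almost all $\gamma\in[0,1]$, with $\mathbf{u}_t^{o\gamma}=\mathbf{u}_t^o(\gamma)\in\mathbb{R}^n$, $$\mathbf{u}_t^{o\gamma}=\breve{\mathbf{u}}_t^{o\gamma}+\sum_{\ell=1}^d u_t^{op\ell}\,\mathbf{f}_\ell(\gamma),$$ where $u_t^{op}=[(u_t^{op1})^\top,\dots,(u_t^{opd})^\top]^\top\in\mathbb{R}^{nd}$ (each $u_t^{op\ell}\in\mathbb{R}^n$) is $$u_t^{op}=-(I\otimes L_b+B\otimes D_b)^\top\Pi_t\,x_t^{op},\qquad x_t^{op}=\mathrm{Proj}_{\mathbf{f}}(\mathbf{x}^o_t),$$ with $\Pi$ solving $$\begin{aligned}-\dot\Pi_t=\;&(I\otimes L_a+A\otimes D_a)^\top\Pi_t+\Pi_t(I\otimes L_a+A\otimes D_a)\\&-\Pi_t(I\otimes L_b+B\otimes D_b)(I\otimes L_b+B\otimes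 D_b)^\top\Pi_t+(I\otimes L_q+Q\otimes D_q),\end{aligned}$$ $$\Pi_T=I\otimes L_{q_T}+Q_T\otimes D_{q_T},$$ and $$\breve{\mathbf{u}}_t^{o\gamma}=-L_b^\top\pi_t\,\breve{\mathbf{x}}_t^{\gamma},\qquad -\dot\pi_t=L_a^\top\pi_t+\pi_tL_a-\pi_tL_bL_b^\top\pi_t+L_q,\qquad \pi_T=L_{q_T},$$ where $\breve{\mathbf{x}}_t^\gamma=\breve{\mathbf{x}}_t(\gamma)\in\mathbb{R}^n$ and $\breve{\mathbf{x}}_t$ is the $(\mathcal{S}^\perp)^n$-component of the optimal state $\mathbf{x}_t^o$.
   Context: Fix $T>0$, $c>0$, $n\ge1$. $\mathcal{W}_c$ is the set of symmetric measurable functions $[0,1]^2\to[-c,c]$ (''graphons''). Each $\mathbf{A}\in\mathcal{W}_c$ also denotes the integral operator $(\mathbf{A}\mathbf{v})(\alpha)=\int_0^1\mathbf{A}(\alpha,\beta)\mathbf{v}(\beta)d\beta$ on $L^2[0,1]$. $(L^2[0,1])^n$ is the Hilbert space of real vector functions $\mathbf{v}=(\mathbf{v}_1,\dots,\mathbf{v}_n)$ with inner product $\langle\mathbf{u},\mathbf{v}\rangle=\sum_{i=1}^n\langle\mathbf{u}_i,\mathbf{v}_i\rangle_{L^2[0,1]}$. For $D\in\mathbb{R}^{n\times n}$, $D\mathbf{A}$ and $D\mathbb{I}$ are the bounded operators on $(L^2[0,1])^n$ given by $([D\mathbf{A}]\mathbf{v})(\alpha)=D\int_0^1\mathbf{A}(\alpha,\beta)\mathbf{v}(\beta)d\beta$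 and $([D\mathbb{I}]\mathbf{v})(\alpha)=D\mathbf{v}(\alpha)$. The dynamics $\dot{\mathbf{x}}_t=\mathbb{A}\mathbf{x}_t+\mathbb{B}\mathbf{u}_t$ are understood in the mild sense: $\mathbf{x}_t=e^{(t-a)\mathbb{A}}\mathbf{x}_a+\int_a^te^{(t-s)\mathbb{A}}\mathbb{B}\mathbf{u}_s\,ds$ for all $0\le a\le t\le T$. A subspace $\mathcal{S}$ is invariant under $\mathbf{A}$ if $\mathbf{A}\mathbf{v}\in\mathcal{S}$ for all $\mathbf{v}\in\mathcal{S}$. $(\mathcal{S})^n=\mathcal{S}\times\cdots\times\mathcal{S}$ ($n$ factors), and likewise $(\mathcal{S}^\perp)^n$. Every $\mathbf{v}\in(L^2[0,1])^n$ is decomposed uniquely, component by component, as $\mathbf{v}=\mathbf{v}^{\mathbf{f}}+\breve{\mathbf{v}}$ with $\mathbf{v}^{\mathbf{f}}\in(\mathcal{S})^n$, $\breve{\mathbf{v}}\in(\mathcal{S}^\perp)^n$. For $\mathbf{x}\in(L^2[0,1])^n$, $\mathrm{Proj}_{\mathbf{f}}(\mathbf{x})=[(x^{p1})^\top,\dots,(x^{pd})^\top]^\top\in\mathbb{R}^{nd}$, where $x^{p\ell}\in\mathbb{R}^n$ has $i$-th entry $\langle\mathbf{x}_i,\mathbf{f}_\ell\rangle$. $\otimes$ is the Kronecker product $M\otimes D=[m_{ij}D]_{ij}$, and $I$ is the $d\times d$ identity matrix. The point $\gamma\in[0,1]$ indexes an agent (node). *)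

(* Defs.v *)
From HB Require Import structures.
From mathcomp Require Import all_boot all_order all_algebra.
From mathcomp Require Import all_classical all_reals all_analysis.
From mathcomp Require Export mxtens.
Set Implicit Arguments.
Unset Strict Implicit.
Unset Printing Implicit Defensive.
Import Order.TTheory GRing.Theory Num.Theory.
Import numFieldNormedType.Exports.
Local Open Scope classical_set_scope.
Local Open Scope ring_scope.

Local Notation leb := lebesgue_measure.

(* Elements of L^2[0,1] are represented by functions on the whole line of which
   only the values on [0,1] matter; equality in L^2[0,1] is a.e. equality on
   [0,1]. *)

Section L2.
Variable R : realType.
Implicit Types (v w : R -> R) (S : set (R -> R)) (A : R * R -> R).

Definition unit_itv : set (measurableTypeR R) := `[0, 1]%classic.

Definition L2 : set (R -> R) := [set v | v \_ unit_itv \in Lfun leb 2%:E].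

Definition L2eq v w : Prop := {ae leb, forall a, unit_itv a -> v a = w a}.

Definition ip v w : R := \int[leb]_(a in unit_itv) (v a * w a).

(* Measurability is Borel; a Lebesgue measurable kernel is a.e. equal to a
   Borel one and defines the same operator on L^2[0,1]. *)
Definition graphon (c : R) : set (R * R -> R) :=
  [set A | [/\ measurable_fun (unit_itv `*` unit_itv) A,
    forall a b, unit_itv a -> unit_itv b -> A (a, b) = A (b, a) &
    forall a b, unit_itv a -> unit_itv b -> - c <= A (a, b) <= c]].

Definition graphon_op A v : R -> R :=
  fun a => \int[leb]_(b in unit_itv) (A (a, b) * v b).

(* The last clause makes [S] a set of classes modulo a.e. equality. *)
Definition is_subspace S : Prop :=
  [/\ S `<=` L2, S 0,
      forall (k : R) v w, S v -> S w -> S (k *: v + w) &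
      forall v w, S v -> L2 w -> L2eq v w -> S w].

Definition is_basis S d (e : 'I_d -> R -> R) : Prop :=
  [/\ forall i, S (e i),
      forall k : 'I_d -> R, L2eq (\sum_i k i *: e i) 0 -> forall i, k i = 0 &
      forall v, S v -> exists k : 'I_d -> R, L2eq v (\sum_i k i *: e i)].

Definition has_dim S (d : nat) : Prop :=
  exists e : 'I_d -> R -> R, is_basis S e.

Definition orthonormal_basis S d (f : 'I_d -> R -> R) : Prop :=
  is_basis S f /\ forall l k, ip (f l) (f k) = (l == k)%:R.

Definition invariant_under S A : Prop := forall v, S v -> S (graphon_op A v).

Definition ortho_compl S : set (R -> R) :=
  [set v | L2 v /\ forall w, S w -> ip v w = 0].

Definition gram_mx A d (f : 'I_d -> R -> R) : 'M[R]_d :=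
  \matrix_(l, k) ip (graphon_op A (f l)) (f k).

End L2.

Section Hspace.
Variables (R : realType) (n : nat).

(* [v a] is the vector (v_1(a), ..., v_n(a))^T; only a in [0,1] matters. *)
Definition Hvec : lmodType R := R -> 'cV[R]_n.
Implicit Types (v w : Hvec) (S : set (R -> R)) (F : R -> Hvec) (D : set R).

Definition coord_fun v (i : 'I_n) : R -> R := fun a => v a i 0.

Definition Hpow S : set Hvec := [set v | forall i, S (coord_fun v i)].

Definition inH : set Hvec := Hpow (@L2 R).

Definition Heq v w : Prop := {ae leb, forall a, unit_itv a -> v a = w a}.

Definition Hip v w : R := \sum_(i < n) ip (coord_fun v i) (coord_fun w i).

Definition Hnorm v : R := Num.sqrt (Hip v v).

(* The operator L I + D A on H = (L^2[0,1])^n. *)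
Definition netop (L D : 'M[R]_n) (A : R * R -> R) : Hvec -> Hvec :=
  fun v a => L *m v a + D *m (\col_i graphon_op A (coord_fun v i) a).

Definition self_adjoint (P : Hvec -> Hvec) : Prop :=
  forall v w, inH v -> inH w -> Hip (P v) w = Hip v (P w).

Definition nonneg_op (P : Hvec -> Hvec) : Prop :=
  forall v, inH v -> 0 <= Hip v (P v).

Definition is_decomp S v vf vb : Prop :=
  [/\ Hpow S vf, Hpow (ortho_compl S) vb & Heq v (vf + vb)].

Definition Hcvg (s : nat -> Hvec) v : Prop :=
  Hnorm (s k - v) @[k --> \oo] --> (0 : R).

(* e^{tP} v = sum_j t^j / j! P^j v, the series converging in H; [xget] selects
   a representative of its sum. *)
Definition expop (P : Hvec -> Hvec) (t : R) v : Hvec :=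
  xget 0 [set w | inH w /\
    Hcvg (series (fun j => (t ^+ j / j`!%:R) *: iter j P v)) w].

Record Hsimple := {
  hs_size : nat;
  hs_set : 'I_hs_size -> set (measurableTypeR R);
  hs_vec : 'I_hs_size -> Hvec;
  hs_measurable : forall j, measurable (hs_set j);
  hs_inH : forall j, inH (hs_vec j) }.

Definition hs_fun (s : Hsimple) (t : R) : Hvec :=
  \sum_(j < hs_size s) (\1_(@hs_set s j) t : R) *: @hs_vec s j.

Definition hs_integral D (s : Hsimple) : Hvec :=
  \sum_(j < hs_size s) fine (leb (@hs_set s j `&` D)) *: @hs_vec s j.

Definition simple_approx D (s : nat -> Hsimple) F : Prop :=
  forall t, D t -> inH (F t) /\ Hcvg (fun k => hs_fun (s k) t) (F t).

(* Approximation holds at every time of [D]; each class of a.e. equal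
   functions that are strongly measurable in the a.e. sense has such a
   representative. *)
Definition strongly_measurable D F : Prop :=
  exists s, simple_approx D s F.

(* [w] is (a representative of) the Bochner integral of [F] over [D]. *)
Definition bochner_integral D F w : Prop :=
  inH w /\ exists s : nat -> Hsimple,
    [/\ simple_approx D s F,
        (\int[leb]_(t in D) (Hnorm (F t - hs_fun (s k) t))%:E)%E
          @[k --> \oo] --> 0%E &
        Hcvg (fun k => hs_integral D (s k)) w].

Definition L2_time (T : R) F : Prop :=
  strongly_measurable `[0, T]%classic F /\
  (\int[leb]_(t in `[0%R, T]%classic) (Hnorm (F t) ^+ 2)%:E < +oo)%E.

Section control.
Variables (T : R) (opA opB opQ opQT : Hvec -> Hvec) (x0 : Hvec).

Definition mild_solution (u x : R -> Hvec) : Prop :=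
  (forall t, 0 <= t <= T -> inH (x t)) /\
  forall a t, 0 <= a -> a <= t -> t <= T ->
    bochner_integral `[a, t]%classic
      (fun s => expop opA (t - s) (opB (u s)))
      (x t - expop opA (t - a) (x a)).

Definition admissible_pair (u x : R -> Hvec) : Prop :=
  [/\ L2_time T u, mild_solution u x & Heq (x 0) x0].

Definition lq_cost (u x : R -> Hvec) : \bar R :=
  (\int[leb]_(t in `[0%R, T]%classic)
      (Hip (x t) (opQ (x t)) + Hip (u t) (u t))%:E
   + (Hip (x T) (opQT (x T)))%:E)%E.

Definition optimal_pair (u x : R -> Hvec) : Prop :=
  admissible_pair u x /\
  forall u' x', admissible_pair u' x' -> (lq_cost u x <= lq_cost u' x')%E.

End control.

(* R^{dn} is indexed by [mxtens_index (l, i)] = l * n + i: d blocks of length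
   n, the ordering used by the Kronecker product [*t]. *)

Definition proj_coord d (f : 'I_d -> R -> R) v : 'cV[R]_(d * n) :=
  \col_j ip (coord_fun v (mxtens_unindex j).2) (f (mxtens_unindex j).1).

Definition vblock d (y : 'cV[R]_(d * n)) (l : 'I_d) : 'cV[R]_n :=
  \col_i y (mxtens_index (l, i)) 0.

End Hspace.

(* -P' = F^T P + P F - P G G^T P + M on [0,T], P(T) = K; the equation is
   imposed on the open interval and P is continuous up to the endpoints. *)
Definition riccati_sol (R : realType) m (T : R) (F G M K : 'M[R]_m)
    (P : R -> 'M[R]_m) : Prop :=
  [/\ {within `[0, T]%classic, continuous P},
      forall t : R, 0 < t < T ->
        is_derive t (1 : R) P
          (- (F^T *m P t + P t *m F - P t *m G *m G^T *m P t + M)) &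
      P T = K].

(* Main.v *)
(* On the span of the basis f_l and of the coordinates of the S^perp-component
   of x0, the operators L I + D A act by finite matrices: by 1 (x) L + A (x) D
   on the f_l and by 1 (x) L on the rest.  A solution P of the Riccati equation
   satisfies P X = Y, where (X, Y) solves the linear Hamiltonian system with
   (X, Y)(T) = (1, K), and X stays invertible on ]-oo, T] because M and K are
   nonnegative.  Hence the feedback trajectory x and its costate p = P x are
   smooth curves in a finite-dimensional space.

   Optimality among all controls follows by expanding the cost around x:
   testing the mild equation for the difference (dx, du) of two admissible
   pairs against p and integrating by parts, the first-order term vanishes, so
   that J(u + du) >= J(u) + int |du|^2, which also gives uniqueness. *)
Require Import Defs.
From HB Require Import structures.
From mathcomp Require Import all_boot all_order all_algebra.
From mathcomp Require Import all_classical all_reals all_analysis.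
From mathcomp Require Import measurable_realfun mxtens ring lra.
Set Implicit Arguments.
Unset Strict Implicit.
Unset Printing Implicit Defensive.
Import Order.TTheory GRing.Theory Num.Theory.
Import numFieldNormedType.Exports.
Local Open Scope classical_set_scope.
Local Open Scope ring_scope.

(** * Matrix-valued calculus and the Riccati equation *)

(** The [S^perp]-component of a state lives in an infinite-dimensional space, yet the [n] coordinate
    functions of its initial value, each times the [n] canonical vectors, span a space that every
    operator preserves; the Riccati equation there is that of [pi_], lifted by a Kronecker product
    with the identity. These coordinate functions may be linearly dependent, so all computations are
    made on coefficients over a generating family. Operators are described by two relations,
    [acts_by] on the family and [coacts_by] for the adjoint. The second one handles competing
    states: they leave the span and can only be paired with it. Being mild solutions, they are not
    differentiated either; pairing with vectors transported by the exponential of [- s F^T] makes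
    the paired state a primitive of an integrable function.

    The Hamiltonian argument on the orthogonal side requires [Lq] and [LqT] to be nonnegative, which
    is not assumed. It is extracted from the nonnegativity of the operators by testing them on a
    unit function orthogonal to [S], which exists because [L^2[0,1]] is infinite-dimensional. *)

Section matrix_calculus.
Context {R : realType}.

Lemma cvg_sumr (T : Type) (F : set_system T) {FF : Filter F} n
    (f : 'I_n -> T -> R) (l : 'I_n -> R) :
  (forall i, f i x @[x --> F] --> l i) ->
  (\sum_i f i x) @[x --> F] --> \sum_i l i.
Proof. by move=> fl; apply: cvg_big => // -[a b]; exact: add_continuous. Qed.

Lemma is_derive_ext (V : normedModType R) (f g : R -> V) (t : R) (d e : V) :
  f =1 g -> d = e -> is_derive t (1 : R) f d -> is_derive t (1 : R) g e.
Proof. by move=> /funext -> ->. Qed.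

Lemma is_derive_near (V : normedModType R) (f g : R -> V) (t : R) (d : V) :
  {near t, f =1 g} -> is_derive t (1 : R) f d -> is_derive t (1 : R) g d.
Proof.
move=> fg [df Df]; split; first exact: near_eq_derivable df.
by rewrite -Df; apply/esym/near_eq_derive.
Qed.

Lemma is_derive_continuous (V : normedModType R) (f : R -> V) t d :
  is_derive t (1 : R) f d -> {for t, continuous f}.
Proof.
by move=> [df _]; apply: differentiable_continuous; exact/derivable1_diffP.
Qed.

Lemma is_derive_mxP p q (P : R -> 'M[R]_(p, q)) t D :
  is_derive t (1 : R) P D <->
  forall i j, is_derive t (1 : R) (fun x => P x i j) (D i j).
Proof.
split=> [[dP <-] i j|dP].
  split; first by move/derivable_mxP : dP; exact.
  by rewrite derive_mx// mxE.
have dP' : derivable P t 1 by apply/derivable_mxP => i j; apply: ex_derive.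
split => //; rewrite derive_mx//; apply/matrixP => i j; rewrite mxE.
exact: derive_val.
Qed.

Lemma is_derive_Mr (f g : R -> R) t df dg :
  is_derive t (1 : R) f df -> is_derive t (1 : R) g dg ->
  is_derive t (1 : R) (fun x => f x * g x) (df * g t + f t * dg).
Proof.
move=> hf hg; apply: is_derive_ext (is_deriveM hf hg) => //=.
by rewrite /GRing.scale/= addrC [g t * df]mulrC.
Qed.

Lemma is_derive_sumr n (f : 'I_n -> R -> R) t (df : 'I_n -> R) :
  (forall i, is_derive t (1 : R) (f i) (df i)) ->
  is_derive t (1 : R) (fun x => \sum_i f i x) (\sum_i df i).
Proof.
move=> hf; apply: is_derive_ext (is_derive_sum hf) => // x.
by rewrite fct_sumE.
Qed.

Lemma is_derive_mulmx p q r (P : R -> 'M[R]_(p, q)) (Q : R -> 'M[R]_(q, r))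
    t dP dQ :
  is_derive t (1 : R) P dP -> is_derive t (1 : R) Q dQ ->
  is_derive t (1 : R) (fun x => P x *m Q x) (dP *m Q t + P t *m dQ).
Proof.
move=> /is_derive_mxP hP /is_derive_mxP hQ; apply/is_derive_mxP => i j.
have := is_derive_sumr (fun k => is_derive_Mr (hP i k) (hQ k j)).
by apply: is_derive_ext => [x|]; rewrite !mxE// big_split.
Qed.

Lemma is_derive_mulmxl p q r (N : 'M[R]_(p, q)) (Q : R -> 'M[R]_(q, r)) t dQ :
  is_derive t (1 : R) Q dQ -> is_derive t (1 : R) (fun x => N *m Q x) (N *m dQ).
Proof.
move=> hQ; have := is_derive_mulmx (is_derive_cst N t 1) hQ.
by rewrite mul0mx add0r.
Qed.

Lemma is_derive_mulmxr p q r (N : 'M[R]_(q, r)) (Q : R -> 'M[R]_(p, q)) t dQ :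
  is_derive t (1 : R) Q dQ -> is_derive t (1 : R) (fun x => Q x *m N) (dQ *m N).
Proof.
move=> hQ; have := is_derive_mulmx hQ (is_derive_cst N t 1).
by rewrite mulmx0 addr0.
Qed.

Lemma is_derive_trmx p q (P : R -> 'M[R]_(p, q)) t dP :
  is_derive t (1 : R) P dP -> is_derive t (1 : R) (fun x => (P x)^T) dP^T.
Proof.
move=> /is_derive_mxP hP; apply/is_derive_mxP => i j.
by apply: is_derive_ext (hP j i) => [x|]; rewrite mxE.
Qed.

Lemma is_derive_comp_affine (V : normedModType R) (f : R -> V) (a b t : R) d :
  is_derive (a * t + b) (1 : R) f d ->
  is_derive t (1 : R) (fun x => f (a * x + b)) (a *: d).
Proof.
move=> hf.
have h1 : is_derive t (1 : R) (fun x : R => a * x + b) a.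
  have := is_deriveD (is_deriveZ a (is_derive_id t (1 : R)))
    (is_derive_cst b t (1 : R)).
  by apply: is_derive_ext => //=; rewrite addr0 [a%:A]mulr1.
have df : differentiable f (a * t + b).
  by apply/derivable1_diffP; exact: ex_derive.
have dg : differentiable (fun x : R => a * x + b) t.
  by apply/derivable1_diffP; exact: ex_derive.
have dfg := differentiable_comp dg df.
split; first exact/derivable1_diffP.
have E : 'd (fun x : R => a * x + b) t 1 = a.
  by rewrite -deriveE//; exact: derive_val.
rewrite deriveE// diff_comp//= E.
have -> : 'd f (a * t + b) a = 'd f (a * t + b) (a *: (1 : R)).
  by rewrite [a *: _]mulr1.
by rewrite linearZ/= -deriveE// derive_val.
Qed.

Lemma is_derive0_cst p q (P : R -> 'M[R]_(p, q)) :
  (forall t, is_derive t (1 : R) P 0) -> forall s t, P s = P t.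
Proof.
move=> dP s t; apply/matrixP => i j.
have {}dP x : is_derive x (1 : R) (fun x => P x i j) 0.
  by have /is_derive_mxP/(_ i j) := dP x; rewrite mxE.
exact: is_derive_0_is_cst.
Qed.

End matrix_calculus.

(** * The exponential of a matrix as a power series, and its group law *)

Section matrix_exponential.
Context {R : realType}.

Section coefficients.
Context {m : nat} (H : 'M[R]_m).

Definition mexp_coef (i j : 'I_m) (k : nat) : R := (H ^+ k) i j / k`!%:R.

(** The sum [C] of all [|H i j|] dominates every row sum, so one more factor [H] costs at most one
    more factor [C]. The exponential series of [C * |t|] is then a majorant. *)
Lemma mexp_coef_bound :
  exists2 C, 0 <= C & forall i j k, `|(H ^+ k) i j| <= C ^+ k.
Proof.
exists (\sum_i \sum_j `|H i j|).
  by apply: sumr_ge0 => i _; apply: sumr_ge0.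
set C := \sum_i _; move=> i j k; elim: k i j => [|k IH] i j.
  by rewrite !expr0 mxE; case: (i == j); rewrite ?normr1// normr0 ler01.
rewrite !exprS mxE (le_trans (ler_norm_sum _ _ _))//.
have C0 : 0 <= C by apply: sumr_ge0 => ? _; apply: sumr_ge0.
have le1 : \sum_l `|H i l| <= C.
  rewrite /C [leRHS](bigD1 i)//= lerDl; apply: sumr_ge0 => ? _; exact: sumr_ge0.
apply: le_trans (ler_wpM2r (exprn_ge0 k C0) le1).
rewrite mulr_suml; apply: ler_sum => l _; rewrite normrM.
exact: ler_wpM2l.
Qed.

Lemma cvg_mexp i j t : cvgn (pseries (mexp_coef i j) t).
Proof.
have [C C0 hC] := mexp_coef_bound.
apply: normed_cvg; apply: (@series_le_cvg _ _ (exp_coeff (C * `|t|))) => //.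
- by move=> k; rewrite normr_ge0.
- by move=> k; rewrite /exp_coeff/= divr_ge0// exprn_ge0// mulr_ge0.
- move=> k /=; rewrite /mexp_coef /exp_coeff/= !normrM normrX normfV.
  rewrite (ger0_norm (ler0n _ _)) mulrAC ler_wpM2r// exprMn.
  by rewrite ler_wpM2r ?exprn_ge0.
- exact: is_cvg_series_exp_coeff.
Qed.

(** Defined entry by entry, so that the scalar theory of power series gives differentiability. *)
Definition mexp (t : R) : 'M[R]_m :=
  \matrix_(i, j) limn (pseries (mexp_coef i j) t).

Lemma pseries_diffs_mexp i j :
  pseries_diffs (mexp_coef i j) = fun k => (H * H ^+ k) i j / k`!%:R.
Proof.
apply/funext => k; rewrite /pseries_diffs /mexp_coef -exprS factS natrM invfM.
by rewrite mulrCA mulVKf// pnatr_eq0.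
Qed.

End coefficients.

(** Each entry is a finite combination of convergent scalar series. Taking [N] to be [H] or [H * H]
    covers the first and second formal derivatives of the exponential series. *)
Lemma pseries_mull m (H N : 'M[R]_m) i j t :
  pseries (fun k => (N * H ^+ k) i j / k`!%:R) t @ \oo --> (N *m mexp H t) i j.
Proof.
have -> : pseries (fun k => (N * H ^+ k) i j / k`!%:R) t =
    fun K => \sum_l N i l * pseries (mexp_coef H l j) t K.
  apply/funext => K; rewrite /pseries /series/=.
  under [RHS]eq_bigr do rewrite mulr_sumr.
  rewrite exchange_big/=; apply: eq_bigr => k _.
  rewrite mxE !mulr_suml; apply: eq_bigr => l _.
  by rewrite /mexp_coef !mulrA.
rewrite mxE.
apply: cvg_sumr => l; rewrite mxE.
by apply: cvgM; [exact: cvg_cst|exact: cvg_mexp].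
Qed.

Lemma is_derive_mexp m (H : 'M[R]_m) t :
  is_derive t (1 : R) (mexp H) (H *m mexp H t).
Proof.
apply/is_derive_mxP => i j.
have c1 N K : cvgn (pseries (fun k => (N * H ^+ k) i j / k`!%:R) K).
  by apply/cvg_ex; eexists; exact: pseries_mull.
have d2 : pseries_diffs (pseries_diffs (mexp_coef H i j)) =
    fun k => (H * H * H ^+ k) i j / k`!%:R.
  rewrite pseries_diffs_mexp; apply/funext => k; rewrite /pseries_diffs.
  rewrite factS natrM invfM mulrCA mulVKf ?pnatr_eq0//.
  by rewrite exprS mulrA.
(* Termwise differentiation at [t] requires the series and its first two formal derivatives to
   converge at a point of larger modulus; [|t| + 1] is such a point. *)
have := @pseries_snd_diffs R (mexp_coef H i j) (`|t| + 1) t.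
rewrite d2 pseries_diffs_mexp => /(_ (@cvg_mexp _ _ _ _ _) (c1 _ _) (c1 _ _)).
rewrite [ltRHS]ger0_norm ?addr_ge0// ltrDl ltr01 => /(_ isT).
apply: is_derive_ext => [x|]; first by rewrite mxE.
by apply: cvg_lim => //; exact: pseries_mull.
Qed.

Lemma mexp0 m (H : 'M[R]_m) : mexp H 0 = 1%:M.
Proof.
apply/matrixP => i j; rewrite mxE; apply: cvg_lim => //.
rewrite -cvg_shiftS; apply: cvg_near_cst; apply: nearW => k.
rewrite /pseries /series/= big_nat_recl// big1 ?addr0.
  by rewrite expr0 mulr1 /mexp_coef expr0 fact0 divr1.
by move=> l _; rewrite expr0n mulr0.
Qed.

(** Both sides are limits of the same series, whose terms involve [H ^+ k.+1] factored on the left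
    or on the right. *)
Lemma mexp_comm m (H : 'M[R]_m) t : H *m mexp H t = mexp H t *m H.
Proof.
apply/matrixP => i j.
rewrite -(cvg_lim (@Rhausdorff R) (@pseries_mull m H H i j t)).
apply: cvg_lim => //.
have -> : pseries (fun k => (H * H ^+ k) i j / k`!%:R) t =
    fun K => \sum_l pseries (mexp_coef H i l) t K * H l j.
  apply/funext => K; rewrite /pseries /series/=.
  under [RHS]eq_bigr do rewrite mulr_suml.
  rewrite exchange_big/=; apply: eq_bigr => k _.
  rewrite -exprS exprSr mxE !mulr_suml; apply: eq_bigr => l _.
  by rewrite /mexp_coef; ring.
rewrite mxE; apply: cvg_sumr => l; rewrite mxE.
by apply: cvgM; [exact: cvg_mexp|exact: cvg_cst].
Qed.

Lemma mexpVr m (H : 'M[R]_m) t : mexp H t *m mexp H (- t) = 1%:M.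
Proof.
have dE s : is_derive s (1 : R) (fun x => mexp H x *m mexp H (- x)) 0.
  have h2 : is_derive s (1 : R) (fun x => mexp H (- x)) (- (H *m mexp H (- s))).
    have := @is_derive_comp_affine R _ (mexp H) (-1) 0 s (H *m mexp H (- s)).
    rewrite mulN1r addr0 scaleN1r => /(_ (is_derive_mexp _ _)).
    by apply: is_derive_ext => // x; rewrite mulN1r addr0.
  apply: is_derive_ext (is_derive_mulmx (is_derive_mexp H s) h2) => //.
  by rewrite mulmxN mexp_comm -!mulmxA subrr.
by rewrite (is_derive0_cst dE t 0) oppr0 mexp0 mulmx1.
Qed.

Lemma mexpVl m (H : 'M[R]_m) t : mexp H (- t) *m mexp H t = 1%:M.
Proof. by rewrite -{2}[t]opprK mexpVr. Qed.

(** The curve [mexp H (- x) *m y (x + t)] has zero derivative. Shifting the origin to [t] yields the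
    semigroup law when [y] is [mexp H] itself. *)
Lemma linear_ode_unique m p (H : 'M[R]_m) (y : R -> 'M[R]_(m, p)) :
  (forall t, is_derive t (1 : R) y (H *m y t)) ->
  forall s t, y (s + t) = mexp H s *m y t.
Proof.
move=> dy s t.
have dz x : is_derive x (1 : R) (fun x => mexp H (- x) *m y (x + t)) 0.
  have h1 : is_derive x (1 : R) (fun x => mexp H (- x)) (- (H *m mexp H (- x))).
    have := @is_derive_comp_affine R _ (mexp H) (-1) 0 x (H *m mexp H (- x)).
    rewrite mulN1r addr0 scaleN1r => /(_ (is_derive_mexp _ _)).
    by apply: is_derive_ext => // z; rewrite mulN1r addr0.
  have h2 : is_derive x (1 : R) (fun x => y (x + t)) (H *m y (x + t)).
    have := @is_derive_comp_affine R _ y 1 t x (H *m y (x + t)).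
    rewrite mul1r scale1r => /(_ (dy _)).
    by apply: is_derive_ext => // z; rewrite mul1r.
  apply: is_derive_ext (is_derive_mulmx h1 h2) => //.
  by rewrite mulNmx mexp_comm -!mulmxA addNr.
have := is_derive0_cst dz s 0.
rewrite oppr0 mexp0 mul1mx add0r => <-.
by rewrite mulmxA mexpVr mul1mx.
Qed.

Lemma mexpD m (H : 'M[R]_m) s t : mexp H (s + t) = mexp H s *m mexp H t.
Proof. exact/linear_ode_unique/is_derive_mexp. Qed.

(* The partial sums are written as they occur in [expop]. *)
Lemma cvg_mexp_mulmx m p (H : 'M[R]_m) t (y : 'M[R]_(m, p)) i j :
  (\sum_(0 <= k < K) (t ^+ k / k`!%:R) *: (H ^+ k *m y)) i j @[K --> \oo]
    --> (mexp H t *m y) i j.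
Proof.
under eq_fun => K.
  rewrite summxE; under eq_bigr => k _ do rewrite !mxE mulr_sumr.
  rewrite exchange_big/=.
  under eq_bigr => l _.
    under eq_bigr => k _.
      rewrite mulrA [t ^+ k / _ * _](_ : _ = mexp_coef H i l k * t ^+ k);
        last first.
        by rewrite /mexp_coef; ring.
      over.
    rewrite -mulr_suml -/(pseries (mexp_coef H i l) t K).
    over.
  over.
rewrite mxE; apply: cvg_sumr => l; rewrite mxE.
by apply: cvgM; [exact: cvg_mexp|exact: cvg_cst].
Qed.

End matrix_exponential.

Section dot_product.
Context {R : realType}.

Definition dotv m (x y : 'cV[R]_m) : R := (x^T *m y) 0 0.

Lemma dotvE m (x y : 'cV[R]_m) : dotv x y = \sum_i x i 0 * y i 0.
Proof. by rewrite /dotv mxE; apply: eq_bigr => i _; rewrite mxE. Qed.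

Lemma dotvC m (x y : 'cV[R]_m) : dotv x y = dotv y x.
Proof. by rewrite !dotvE; apply: eq_bigr => i _; rewrite mulrC. Qed.

Lemma dotv_trmx m p (N : 'M[R]_(m, p)) x y : dotv x (N *m y) =
  dotv (N^T *m x) y.
Proof. by rewrite /dotv trmx_mul trmxK mulmxA. Qed.

Lemma dotvDl m (x y z : 'cV[R]_m) : dotv (x + y) z = dotv x z + dotv y z.
Proof. by rewrite /dotv linearD/= mulmxDl mxE. Qed.

Lemma dotvDr m (x y z : 'cV[R]_m) : dotv x (y + z) = dotv x y + dotv x z.
Proof. by rewrite /dotv mulmxDr mxE. Qed.

Lemma dotvZl m (k : R) (x y : 'cV[R]_m) : dotv (k *: x) y = k * dotv x y.
Proof. by rewrite /dotv linearZ/= -scalemxAl mxE. Qed.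

Lemma dotvZr m (k : R) (x y : 'cV[R]_m) : dotv x (k *: y) = k * dotv x y.
Proof. by rewrite /dotv -scalemxAr mxE. Qed.

Lemma dotvNl m (x y : 'cV[R]_m) : dotv (- x) y = - dotv x y.
Proof. by rewrite -scaleN1r dotvZl mulN1r. Qed.

Lemma dotvNr m (x y : 'cV[R]_m) : dotv x (- y) = - dotv x y.
Proof. by rewrite -scaleN1r dotvZr mulN1r. Qed.

Lemma dotv0l m (y : 'cV[R]_m) : dotv 0 y = 0.
Proof. by rewrite /dotv linear0 mul0mx mxE. Qed.

Lemma dotv_ge0 m (x : 'cV[R]_m) : 0 <= dotv x x.
Proof. by rewrite dotvE; apply: sumr_ge0 => i _; exact: sqr_ge0. Qed.

Lemma dotv_eq0 m (x : 'cV[R]_m) : dotv x x = 0 -> x = 0.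
Proof.
rewrite dotvE => /eqP; rewrite psumr_eq0; last by move=> i _; exact: sqr_ge0.
move=> /allP x0; apply/colP => i; rewrite mxE.
by have := x0 i (mem_index_enum _); rewrite /= mulf_eq0 orbb => /eqP.
Qed.

Definition psd m (M : 'M[R]_m) : Prop :=
  M^T = M /\ forall x : 'cV_m, 0 <= dotv x (M *m x).

Lemma is_derive_dotv m (x y : R -> 'cV[R]_m) t dx dy :
  is_derive t (1 : R) x dx -> is_derive t (1 : R) y dy ->
  is_derive t (1 : R) (fun s => dotv (x s) (y s)) (dotv dx (y t) + dotv (x t)
    dy).
Proof.
move=> hx hy; have /is_derive_mxP/(_ 0 0) :=
  is_derive_mulmx (is_derive_trmx hx) hy.
by move=> h; apply: is_derive_ext h => //; rewrite mxE.
Qed.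

End dot_product.

(** * Backward uniqueness for linear matrix equations *)

Section ode_uniqueness.
Context {R : realType}.

Lemma continuous_comp_within (A : set R) (U V : topologicalType)
    (f : R -> U) (g : U -> V) :
  continuous g -> {within A, continuous f} -> {within A, continuous (g \o f)}.
Proof.
move=> cg cf x.
have := @continuous_comp (subspace A) U V f g x (cf x) (cg _).
by apply.
Qed.

Lemma within_continuous_coord (A : set R) p q (Z : R -> 'M[R]_(p, q)) i j :
  {within A, continuous Z} -> {within A, continuous (fun t => Z t i j)}.
Proof.
apply: (@continuous_comp_within _ _ _ Z (fun M : 'M[R]_(p, q) => M i j)).
exact: coord_continuous.
Qed.

Lemma continuous_mxP (U : topologicalType) p q (Z : U -> 'M[R]_(p, q)) :
  continuous Z <-> forall i j, continuous (fun t => Z t i j).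
Proof.
split=> [cZ i j x|cZ x].
  apply: (@continuous_comp _ _ _ Z (fun M : 'M[R]_(p, q) => M i j)).
    exact: cZ.
  exact: coord_continuous.
apply/cvgrPdist_le => /= e e0; near=> y.
rewrite /Num.Def.normr/= mx_normrE (bigmax_le _ (ltW e0))//= => i _.
rewrite !mxE.
move: i; near: y; apply: filter_forall => -[i j].
by have /cvgrPdist_le := cZ i j x; exact.
Unshelve. all: by end_near. Qed.

Lemma within_continuous_mulmx (A : set R) p q r
    (P : R -> 'M[R]_(p, q)) (Q : R -> 'M[R]_(q, r)) :
  {within A, continuous P} -> {within A, continuous Q} ->
  {within A, continuous (fun t => P t *m Q t)}.
Proof.
move=> /continuous_mxP cP /continuous_mxP cQ; apply/continuous_mxP => i j x.
rewrite /continuous_at.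
under eq_fun do rewrite mxE.
rewrite mxE.
by apply: cvg_sumr => k; apply: cvgM; [exact: cP|exact: cQ].
Qed.

Lemma is_derive_within_continuous (V : normedModType R) (f df : R -> V) A :
  (forall t, is_derive t (1 : R) f (df t)) -> {within A, continuous f}.
Proof.
by move=> hf; apply: continuous_subspaceT => t;
  exact: is_derive_continuous (hf t).
Qed.

(** The count behind the Gronwall constant: each [f i j] occurs [m] times in either role. *)
Lemma triple_sum m p (f : 'I_m -> 'I_p -> R) :
  \sum_i \sum_j \sum_l (f i j + f l j) = 2 * (\sum_i \sum_j f i j) * m%:R.
Proof.
have -> : \sum_i \sum_j \sum_l (f i j + f l j) =
    \sum_i ((\sum_j f i j) *+ m + \sum_l \sum_j f l j).
  apply: eq_bigr => i _; rewrite -sumrMnl [X in _ =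
    _ + X]exchange_big -big_split.
  by apply: eq_bigr => j _; rewrite big_split sumr_const card_ord.
rewrite big_split sumrMnl sumr_const card_ord/=.
by rewrite -mulrnDl -mulr2n -[LHS]mulr_natr -[X in X * _]mulr_natl.
Qed.

(* Gronwall, run backwards from [T] on the squared Frobenius norm of [Z]. *)
Lemma linear_ode_zero (T : R) m p (N : R -> 'M[R]_m) (Z : R -> 'M[R]_(m, p)) :
  {within `[0, T], continuous N} -> {within `[0, T], continuous Z} ->
  (forall t : R, 0 < t < T -> is_derive t (1 : R) Z (N t *m Z t)) ->
  Z T = 0 -> forall t : R, 0 <= t <= T -> Z t = 0.
Proof.
move=> cN cZ dZ ZT t /andP[t0 tT].
have T0 : 0 <= T by exact: le_trans tT.
have [C C0 hC] : exists2 C : R, 0 <= C & forall s : R, 0 <= s <= T ->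
    forall i j, `|N s i j| <= C.
  have cnN : {within `[0, T], continuous (fun s => `|N s|)}.
    by apply: continuous_comp_within cN; exact: norm_continuous.
  have [s0 _ hs] := EVT_max T0 cnN.
  exists `|N s0| => // s sT i j; apply: le_trans (hs s _);
    last by rewrite in_itv.
  rewrite [leRHS]/Num.Def.normr/= mx_normrE.
  by apply: (le_bigmax _ (fun ij : 'I_m * 'I_m => `|N s ij.1 ij.2|) (i, j)).
pose z s := \sum_i \sum_j Z s i j * Z s i j.
pose dz s := \sum_i \sum_j ((N s *m Z s) i j * Z s i j + Z s i j * (N s *m Z
  s) i j).
have z_ge0 s : 0 <= z s.
  by apply: sumr_ge0 => i _; apply: sumr_ge0 => j _; exact: sqr_ge0.
have hz (s : R) : 0 < s < T -> is_derive s (1 : R) z (dz s).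
  move=> /dZ/is_derive_mxP dZs.
  by apply: is_derive_sumr => i; apply: is_derive_sumr => j;
    exact: is_derive_Mr.
(* Each product [2 N_il Z_ij Z_lj] is at least [- C (Z_ij^2 + Z_lj^2)]; summing over [i], [j], [l]
   with [triple_sum] gives [- k z]. *)
pose k := 2 * C * m%:R.
have dz_ge (s : R) : 0 < s < T -> - (k * z s) <= dz s.
  move=> /andP[s0 sT].
  have hCs : forall i j, `|N s i j| <= C by apply: hC; rewrite !ltW.
  have -> : - (k * z s) = \sum_i \sum_j \sum_l
      - (C * (Z s i j * Z s i j + Z s l j * Z s l j)).
    rewrite /k (_ : 2 * C * m%:R * z s = C * (2 * z s * m%:R)); last by ring.
    rewrite /z -triple_sum mulr_sumr -sumrN.
    apply: eq_bigr => i _; rewrite mulr_sumr -sumrN.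
    by apply: eq_bigr => j _; rewrite mulr_sumr -sumrN.
  apply: ler_sum => i _; apply: ler_sum => j _.
  rewrite mxE mulr_suml mulr_sumr -big_split/=; apply: ler_sum => l _.
  have := hCs i l; rewrite ler_norml => /andP[N1 N2].
  have := sqr_ge0 (Z s i j + Z s l j); have := sqr_ge0 (Z s i j - Z s l j).
  rewrite sqrrB sqrrD !expr2.
  set a := Z s i j; set b := Z s l j; set c := N s i l => h1 h2.
  (* Adding [(C - c) (a - b)^2] and [(C + c) (a + b)^2] gives [2 C (a^2 + b^2) + 4 c a b], which is
     twice the required inequality. *)
  have h3 : 0 <= (C - c) * (a * a - a * b *+ 2 + b * b).
    by rewrite mulr_ge0// subr_ge0.
  have h4 : 0 <= (C + c) * (a * a + a * b *+ 2 + b * b).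
    by rewrite mulr_ge0// -lerBlDl sub0r.
  nra.
(* Integrating factor: [w] is nondecreasing and nonnegative, and it vanishes at [T]. *)
pose w s := expR (k * s) * z s.
have wE (s : R) : 0 < s < T ->
    is_derive s (1 : R) w (k * expR (k * s) * z s + expR (k * s) * dz s).
  move=> sT; apply: is_derive_Mr (hz _ sT).
  have := @is_derive_comp_affine R _ expR k 0 s _ (is_derive_expR _).
  by rewrite addr0; apply: is_derive_ext => // x; rewrite addr0.
have cw : {within `[0, T], continuous w}.
  move=> x; apply: cvgM.
    have hc : continuous (fun s : R => expR (k * s)).
      move=> s; apply: (@continuous_comp _ _ _ (fun s : R => k * s) (@expR R)).
        by apply: cvgM; [exact: cvg_cst|exact: cvg_id].
      exact: continuous_expR.
    exact: (continuous_subspaceT hc).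
  apply: cvg_sumr => i; apply: cvg_sumr => j.
  by apply: cvgM; exact: within_continuous_coord.
have wle : w t <= w T.
  apply: (ger0_derive1_ndecr _ _ cw t0 tT (lexx T)) => s;
    rewrite in_itv/= => sT.
    by case: (wE _ sT).
  have h := wE _ sT; rewrite derive1E (derive_val (is_derive := h)).
  rewrite [k * _]mulrC -mulrA -mulrDr mulr_ge0 ?expR_ge0//.
  by rewrite -lerBlDl sub0r; exact: dz_ge.
have zt0 : z t = 0.
  apply/le_anti; rewrite z_ge0 andbT.
  rewrite -(pmulr_rle0 _ (expR_gt0 (k * t))); apply: le_trans wle _.
  rewrite /w /z ZT big1 ?mulr0// => i _; rewrite big1// => j _.
  by rewrite mxE mulr0.
apply/matrixP => i j; rewrite mxE.
move/eqP: zt0; rewrite psumr_eq0 => [/allP/(_ i (mem_index_enum _))/=|];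
  last first.
  by move=> i' _; apply: sumr_ge0 => j' _; exact: sqr_ge0.
rewrite psumr_eq0 => [/allP/(_ j (mem_index_enum _))/=|]; last first.
  by move=> j' _; exact: sqr_ge0.
by rewrite mulf_eq0 orbb => /eqP.
Qed.

End ode_uniqueness.

Section derivable_inverse.
Context {R : realType}.

Lemma derivable_bigsum (I : Type) (r : seq I) (f : I -> R -> R) (t : R) :
  (forall i, derivable (f i) t 1) ->
  derivable (fun x => \sum_(i <- r) f i x) t 1.
Proof.
move=> df; elim: r => [|i r IH].
  by under eq_fun do rewrite big_nil; exact: derivable_cst.
under eq_fun do rewrite big_cons.
exact: (derivableD (df i) IH).
Qed.

Lemma derivable_bigprod (I : Type) (r : seq I) (f : I -> R -> R) (t : R) :
  (forall i, derivable (f i) t 1) ->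
  derivable (fun x => \prod_(i <- r) f i x) t 1.
Proof.
move=> df; elim: r => [|i r IH].
  by under eq_fun do rewrite big_nil; exact: derivable_cst.
under eq_fun do rewrite big_cons.
exact: (derivableM (df i) IH).
Qed.

Lemma derivable_det m (X : R -> 'M[R]_m) (t : R) :
  (forall i j, derivable (fun x => X x i j) t 1) ->
  derivable (fun x => \det (X x)) t 1.
Proof.
move=> dX; rewrite /determinant; apply: derivable_bigsum => s.
by apply: derivableM; [exact: derivable_cst|exact: derivable_bigprod].
Qed.

Lemma derivable_adjugate m (X : R -> 'M[R]_m) (t : R) :
  (forall i j, derivable (fun x => X x i j) t 1) ->
  forall i j, derivable (fun x => (\adj (X x)) i j) t 1.
Proof.
move=> dX i j; under eq_fun do rewrite mxE /cofactor.
apply: derivableM; first exact: derivable_cst.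
apply: derivable_det => k l.
by under eq_fun do rewrite !mxE; exact: dX.
Qed.

End derivable_inverse.

(** * The Riccati equation through its Hamiltonian system *)

Section riccati.
Context {R : realType} {m : nat}.
Variables (T : R) (F G M K : 'M[R]_m).

Definition hamiltonian : 'M[R]_(m + m) :=
  block_mx F (- (G *m G^T)) (- M) (- F^T).

Definition ham_flow (t : R) : 'M[R]_(m + m, m) :=
  mexp hamiltonian (t - T) *m col_mx 1%:M K.

Definition ham_state t : 'M[R]_m := usubmx (ham_flow t).
Definition ham_costate t : 'M[R]_m := dsubmx (ham_flow t).

Lemma is_derive_ham t :
  is_derive t (1 : R) ham_state (F *m ham_state t - G *m G^T *m ham_costate t)
    /\
  is_derive t (1 : R) ham_costate (- (M *m ham_state t) - F^T *m ham_costate t).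
Proof.
have dE : is_derive t (1 : R) (fun s => mexp hamiltonian (s - T))
    (hamiltonian *m mexp hamiltonian (t - T)).
  have := @is_derive_comp_affine R _ (mexp hamiltonian) 1 (- T) t
            (hamiltonian *m mexp hamiltonian (t - T)).
  rewrite mul1r scale1r => /(_ (is_derive_mexp _ _)).
  by apply: is_derive_ext => // z; rewrite mul1r.
have /is_derive_mxP h := is_derive_mulmxr (col_mx 1%:M K) dE.
have E : hamiltonian *m mexp hamiltonian (t - T) *m col_mx 1%:M K =
    col_mx (F *m ham_state t - G *m G^T *m ham_costate t)
           (- (M *m ham_state t) - F^T *m ham_costate t).
  rewrite -mulmxA -/(ham_flow t) -[ham_flow t]vsubmxK.
  by rewrite -/(ham_state t) -/(ham_costate t) mul_block_col !mulNmx.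
rewrite E in h; split; apply/is_derive_mxP => i j.
- apply: is_derive_ext (h (lshift _ i) j) => [x|]; last by rewrite col_mxEu.
  by rewrite /ham_state [RHS]mxE.
- apply: is_derive_ext (h (rshift _ i) j) => [x|]; last by rewrite col_mxEd.
  by rewrite /ham_costate [RHS]mxE.
Qed.

Lemma ham_state_T : ham_state T = 1%:M.
Proof. by rewrite /ham_state /ham_flow subrr mexp0 mul1mx col_mxKu. Qed.

Lemma ham_costate_T : ham_costate T = K.
Proof. by rewrite /ham_costate /ham_flow subrr mexp0 mul1mx col_mxKd. Qed.

Hypotheses (psdM : psd M) (psdK : psd K).

(* If [X(t0) v = 0], then [x = X v] and [y = Y v] satisfy
   [(x^T y)' = - |G^T y|^2 - x^T M x <= 0] while [x^T y] is [0] at [t0] and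
   nonnegative at [T]; hence [G^T y = 0], [x' = F x] and [v = x(T) = 0]. *)
Lemma ham_state_inj t0 (v : 'cV[R]_m) :
  t0 <= T -> ham_state t0 *m v = 0 -> v = 0.
Proof.
move=> t0T xt0.
pose x s := ham_state s *m v; pose y s := ham_costate s *m v.
have dx s : is_derive s (1 : R) x (F *m x s - G *m (G^T *m y s)).
  have [h _] := is_derive_ham s.
  apply: is_derive_ext (is_derive_mulmxr v h) => //.
  by rewrite mulmxBl !mulmxA.
have dy s : is_derive s (1 : R) y (- (M *m x s) - F^T *m y s).
  have [_ h] := is_derive_ham s.
  apply: is_derive_ext (is_derive_mulmxr v h) => //.
  by rewrite mulmxBl mulNmx !mulmxA.
pose phi s := dotv (x s) (y s).
pose dphi s := - (dotv (G^T *m y s) (G^T *m y s) + dotv (x s) (M *m x s)).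
have hphi s : is_derive s (1 : R) phi (dphi s).
  apply: is_derive_ext (is_derive_dotv (dx s) (dy s)) => //.
  rewrite dotvDl dotvNl dotvDr !dotvNr.
  rewrite [dotv _ (F^T *m _)]dotv_trmx trmxK.
  rewrite [dotv (G *m _) _]dotvC [dotv _ (G *m _)]dotv_trmx.
  by rewrite /dphi; ring.
have [symM posM] := psdM.
have dphi_le0 s : dphi s <= 0.
  by rewrite oppr_le0 addr_ge0 ?dotv_ge0.
have phiT : 0 <= phi T.
  rewrite /phi /x /y ham_state_T ham_costate_T mul1mx.
  by have [_ posK] := psdK; exact: posK.
have phi_dec a b : a <= b -> phi b <= phi a.
  move=> ab; apply: (ler0_derive1_nincr (a := a) (b := b)) => //.
  - by move=> s _; rewrite derive1E (derive_val (is_derive := hphi s)).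
  - exact: is_derive_within_continuous hphi.
have phit0 : phi t0 = 0 by rewrite /phi /x xt0 dotv0l.
have phi0 s : t0 <= s <= T -> phi s = 0.
  move=> /andP[t0s sT]; apply/le_anti/andP; split.
    by rewrite -phit0; exact: phi_dec.
  by apply: le_trans phiT _; exact: phi_dec.
have dphi0 s : t0 < s < T -> dphi s = 0.
  move=> /andP[t0s sT].
  (* [phi] vanishes on a neighbourhood of an interior point, so its derivative is zero there, and
     each of the two nonnegative terms of [dphi] must vanish. *)
  have h0 : is_derive s (1 : R) phi 0.
    apply: (is_derive_near _ (is_derive_cst (0 : R) s (1 : R))).
    near=> z; rewrite /= phi0//; apply/andP; split; apply/ltW; near: z.
      exact: lt_nbhsr.
    exact: lt_nbhsl.
  by rewrite -(derive_val (is_derive := hphi s)) (derive_val (is_derive := h0)).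
have Gy0 s : t0 < s < T -> G^T *m y s = 0.
  move=> /dphi0/eqP; rewrite oppr_eq0 paddr_eq0 ?dotv_ge0// => /andP[/eqP + _].
  exact: dotv_eq0.
(* Undoing the flow of [F] leaves only the control term in the derivative of [w]. As this term is
   zero inside the interval, [w] takes the same value at [t0] and at [T]. *)
pose w s := mexp F (- s) *m x s.
have dw s : is_derive s (1 : R) w (- (mexp F (- s) *m (G *m (G^T *m y s)))).
  have h1 : is_derive s (1 : R) (fun x => mexp F (- x)) (- (F *m mexp F (- s))).
    have := @is_derive_comp_affine R _ (mexp F) (-1) 0 s (F *m mexp F (- s)).
    rewrite mulN1r addr0 scaleN1r => /(_ (is_derive_mexp _ _)).
    by apply: is_derive_ext => // z; rewrite mulN1r addr0.
  apply: is_derive_ext (is_derive_mulmx h1 (dx s)) => //.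
  by rewrite mulmxBr mulNmx mexp_comm -!mulmxA addKr.
have : w T = w t0.
  apply/matrixP => i j.
  have dwij s : is_derive s (1 : R) (fun s => w s i j)
      ((- (mexp F (- s) *m (G *m (G^T *m y s)))) i j).
    by have /is_derive_mxP := dw s; exact.
  move: t0T; rewrite le_eqVlt => /predU1P[->//|t0T].
  have cw : {within `[t0, T], continuous (fun s => w s i j)}.
    exact: is_derive_within_continuous dwij.
  have [c cI /eqP] := MVT t0T (fun s _ => dwij s) cw.
  rewrite Gy0; last by move: cI; rewrite in_itv.
  by rewrite !mulmx0 oppr0 [X in _ == X * _]mxE mul0r subr_eq0 => /eqP.
rewrite [w t0]/w [x t0]/x xt0 mulmx0 /w /x ham_state_T mul1mx => wT.
by rewrite -[v]mul1mx -(mexpVr F T) -mulmxA wT mulmx0.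
Unshelve. all: by end_near. Qed.

(** A square matrix with trivial kernel is invertible; the transposes are there because [kermx] is a
    kernel of row vectors. *)
Lemma ham_state_unit t : t <= T -> ham_state t \in unitmx.
Proof.
move=> tT; rewrite -unitmx_tr -row_free_unit -kermx_eq0.
apply/eqP/row_matrixP => i; rewrite row0; apply: trmx_inj; rewrite trmx0.
apply: (ham_state_inj tT).
set k := row i _.
have kX : k *m (ham_state t)^T = 0 by rewrite -row_mul mulmx_ker row0.
by apply: trmx_inj; rewrite trmx_mul trmxK kX trmx0.
Qed.

(* Equals [ham_costate t *m invmx (ham_state t)] when [ham_state t] is
   invertible; the adjugate makes differentiability immediate. *)
Definition riccati_flow t : 'M[R]_m :=
  (\det (ham_state t))^-1 *: (ham_costate t *m \adj (ham_state t)).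

Lemma riccati_flowE t : t <= T ->
  riccati_flow t *m ham_state t = ham_costate t.
Proof.
move=> /ham_state_unit; rewrite unitmxE unitfE => d0.
by rewrite -scalemxAl -mulmxA mul_adj_mx mul_mx_scalar scalerA mulVf ?scale1r.
Qed.

Lemma derivable_riccati_flow t : t <= T -> derivable riccati_flow t 1.
Proof.
move=> /ham_state_unit; rewrite unitmxE unitfE => d0.
have [/is_derive_mxP dX /is_derive_mxP dY] := is_derive_ham t.
have dX' i j : derivable (fun x => ham_state x i j) t 1.
  by case: (dX i j).
have dY' i j : derivable (fun x => ham_costate x i j) t 1.
  by case: (dY i j).
apply/derivable_mxP => i j.
under eq_fun do rewrite !mxE.
apply: derivableM.
  by apply: derivableV => //; exact: derivable_det.
apply: derivable_bigsum => k.
by apply: derivableM => //; exact: derivable_adjugate.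
Qed.

(** Differentiating [P X = Y] gives [P' X = Y' - P X']; substituting the Hamiltonian system and
    cancelling the invertible [X] leaves the Riccati equation. *)
Lemma riccati_flow_sol : riccati_sol T F G M K riccati_flow.
Proof.
split.
- move=> x; apply: continuous_in_subspaceT => {}x.
  rewrite inE/= in_itv/= => /andP[_ xT].
  apply: differentiable_continuous; apply/derivable1_diffP.
  exact: derivable_riccati_flow.
- move=> t /andP[t0 tT].
  have [dX dY] := is_derive_ham t.
  have dP : is_derive t (1 : R) riccati_flow ('D_1 riccati_flow t).
    by apply: derivableP; exact/derivable_riccati_flow/ltW.
  have h := is_derive_mulmx dP dX.
  have h' : is_derive t (1 : R) ham_costate ('D_1 riccati_flow t *m ham_state
    t +
      riccati_flow t *m (F *m ham_state t - G *m G^T *m ham_costate t)).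
    (* The identity [P X = Y] is available only up to [T], hence on a neighbourhood of each
       [t < T]. *)
    apply: is_derive_near h; near=> z; apply: riccati_flowE; apply/ltW.
    near: z; exact: lt_nbhsl.
  have E : 'D_1 riccati_flow t *m ham_state t =
      - (M *m ham_state t) - F^T *m ham_costate t -
      riccati_flow t *m (F *m ham_state t - G *m G^T *m ham_costate t).
    have := derive_val (is_derive := h').
    by rewrite (derive_val (is_derive := dY)) => ->; rewrite addrK.
  suff -> : - (F^T *m riccati_flow t + riccati_flow t *m F -
      riccati_flow t *m G *m G^T *m riccati_flow t + M) = 'D_1 riccati_flow t.
    by [].
  have Xu : ham_state t \in unitmx by exact/ham_state_unit/ltW.
  apply: (can_inj (mulmxK Xu)); rewrite E.
  rewrite mulNmx !mulmxDl mulNmx -!mulmxA riccati_flowE ?ltW// mulmxBr.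
  by rewrite !mulmxA !opprD !opprK; apply/matrixP => i j; rewrite !mxE; ring.
- by rewrite /riccati_flow ham_state_T ham_costate_T det1 adj1 invr1 scale1r
  mulmx1.
Unshelve. all: by end_near. Qed.

(** The defect [Z = Y - P X] solves the homogeneous equation [Z' = (P G G^T - F^T) Z] with
    [Z T = 0]. This ties an arbitrary Riccati solution, and not only [riccati_flow], to the
    Hamiltonian system. *)
Lemma riccati_solE P : riccati_sol T F G M K P ->
  forall t, 0 <= t <= T -> P t *m ham_state t = ham_costate t.
Proof.
move=> [cP dP PT] t tT; apply/eqP; rewrite eq_sym -subr_eq0; apply/eqP.
pose Z s := ham_costate s - P s *m ham_state s.
have dX s := (is_derive_ham s).1.
have dY s := (is_derive_ham s).2.
have cY : {within `[0, T], continuous ham_costate}.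
  exact: is_derive_within_continuous dY.
have cX : {within `[0, T], continuous ham_state}.
  exact: is_derive_within_continuous dX.
have cC (N : 'M[R]_m) : {within `[0, T], continuous (fun _ : R => N)}.
  by apply: continuous_subspaceT => x; exact: cvg_cst.
have cN : {within `[0, T], continuous (fun s => P s *m (G *m G^T) - F^T)}.
  move=> x; apply: cvgB; last exact: cC.
  exact: (within_continuous_mulmx cP (cC _)).
have cZ : {within `[0, T], continuous Z}.
  move=> x; apply: cvgB; first exact: cY.
  exact: (within_continuous_mulmx cP cX).
apply: (linear_ode_zero cN cZ _ _ tT) => [s /dP dPs|]; last first.
  by rewrite /Z ham_costate_T ham_state_T PT mulmx1 subrr.
have dPX := is_derive_mulmx dPs (dX s).
apply: is_derive_ext (is_deriveB (dY s) dPX) => //.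
rewrite /Z !(mulmxDl, mulmxDr, mulNmx, mulmxN) !mulmxA.
by apply/matrixP => i j; rewrite !mxE; ring.
Qed.

(** Applying [X] and [Y] to the fixed vector [X(0)^-1 xi0] turns the terminal value problem into one
    with a prescribed initial state. The curves solve their equations on the whole line; only the
    feedback relation is confined to [[0, T]]. *)
Lemma hamiltonian_pair P (xi0 : 'cV[R]_m) : 0 <= T -> riccati_sol T F G M K P ->
  exists xi psi : R -> 'cV[R]_m,
  [/\ forall t, is_derive t (1 : R) xi (F *m xi t - G *m (G^T *m psi t)),
      forall t, is_derive t (1 : R) psi (- (M *m xi t) - F^T *m psi t),
      xi 0 = xi0,
      psi T = K *m xi T &
      forall t, 0 <= t <= T -> psi t = P t *m xi t].
Proof.
move=> T0 Psol; set v := invmx (ham_state 0) *m xi0.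
exists (fun t => ham_state t *m v), (fun t => ham_costate t *m v); split.
- move=> s; have [h _] := is_derive_ham s.
  apply: is_derive_ext (is_derive_mulmxr v h) => //.
  by rewrite mulmxBl !mulmxA.
- move=> s; have [_ h] := is_derive_ham s.
  apply: is_derive_ext (is_derive_mulmxr v h) => //.
  by rewrite mulmxBl mulNmx !mulmxA.
- by rewrite /v mulmxA mulmxV ?mul1mx// ham_state_unit.
- by rewrite ham_costate_T ham_state_T mul1mx.
- by move=> t tT; rewrite mulmxA (riccati_solE Psol).
Qed.

End riccati.

(** * The spaces L^2[0,1] and (L^2[0,1])^n *)

Section real_integrable.
Context d (X : measurableType d) {R : realType} (mu : {measure set X ->
  \bar R}).
Variables (D : set X) (mD : measurable D).
Implicit Types f g : X -> R.

Lemma rintegrableD f g : mu.-integrable D (fun x => (f x)%:E) ->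
  mu.-integrable D (fun x => (g x)%:E) -> mu.-integrable D (fun x => (f x + g
    x)%:E).
Proof. by move=> hf hg; exact: integrableD hf hg. Qed.

Lemma rintegrableB f g : mu.-integrable D (fun x => (f x)%:E) ->
  mu.-integrable D (fun x => (g x)%:E) -> mu.-integrable D (fun x => (f x - g
    x)%:E).
Proof. by move=> hf hg; exact: integrableB hf hg. Qed.

Lemma rintegrableZ k f : mu.-integrable D (fun x => (f x)%:E) ->
  mu.-integrable D (fun x => (k * f x)%:E).
Proof. by move=> hf; exact: integrableZl hf. Qed.

Lemma rintegrable0 : mu.-integrable D (fun x => (0 : R)%:E).
Proof. exact: integrable0. Qed.

Lemma rintegrable_sum n (f : 'I_n -> X -> R) :
  (forall i, mu.-integrable D (fun x => (f i x)%:E)) ->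
  mu.-integrable D (fun x => (\sum_i f i x)%:E).
Proof.
move=> hf; have := integrable_sum mD (index_enum 'I_n)
  (P := xpredT) (fun i _ => hf i).
by under eq_fun do rewrite /= sumEFin.
Qed.

Lemma rintegrable_le f g : measurable_fun D f ->
  mu.-integrable D (fun x => (g x)%:E) ->
  (forall x, D x -> `|f x| <= g x) -> mu.-integrable D (fun x => (f x)%:E).
Proof.
move=> mf ig fg; apply: (le_integrable mD _ _ ig).
  exact/measurable_EFinP.
by move=> x Dx /=; rewrite lee_fin (le_trans (fg x Dx))// ler_norm.
Qed.

Lemma rintegrable_measurable f : mu.-integrable D (fun x => (f x)%:E) ->
  measurable_fun D f.
Proof. by move=> hf; exact/measurable_EFinP/(measurable_int mu). Qed.

Lemma RintegralE f : mu.-integrable D (fun x => (f x)%:E) ->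
  (\int[mu]_(x in D) (f x)%:E)%E = (\int[mu]_(x in D) f x)%:E.
Proof. by move=> hf; rewrite fineK//; exact: integrable_fin_num. Qed.

Lemma Rintegral_sum n (f : 'I_n -> X -> R) :
  (forall i, mu.-integrable D (fun x => (f i x)%:E)) ->
  \int[mu]_(x in D) (\sum_i f i x) = \sum_i \int[mu]_(x in D) f i x.
Proof.
move=> hf; apply: EFin_inj; rewrite -RintegralE; last exact: rintegrable_sum.
under eq_integral do rewrite -sumEFin.
rewrite integral_sum// -sumEFin.
by apply: eq_bigr => i _; rewrite -RintegralE.
Qed.

Lemma rintegrable_cst (k : R) : (mu D < +oo)%E ->
  mu.-integrable D (fun x => k%:E).
Proof.
move=> Doo; apply/integrableP; split; first exact: measurable_cst.
rewrite (_ : (fun x => `|k%:E|)%E = cst `|k|%:E)//.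
by rewrite integral_cst// lte_mul_pinfty.
Qed.

End real_integrable.

Section L2_space.
Context {R : realType}.
Local Notation leb := (@lebesgue_measure R).
Local Notation U := (@unit_itv R).
Implicit Types (v w g : R -> R).

Lemma measurable_unit_itv : measurable U.
Proof. exact: measurable_itv. Qed.
Hint Resolve measurable_unit_itv : core.

Lemma L2P v : L2 v <-> measurable_fun U v /\
  leb.-integrable U (fun a => (v a ^+ 2)%:E).
Proof.
have mE : measurable_fun U v <-> measurable_fun setT (v \_ U).
  exact: measurable_restrictT.
have sqE : (fun a => ((v \_ U) a ^+ 2)%:E) = (fun a => (v a ^+ 2)%:E) \_ U.
  apply/funext => a; rewrite !patchE; case: ifP => // _.
  by rewrite expr0n.
have iE : leb.-integrable U (fun a => (v a ^+ 2)%:E) <->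
    leb.-integrable setT (fun a => ((v \_ U) a ^+ 2)%:E).
  by rewrite sqE; exact: integrable_mkcond.
split=> [|[mv iv]].
- rewrite /L2/= => hv; split.
    by apply/mE; move: hv; rewrite inE => /andP[/[!inE]].
  by apply/iE; exact: Lfun2_integrable_sqr.
- rewrite /L2/= inE; apply/andP; rewrite !inE/=; split; first exact/mE.
  rewrite /finite_norm unlock.
  apply: poweR_lty.
  move/iE : iv => /integrableP[_]; apply: le_lt_trans.
  under [leRHS]eq_integral do rewrite gee0_abs ?lee_fin ?sqr_ge0//.
  by under eq_integral do rewrite poweR_EFin powR_mulrn// real_normK
    ?num_real//.
Qed.

Lemma L2_measurable v : L2 v -> measurable_fun U v.
Proof. by move=> /L2P[]. Qed.

Lemma L2_integrableM v w : L2 v -> L2 w ->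
  leb.-integrable U (fun a => (v a * w a)%:E).
Proof.
move=> hv hw; have /Lfun1_integrable := Lfun2_mul_Lfun1 hv hw.
have -> : EFin \o v \_ U \* w \_ U = (fun a => (v a * w a)%:E) \_ U.
  apply/funext => a; rewrite /= !patchE; case: ifP => // _.
  by rewrite mul0r.
by move=> h; apply/integrable_mkcond.
Qed.

Lemma L2_lin (k : R) v w : L2 v -> L2 w -> L2 (k *: v + w).
Proof.
move=> hv hw; apply/L2P; split.
  apply: measurable_funD; last exact: L2_measurable.
  by apply: measurable_funM; [exact: measurable_cst|exact: L2_measurable].
have -> : (fun a => (((k *: v + w) a) ^+ 2)%:E) =
  (fun a => (k ^+ 2 * (v a * v a) + (2 * k * (v a * w a) + w a * w a))%:E).
  apply/funext => a; congr EFin.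
  have -> : (k *: v + w) a = k * v a + w a by [].
  by ring.
do ![apply: rintegrableD => //| apply: rintegrableZ => //];
  exact: L2_integrableM.
Qed.

Lemma L2_0 : L2 (0 : R -> R).
Proof.
apply/L2P; split; first exact: measurable_cst.
have -> : (fun a : R => ((0 : R -> R) a ^+ 2)%:E) = cst 0%E.
  by apply/funext => a; rewrite /= [(0 : R -> R) a]/(0 : R) expr0n.
exact: integrable0.
Qed.

Lemma L2Z (k : R) v : L2 v -> L2 (k *: v).
Proof. by move=> hv; rewrite -[k *: v]addr0; apply: L2_lin => //;
  exact: L2_0. Qed.

Lemma L2D v w : L2 v -> L2 w -> L2 (v + w).
Proof. by move=> hv; move=> hw; rewrite -[v]scale1r; exact: L2_lin. Qed.

Lemma L2_sum m (v : 'I_m -> R -> R) : (forall i, L2 (v i)) -> L2 (\sum_i v i).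
Proof. by move=> hv; apply: (big_ind (@L2 R)) => //;
  [exact: L2_0|exact: L2D]. Qed.

Lemma ipC v w : ip v w = ip w v.
Proof. by apply: eq_Rintegral => a _; rewrite mulrC. Qed.

Lemma ipDl v w g : L2 v -> L2 w -> L2 g -> ip (v + w) g = ip v g + ip w g.
Proof.
move=> hv hw hg; rewrite /ip -RintegralD//; try exact: L2_integrableM.
by apply: eq_Rintegral => a _; rewrite -mulrDl.
Qed.

Lemma ipZl (k : R) v g : L2 v -> L2 g -> ip (k *: v) g = k * ip v g.
Proof.
move=> hv hg; rewrite /ip -RintegralZl//; last exact: L2_integrableM.
by apply: eq_Rintegral => a _; rewrite mulrA.
Qed.

Lemma ip_ge0 v : 0 <= ip v v.
Proof. by apply: Rintegral_ge0 => a _; exact: sqr_ge0. Qed.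

Lemma ip_ae v w g : measurable_fun U v -> measurable_fun U w ->
  measurable_fun U g -> L2eq v w -> ip v g = ip w g.
Proof.
move=> mv mw mg vw; congr fine; apply: ae_eq_integral => //.
- exact/measurable_EFinP/measurable_funM.
- exact/measurable_EFinP/measurable_funM.
- by apply: filterS vw => a vwa Ua; rewrite vwa.
Qed.

Lemma ip_eq0 v : L2 v -> ip v v = 0 -> L2eq v 0.
Proof.
move=> hv v0.
have iv := L2_integrableM hv hv.
have : (\int[leb]_(a in U) `|(v a * v a)%:E| = 0)%E.
  have -> : (\int[leb]_(a in U) `|(v a * v a)%:E| =
    \int[leb]_(a in U) (v a * v a)%:E)%E.
    by apply: eq_integral => a _; rewrite gee0_abs// lee_fin; exact: sqr_ge0.
  rewrite -[LHS]fineK; last exact: integrable_fin_num.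
  by rewrite -[fine _]/(ip v v) v0.
move/(ae_eq_integral_abs _ measurable_unit_itv (measurable_int _ iv)).
apply: filterS => a va0 Ua; have /eqP := va0 Ua.
by rewrite eqe mulf_eq0 orbb => /eqP.
Qed.

End L2_space.

(* No measurability is assumed: the integral is a difference of suprema over
   simple functions. *)
Lemma le_integralW d (X : measurableType d) (R : realType)
    (mu : {measure set X -> \bar R}) (D : set X) (f g : X -> \bar R) :
  (forall x, D x -> (f x <= g x)%E) ->
  (\int[mu]_(x in D) f x <= \int[mu]_(x in D) g x)%E.
Proof.
move=> fg; rewrite /integral/=.
have fg' x : ((f \_ D) x <= (g \_ D) x)%E by exact: lee_restrict.
apply: leeB; apply: ge_ereal_sup => _ [h /= hh <-];
  apply: ereal_sup_ubound; exists h => //= x; apply: le_trans (hh x) _.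
- by apply: (@funepos_le _ _ setT) => [y _|]; [exact: fg'|rewrite inE].
- by apply: (@funeneg_le _ _ setT) => [y _|]; [exact: fg'|rewrite inE].
Qed.

(** * Fubini for a bounded kernel between two integrable functions *)

Section bounded_kernel.
Context {R : realType}.
Local Notation leb := (@lebesgue_measure R).
Variables (k : measurableTypeR R * measurableTypeR R -> R) (C : R).
Hypotheses (mk : measurable_fun setT k) (kC : forall z, `|k z| <= C).

Lemma measurable_kernelr a : measurable_fun setT (fun b : measurableTypeR R =>
  k (a, b)).
Proof. exact: (measurableT_comp mk (measurable_pair1 a)). Qed.

Lemma measurable_kernell b : measurable_fun setT (fun a : measurableTypeR R =>
  k (a, b)).
Proof. exact: (measurableT_comp mk (measurable_pair2 b)). Qed.

Lemma integrable_bounded_mul (D : set (measurableTypeR R)) (h th : R ->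
  R) (K : R) :
  measurable D -> measurable_fun D h ->
  (forall b, D b -> `|h b| <= K) -> leb.-integrable D (EFin \o th) ->
  leb.-integrable D (fun b => (h b * th b)%:E).
Proof.
move=> mD mh hK ith.
apply: (rintegrable_le _ _ (rintegrableZ mD K (integrable_norm ith))) => //.
  by apply: measurable_funM => //; exact: rintegrable_measurable ith.
by move=> b Db; rewrite normrM ler_wpM2r// hK.
Qed.

Variables (ka th : R -> R).
Hypotheses (ika : leb.-integrable setT (EFin \o ka))
  (ith : leb.-integrable setT (EFin \o th)).

Let f (z : measurableTypeR R * measurableTypeR R) : \bar R :=
  (ka z.1 * (k z * th z.2))%:E.

Let mf : measurable_fun setT f.
Proof.
have mka := rintegrable_measurable ika.
have mth := rintegrable_measurable ith.
apply/measurable_EFinP; apply: measurable_funM.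
  exact: (measurableT_comp mka measurable_fst).
by apply: measurable_funM => //; exact: (measurableT_comp mth measurable_snd).
Qed.

Lemma integrable_kernelr a : leb.-integrable setT (fun b => (k (a,
  b) * th b)%:E).
Proof.
by apply: (@integrable_bounded_mul _ _ _ C) => //; exact: measurable_kernelr.
Qed.

Lemma integrable_kernell b : leb.-integrable setT (fun a => (k (a,
  b) * ka a)%:E).
Proof.
by apply: (@integrable_bounded_mul _ _ _ C) => //; exact: measurable_kernell.
Qed.

(** Tonelli: the iterated integral of [|f|] is at most [C] times the product of the [L^1] norms of
    [ka] and [th]. *)
Let int_f : (leb \x leb)%E.-integrable setT f.
Proof.
apply/(integrable12ltyP leb leb mf).
pose I := \int[leb]_b `|th b|.
have -> : (\int[leb]_x \int[leb]_y `|f (x, y)| =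
    \int[leb]_x (`|ka x| * \int[leb]_y `|k (x, y) * th y|)%:E)%E.
  apply: eq_integral => x _.
  rewrite EFinM -RintegralE//; last exact/integrable_norm/integrable_kernelr.
  rewrite -ge0_integralZl_EFin//; last first.
    by apply/measurable_EFinP/measurableT_comp => //;
      exact: rintegrable_measurable (integrable_kernelr x).
  by apply: eq_integral => y _; rewrite /f/= normrM EFinM.
apply: (@le_lt_trans _ _ (\int[leb]_x ((C * I) * `|ka x|)%:E)%E); last first.
  have := rintegrableZ measurableT (C * I) (integrable_norm ika).
  move=> h; rewrite RintegralE//; exact: ltry.
apply: le_integralW => x _; rewrite lee_fin mulrC.
rewrite ler_wpM2r// /I -RintegralZl//; last exact: integrable_norm.
apply: le_Rintegral => //.
- exact/integrable_norm/integrable_kernelr.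
- exact/rintegrableZ/integrable_norm.
- by move=> y _; rewrite normrM ler_wpM2r.
Qed.

Lemma measurable_kernel_integral :
  measurable_fun setT (fun a => ka a * \int[leb]_b (k (a, b) * th b)).
Proof.
apply/measurable_EFinP; apply: eq_measurable_fun (measurable_fubini_F int_f).
move=> x _; rewrite /fubini_F /f/=.
have := RintegralE measurableT (rintegrableZ measurableT (ka x)
  (integrable_kernelr x)).
by move=> ->; rewrite RintegralZl//; exact: integrable_kernelr.
Qed.

Lemma integrable_kernel_integral :
  leb.-integrable setT (fun a => (ka a * \int[leb]_b (k (a, b) * th b))%:E).
Proof.
apply: eq_integrable (integrable_fubini_F int_f) => //.
move=> x _; rewrite /fubini_F /f/=.
have := RintegralE measurableT (rintegrableZ measurableT (ka x)
  (integrable_kernelr x)).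
by move=> ->; rewrite RintegralZl//; exact: integrable_kernelr.
Qed.

(** Serves twice: with a graphon as kernel it gives self-adjointness, and with the indicator of
    [s <= r] it gives integration by parts. *)
Lemma kernel_fubini :
  \int[leb]_a (ka a * \int[leb]_b (k (a, b) * th b)) =
  \int[leb]_b (th b * \int[leb]_a (k (a, b) * ka a)).
Proof.
congr fine.
transitivity (\int[leb]_x \int[leb]_y f (x, y))%E.
  apply: eq_integral => x _.
  rewrite -RintegralZl//; last exact: integrable_kernelr.
  by rewrite -RintegralE//; exact/rintegrableZ/integrable_kernelr.
rewrite (Fubini int_f); apply: eq_integral => y _.
rewrite -RintegralZl//; last exact: integrable_kernell.
rewrite -RintegralE//; last exact/rintegrableZ/integrable_kernell.
by apply: eq_integral => x _; rewrite /f/=; congr EFin; ring.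
Qed.

End bounded_kernel.

Section graphon_operator.
Context {R : realType}.
Local Notation leb := (@lebesgue_measure R).
Local Notation U := (@unit_itv R).
Implicit Types (v w : R -> R).

Lemma leb_unit_itv : leb U = 1%E.
Proof. by rewrite lebesgue_measure_itv/= lte_fin ltr01 oppr0 adde0. Qed.

Lemma leb_unit_itv_lty : (leb U < +oo)%E.
Proof. by rewrite leb_unit_itv ltry. Qed.

Lemma L2_cst1 : L2 (cst 1 : R -> R).
Proof.
apply/L2P; split; first exact: measurable_cst.
under eq_fun do rewrite /= expr1n.
apply: rintegrable_cst; first exact: measurable_unit_itv.
exact: leb_unit_itv_lty.
Qed.

Lemma L2_integrable v : L2 v -> leb.-integrable U (EFin \o v).
Proof.
move=> hv.
have := L2_integrableM L2_cst1 hv; apply: eq_integrable => //.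
  exact: measurable_unit_itv.
by move=> a _ /=; rewrite mul1r.
Qed.

Lemma bounded_L2 v (K : R) : measurable_fun U v ->
  (forall a, U a -> `|v a| <= K) -> L2 v.
Proof.
move=> mv vK; apply/L2P; split => //.
apply: (@rintegrable_le _ _ _ _ _ measurable_unit_itv _ (fun=> K ^+ 2)).
- exact: measurable_funX.
- apply: rintegrable_cst; first exact: measurable_unit_itv.
  exact: leb_unit_itv_lty.
- by move=> a Ua; rewrite normrX lerXn2r ?nnegrE ?vK// (le_trans _ (vK a Ua)).
Qed.

Variables (A : R * R -> R) (c : R) (hA : graphon c A).

(** Extension by zero off the unit square, so that the kernel is measurable and bounded on the whole
    plane. The bound [|c|] also covers the value zero. *)
Let k (z : measurableTypeR R * measurableTypeR R) : R := (A \_ (U `*` U)) z.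

Let mk : measurable_fun setT k.
Proof.
have [mA _ _] := hA.
apply/(measurable_restrictT _ _).1 => //.
by apply: measurableX; exact: measurable_unit_itv.
Qed.

Let kc z : `|k z| <= `|c|.
Proof.
have [_ _ Ac] := hA; rewrite /k patchE; case: ifPn => [|_];
  last by rewrite normr0.
rewrite inE/= => -[z1 z2]; have := Ac _ _ z1 z2.
rewrite -surjective_pairing -ler_norml => /le_trans; apply; exact: ler_norm.
Qed.

Let restr_int v : L2 v -> leb.-integrable setT (EFin \o (v \_ U)).
Proof.
move=> hv; rewrite -restrict_EFin.
exact: (integrable_mkcond _ measurable_unit_itv).1 (L2_integrable hv).
Qed.

Lemma graphon_opE v a : U a ->
  graphon_op A v a = \int[leb]_b (k (a, b) * (v \_ U) b).
Proof.
move=> Ua; rewrite /graphon_op Rintegral_mkcond; apply: eq_Rintegral => b _.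
rewrite /k !patchE; case: ifPn => Ub; last by rewrite mulr0.
by rewrite ifT// inE; split => //=; move: Ub; rewrite inE.
Qed.

(** The image is bounded by [|c|] times the [L^1] norm of [v], and bounded measurable functions on
    [[0,1]] are square integrable. *)
Lemma graphon_op_L2 v : L2 v -> L2 (graphon_op A v).
Proof.
move=> hv.
apply: (@bounded_L2 _ (`|c| * \int[leb]_b `|(v \_ U) b|)).
  have h1 := restr_int L2_cst1.
  have := measurable_kernel_integral mk kc h1 (restr_int hv).
  move/(measurable_funS measurableT (@subsetT _ U)).
  apply: eq_measurable_fun => a; rewrite inE => Ua.
  by rewrite graphon_opE// patchE mem_set// mul1r.
move=> a Ua; rewrite graphon_opE//.
have ik := integrable_kernelr mk kc (restr_int hv) a.
apply: le_trans (le_normr_Rintegral _ ik) _ => //.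
rewrite -RintegralZl//; last exact/integrable_norm/restr_int.
apply: le_Rintegral => //.
- exact: integrable_norm ik.
- exact/rintegrableZ/integrable_norm/restr_int.
- by move=> y _; rewrite normrM ler_wpM2r.
Qed.

(** Holds at every node of [U], not merely almost everywhere, since each slice of the bounded kernel
    is integrable against every [L2] function. *)
Lemma graphon_op_lin (s : R) v w a : U a -> L2 v -> L2 w ->
  graphon_op A (s *: v + w) a = s * graphon_op A v a + graphon_op A w a.
Proof.
move=> Ua hv hw; rewrite !graphon_opE//.
have iv := integrable_kernelr mk kc (restr_int hv) a.
have iw := integrable_kernelr mk kc (restr_int hw) a.
rewrite -RintegralZl// -RintegralD//; last exact: rintegrableZ.
apply: eq_Rintegral => b _; rewrite !patchE; case: ifP => _.
  have -> : (s *: v + w) b = s * v b + w b by [].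
  by ring.
by rewrite !mulr0 addr0.
Qed.

Lemma graphon_op_ae v w a : U a -> L2 v -> L2 w -> L2eq v w ->
  graphon_op A v a = graphon_op A w a.
Proof.
move=> Ua hv hw vw; rewrite !graphon_opE//.
have iv := integrable_kernelr mk kc (restr_int hv) a.
have iw := integrable_kernelr mk kc (restr_int hw) a.
congr fine; apply: ae_eq_integral => //.
- exact: measurable_int iv.
- exact: measurable_int iw.
- apply: filterS vw => b vwb _; rewrite !patchE; case: ifPn => //.
  by rewrite inE => /vwb ->.
Qed.

Lemma graphon_op_sa v w : L2 v -> L2 w ->
  ip (graphon_op A v) w = ip v (graphon_op A w).
Proof.
have [_ Asym _] := hA.
move=> hv hw.
transitivity (\int[leb]_a ((w \_ U) a * \int[leb]_b (k (a, b) * (v \_ U) b))).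
  rewrite /ip Rintegral_mkcond; apply: eq_Rintegral => a _.
  rewrite !patchE; case: ifPn => Ua; last by rewrite mul0r.
  by rewrite mulrC graphon_opE//; move: Ua; rewrite inE.
rewrite (kernel_fubini mk kc (restr_int hw) (restr_int hv)).
rewrite /ip [RHS]Rintegral_mkcond; apply: eq_Rintegral => a _.
rewrite !patchE; case: ifPn => Ua; last by rewrite mul0r.
have Ua' : U a by move: Ua; rewrite inE.
rewrite graphon_opE//; congr (_ * _); apply: eq_Rintegral => b _.
rewrite /k !patchE; congr (_ * _).
have -> : ((b, a) \in U `*` U) = ((a, b) \in U `*` U).
  by apply/idP/idP; rewrite !inE => -[].
by case: ifPn => //; rewrite inE => -[_ Ub]; rewrite Asym.
Qed.

End graphon_operator.

Section H_space.
Context {R : realType} {n : nat}.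
Local Notation leb := (@lebesgue_measure R).
Local Notation U := (@unit_itv R).
Local Notation H := (Hvec R n).
Implicit Types (v w g : H).

Lemma coord_fun_lin (k : R) v w i :
  coord_fun (k *: v + w) i = k *: coord_fun v i + coord_fun w i.
Proof. by apply/funext => a; rewrite /coord_fun !mxE. Qed.

Lemma coord_funZ (k : R) v i : coord_fun (k *: v) i = k *: coord_fun v i.
Proof. by apply/funext => a; rewrite /coord_fun !mxE. Qed.

Lemma coord_funD v w i : coord_fun (v + w) i = coord_fun v i + coord_fun w i.
Proof. by apply/funext => a; rewrite /coord_fun !mxE. Qed.

Lemma inH0 : inH (0 : H).
Proof.
move=> i; rewrite (_ : coord_fun 0 i = 0); first exact: L2_0.
by apply/funext => a; rewrite /coord_fun !mxE.
Qed.

Lemma inHD v w : inH v -> inH w -> inH (v + w).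
Proof. by move=> hv hw i; rewrite coord_funD; exact: L2D. Qed.

Lemma inHZ (k : R) v : inH v -> inH (k *: v).
Proof. by move=> hv i; rewrite coord_funZ; exact: L2Z. Qed.

Lemma inHB v w : inH v -> inH w -> inH (v - w).
Proof. by move=> hv hw; rewrite -scaleN1r; apply: inHD => //; exact: inHZ. Qed.

Lemma inH_sum m (v : 'I_m -> H) : (forall i, inH (v i)) -> inH (\sum_i v i).
Proof. by move=> hv; apply: (big_ind (@inH R n)) => //;
  [exact: inH0|exact: inHD]. Qed.

Lemma inH_sum_nat m (v : nat -> H) : (forall i, inH (v i)) ->
  inH (\sum_(0 <= i < m) v i).
Proof. by move=> hv; apply: (big_ind (@inH R n)) => //;
  [exact: inH0|exact: inHD]. Qed.

Lemma HipC v w : Hip v w = Hip w v.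
Proof. by apply: eq_bigr => i _; exact: ipC. Qed.

Lemma HipDl v w g : inH v -> inH w -> inH g -> Hip (v + w) g =
  Hip v g + Hip w g.
Proof.
move=> hv hw hg; rewrite /Hip -big_split; apply: eq_bigr => i _ /=.
by rewrite coord_funD ipDl.
Qed.

Lemma HipZl (k : R) v g : inH v -> inH g -> Hip (k *: v) g = k * Hip v g.
Proof.
move=> hv hg; rewrite /Hip mulr_sumr; apply: eq_bigr => i _.
by rewrite coord_funZ ipZl.
Qed.

Lemma HipDr v w g : inH v -> inH w -> inH g -> Hip g (v + w) =
  Hip g v + Hip g w.
Proof. by move=> *; rewrite HipC HipDl// !(HipC g). Qed.

Lemma HipZr (k : R) v g : inH v -> inH g -> Hip g (k *: v) = k * Hip g v.
Proof. by move=> *; rewrite HipC HipZl// !(HipC g). Qed.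

Lemma HipBl v w g : inH v -> inH w -> inH g -> Hip (v - w) g =
  Hip v g - Hip w g.
Proof.
move=> hv hw hg; rewrite -scaleN1r HipDl ?HipZl ?mulN1r//; exact: inHZ.
Qed.

Lemma HipBr v w g : inH v -> inH w -> inH g -> Hip g (v - w) =
  Hip g v - Hip g w.
Proof. by move=> *; rewrite HipC HipBl// !(HipC g). Qed.

Lemma Hip0l g : inH g -> Hip 0 g = 0.
Proof. by move=> hg; rewrite -(scale0r 0) HipZl ?mul0r//; exact: inH0. Qed.

Lemma Hip_suml m (v : 'I_m -> H) g : (forall i, inH (v i)) -> inH g ->
  Hip (\sum_i v i) g = \sum_i Hip (v i) g.
Proof.
move=> hv hg; have [] // : inH (\sum_i v i) /\ Hip (\sum_i v i) g =
  \sum_i Hip (v i) g.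
apply: (big_ind2 (fun x y => inH x /\ Hip x g = y)).
- by split; [exact: inH0|exact: Hip0l].
- move=> x1 x2 y1 y2 [h1 e1] [h2 e2]; split; first exact: inHD.
  by rewrite HipDl// e1 e2.
- by move=> i _; split.
Qed.

Lemma Hip_sumr m (v : 'I_m -> H) g : (forall i, inH (v i)) -> inH g ->
  Hip g (\sum_i v i) = \sum_i Hip g (v i).
Proof.
by move=> hv hg; rewrite HipC Hip_suml//; apply: eq_bigr => i _; rewrite HipC.
Qed.

Lemma Hip_ge0 v : 0 <= Hip v v.
Proof. by apply: sumr_ge0 => i _; exact: ip_ge0. Qed.

Lemma HeqP v w : Heq v w <-> forall i, L2eq (coord_fun v i) (coord_fun w i).
Proof.
split=> [vw i|vw]; first by apply: filterS vw => a h /h;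
  rewrite /coord_fun => ->.
have h0 : {ae leb, forall a, forall i, U a -> coord_fun v i a =
  coord_fun w i a}.
  exact: filter_forall.
apply: filterS h0 => a h Ua.
by apply/colP => i; exact: h.
Qed.

Lemma Heq_refl v : Heq v v.
Proof. exact: aeW. Qed.

Lemma eq_Heq v w : (forall a, U a -> v a = w a) -> Heq v w.
Proof. by move=> h; apply: aeW => a Ua; exact: h. Qed.

Lemma Heq_sym v w : Heq v w -> Heq w v.
Proof. by apply: filterS => a h /h ->. Qed.

Lemma Heq_trans g v w : Heq v g -> Heq g w -> Heq v w.
Proof. by apply: filterS2 => a h1 h2 Ua; rewrite h1// h2. Qed.

Lemma Heq_lin (k : R) v v' w w' :
  Heq v v' -> Heq w w' -> Heq (k *: v + w) (k *: v' + w').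
Proof.
apply: filterS2 => a h1 h2 Ua.
by rewrite -[LHS]/(k *: v a + w a) -[RHS]/(k *: v' a + w' a) h1// h2.
Qed.

Lemma HeqD v v' w w' : Heq v v' -> Heq w w' -> Heq (v + w) (v' + w').
Proof. by move=> *; rewrite -[v]scale1r -[v']scale1r; exact: Heq_lin. Qed.

Lemma HeqZ (k : R) v v' : Heq v v' -> Heq (k *: v) (k *: v').
Proof.
by move=> *; rewrite -[k *: v]addr0 -[k *: v']addr0; apply: Heq_lin => //;
  exact: Heq_refl.
Qed.

Lemma HeqB v v' w w' : Heq v v' -> Heq w w' -> Heq (v - w) (v' - w').
Proof. by move=> *; rewrite -(scaleN1r w) -(scaleN1r w'); apply: HeqD => //;
  exact: HeqZ. Qed.

Lemma Hip_aeL v w g : inH v -> inH w -> inH g -> Heq v w -> Hip v g = Hip w g.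
Proof.
move=> hv hw hg /HeqP vw; apply: eq_bigr => i _.
by apply: ip_ae => //; exact: L2_measurable.
Qed.

Lemma Hip_aeR v w g : inH v -> inH w -> inH g -> Heq v w -> Hip g v = Hip g w.
Proof. by move=> *; rewrite HipC [RHS]HipC; exact: Hip_aeL. Qed.

Lemma Hip_eq0 v : inH v -> Hip v v = 0 -> Heq v 0.
Proof.
move=> hv /eqP; rewrite psumr_eq0; last by move=> i _; exact: ip_ge0.
move=> /allP v0; apply/HeqP => i.
have /eqP := v0 i (mem_index_enum _) => /(ip_eq0 (hv i)).
by apply: filterS => a h /h ->; rewrite /coord_fun mxE.
Qed.

Lemma Heq_subr0 v w : Heq (v - w) 0 -> Heq v w.
Proof.
apply: filterS => a h /h /eqP; rewrite -[(v - w) a]/(v a - w a).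
by rewrite subr_eq0 => /eqP.
Qed.

Lemma Hnorm_ge0 v : 0 <= Hnorm v.
Proof. exact: sqrtr_ge0. Qed.

Lemma sqr_Hnorm v : Hnorm v ^+ 2 = Hip v v.
Proof. by rewrite sqr_sqrtr// Hip_ge0. Qed.

Lemma Hnorm_ae v w : inH v -> inH w -> Heq v w -> Hnorm v = Hnorm w.
Proof. by move=> hv hw vw; rewrite /Hnorm (Hip_aeL hv hw hv vw) (Hip_aeR hv hw
  hw vw). Qed.

Lemma Hnorm_eq0 v : inH v -> Hnorm v = 0 -> Heq v 0.
Proof. by move=> hv v0; apply: Hip_eq0 => //; rewrite -sqr_Hnorm v0 expr0n. Qed.

Lemma HnormZ (k : R) v : inH v -> Hnorm (k *: v) = `|k| * Hnorm v.
Proof.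
move=> hv; rewrite /Hnorm HipZl//; last exact: inHZ.
by rewrite HipZr// mulrA -expr2 sqrtrM ?sqr_ge0// sqrtr_sqr.
Qed.

(** The form [|s v + t w|^2] is nonnegative. With [s = c] and [t = - a] it reads
    [c (b c - a^2) >= 0], which settles [c > 0]; the degenerate case [c = 0] takes another
    choice. *)
Lemma Hip_CS v w : inH v -> inH w -> `|Hip v w| <= Hnorm v * Hnorm w.
Proof.
move=> hv hw; rewrite -(@ler_pXn2r _ 2)// ?nnegrE ?mulr_ge0 ?Hnorm_ge0//.
rewrite exprMn !sqr_Hnorm real_normK ?num_real//.
set a := Hip v w; set b := Hip v v; set c := Hip w w.
have key s t : 0 <= s ^+ 2 * b + 2 * s * t * a + t ^+ 2 * c.
  have := Hip_ge0 (s *: v + t *: w).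
  have sv := inHZ s hv; have tw := inHZ t hw.
  rewrite (HipDl sv tw (inHD sv tw)) (HipDr sv tw sv) (HipDr sv tw tw).
  rewrite (HipZl s hv sv) (HipZl s hv tw) (HipZl t hw sv) (HipZl t hw tw).
  rewrite (HipZr s hv hv) (HipZr t hw hv) (HipZr s hv hw) (HipZr t hw hw).
  by rewrite [Hip w v]HipC -/a -/b -/c => /le_trans; apply; rewrite le_eqVlt;
     apply/orP; left; apply/eqP; ring.
have b0 : 0 <= b by exact: Hip_ge0.
have c0 : 0 <= c by exact: Hip_ge0.
have := key c (- a).
have -> : c ^+ 2 * b + 2 * c * - a * a + (- a) ^+ 2 * c = c * (b * c - a ^+ 2).
  by ring.
move: c0; rewrite le_eqVlt => /predU1P[c0|c0]; last first.
  by rewrite pmulr_rge0// subr_ge0.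
rewrite -c0 mulr0 => _.
have := key 1 (- ((b + 1) * a)).
rewrite -c0 mulr0 addr0 expr1n mul1r mulr1 => h.
have a2 := sqr_ge0 a; have b3 : 0 <= b * a ^+ 2 by exact: mulr_ge0.
(* When [c = 0] this choice gives [a^2 (- b - 2) >= 0], which forces [a = 0] because [b >= 0]. *)
have h2 := key (a) (- (b + 1)).
rewrite -c0 mulr0 addr0 in h2.
have : 0 <= a ^+ 2 * (- b - 2).
  by apply: le_trans h2 _; rewrite le_eqVlt; apply/orP; left; apply/eqP; ring.
nra.
Qed.

Lemma ler_HnormD v w : inH v -> inH w -> Hnorm (v + w) <= Hnorm v + Hnorm w.
Proof.
move=> hv hw; rewrite -(@ler_pXn2r _ 2)// ?nnegrE ?addr_ge0 ?Hnorm_ge0//.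
rewrite sqrrD !sqr_Hnorm HipDl ?HipDr//; try exact: inHD.
have := le_trans (ler_norm _) (Hip_CS hv hw); rewrite [Hip w v]HipC; lra.
Qed.

Lemma ler_Hnorm_sum m (v : 'I_m -> H) : (forall i, inH (v i)) ->
  Hnorm (\sum_i v i) <= \sum_i Hnorm (v i).
Proof.
move=> hv; have [] // : inH (\sum_i v i) /\ Hnorm (\sum_i v i) <= \sum_i Hnorm
  (v i).
apply: (big_ind2 (fun x y => inH x /\ Hnorm x <= y)).
- split; first exact: inH0.
  by rewrite /Hnorm Hip0l ?sqrtr0//; exact: inH0.
- move=> x1 x2 y1 y2 [h1 e1] [h2 e2]; split; first exact: inHD.
  by apply: le_trans (ler_HnormD h1 h2) _; exact: lerD.
- by move=> i _; split.
Qed.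

Lemma HnormB v w : inH v -> inH w -> Hnorm (v - w) = Hnorm (w - v).
Proof.
by move=> hv hw; rewrite -(opprB w v) -(scaleN1r (w - v)) HnormZ ?normrN1
  ?mul1r//; exact: inHB.
Qed.

Lemma Hcvg_unique (s : nat -> H) v w : (forall k, inH (s k)) -> inH v ->
  inH w ->
  Hcvg s v -> Hcvg s w -> Heq v w.
Proof.
move=> hs hv hw sv sw; apply: Heq_subr0; apply: Hnorm_eq0; first exact: inHB.
apply/le_anti/andP; split; last exact: Hnorm_ge0.
have h : Hnorm (s k - v) + Hnorm (s k - w) @[k --> \oo] --> (0 + 0 : R).
  exact: (cvgD sv sw).
rewrite addr0 in h.
apply: (cvgr_to_ge h); apply: nearW => k.
have -> : v - w = (v - s k) + (s k - w) by rewrite addrA subrK.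
rewrite [X in _ <= X + _]HnormB//.
by apply: ler_HnormD; exact: inHB.
Qed.

Lemma Hcvg_Hip (s : nat -> H) v g : (forall k, inH (s k)) -> inH v -> inH g ->
  Hcvg s v -> Hip g (s k) @[k --> \oo] --> Hip g v.
Proof.
move=> hs hv hg sv.
apply/cvgrPdist_le => e e0.
have h : Hnorm g * Hnorm (s k - v) @[k --> \oo] --> (0 : R).
  by rewrite -[0 in X in _ --> X](mulr0 (Hnorm g)); apply: cvgM => //;
    exact: cvg_cst.
move/cvgrPdist_le : h => /(_ _ e0); apply: filterS => k.
rewrite sub0r normrN ger0_norm ?mulr_ge0 ?Hnorm_ge0//.
apply: le_trans; rewrite distrC -HipBr//; apply: Hip_CS => //; exact: inHB.
Qed.

Lemma Hcvg_ae (s s' : nat -> H) v v' :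
  (forall k, inH (s k)) -> (forall k, inH (s' k)) -> inH v -> inH v' ->
  (forall k, Heq (s k) (s' k)) -> Heq v v' -> Hcvg s v -> Hcvg s' v'.
Proof.
move=> hs hs' hv hv' ss' vv'; rewrite /Hcvg.
have E k : Hnorm (s' k - v') = Hnorm (s k - v).
  exact/esym/(Hnorm_ae (inHB (hs k) hv) (inHB (hs' k) hv') (HeqB (ss' k) vv')).
by rewrite (funext E); exact: id.
Qed.

End H_space.

(** * Operators on finite families and their exponentials *)

Section families.
Context {R : realType} {n : nat}.
Local Notation H := (Hvec R n).

(** The synthesis operator of the family; [moments] is its adjoint. As [h] may be linearly
    dependent, a vector does not determine its coefficients. *)
Definition synth m (h : 'I_m -> H) (y : 'cV[R]_m) : H := \sum_j y j 0 *: h j.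

Definition moments m (h : 'I_m -> H) (v : H) : 'cV[R]_m := \col_j Hip (h j) v.

Section synthesis.
Context {m : nat} (h : 'I_m -> H) (hH : forall j, inH (h j)).

Lemma synth_inH y : inH (synth h y).
Proof. by apply: inH_sum => j; exact: inHZ. Qed.

Lemma synth_lin (k : R) y z : synth h (k *: y + z) = k *: synth h y + synth h z.
Proof.
rewrite /synth scaler_sumr -big_split; apply: eq_bigr => j _ /=.
by rewrite !mxE scalerDl scalerA.
Qed.

Lemma synthD y z : synth h (y + z) = synth h y + synth h z.
Proof. by rewrite -[y]scale1r synth_lin !scale1r. Qed.

Lemma synth0 : synth h 0 = 0.
Proof. by rewrite /synth big1// => j _; rewrite mxE scale0r. Qed.

Lemma synthZ (k : R) y : synth h (k *: y) = k *: synth h y.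
Proof. by rewrite -[k *: y]addr0 synth_lin synth0 addr0. Qed.

Lemma synthN y : synth h (- y) = - synth h y.
Proof. by rewrite -(scaleN1r y) synthZ scaleN1r. Qed.

Lemma synthB y z : synth h (y - z) = synth h y - synth h z.
Proof. by rewrite synthD synthN. Qed.

Lemma synth_sum_nat N (y : nat -> 'cV[R]_m) :
  synth h (\sum_(0 <= k < N) y k) = \sum_(0 <= k < N) synth h (y k).
Proof. by apply: (big_morph (synth h)); [exact: synthD|exact: synth0]. Qed.

Lemma Hip_synth y v : inH v -> Hip (synth h y) v = dotv y (moments h v).
Proof.
move=> hv; rewrite dotvE Hip_suml//; last by move=> j; exact: inHZ.
by apply: eq_bigr => j _; rewrite HipZl// mxE.
Qed.

Lemma Hnorm_synth_le y : Hnorm (synth h y) <= \sum_j `|y j 0| * Hnorm (h j).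
Proof.
apply: le_trans (ler_Hnorm_sum _) _; first by move=> j; exact: inHZ.
by apply: ler_sum => j _; rewrite HnormZ.
Qed.

Lemma cvg_Hnorm_synth (y : nat -> 'cV[R]_m) :
  (forall j, y k j 0 @[k --> \oo] --> (0 : R)) ->
  Hnorm (synth h (y k)) @[k --> \oo] --> (0 : R).
Proof.
move=> y0.
apply: (@squeeze_cvgr _ _ _ _ (fun=> 0) (fun k => \sum_j `|y k j 0| * Hnorm (h
  j))).
- by apply: nearW => k; rewrite Hnorm_ge0 Hnorm_synth_le.
- exact: cvg_cst.
- have hs : \sum_j `|y k j 0| * Hnorm (h j) @[k --> \oo] -->
      \sum_j `|0 : R| * Hnorm (h j).
    apply: cvg_sumr => j; apply: cvgM; last exact: cvg_cst.
    by apply: cvg_norm; exact: y0.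
  apply: cvg_trans hs _; rewrite big1// => j _.
  by rewrite normr0 mul0r.
Qed.

End synthesis.

Definition Hlinear (P : H -> H) : Prop :=
  [/\ forall v, inH v -> inH (P v),
      forall v w, inH v -> inH w -> Heq v w -> Heq (P v) (P w) &
      forall (k : R) v w, inH v -> inH w ->
        Heq (P (k *: v + w)) (k *: P v + P w)].

Definition acts_by (P : H -> H) m (h : 'I_m -> H) (F : 'M[R]_m) : Prop :=
  forall y, Heq (P (synth h y)) (synth h (F *m y)).

(* The adjoint of [P] acts on the span of [h] by the transpose of [F]. *)
Definition coacts_by (P : H -> H) m (h : 'I_m -> H) (F : 'M[R]_m) : Prop :=
  forall y v, inH v -> Hip (synth h y) (P v) = Hip (synth h (F^T *m y)) v.

(* Under this property the series defining [expop] lives in a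
   finite-dimensional space, so completeness of (L^2[0,1])^n is not needed. *)
Definition locally_finite (P : H -> H) : Prop :=
  forall v, inH v -> exists m (h : 'I_m -> H) (F : 'M[R]_m) (y : 'cV[R]_m),
    [/\ forall j, inH (h j), acts_by P h F & Heq v (synth h y)].

Section exponential.
Variables (P : H -> H) (PH : Hlinear P).

Lemma iter_inH k v : inH v -> inH (iter k P v).
Proof. by have [h _ _] := PH; move=> hv; elim: k => //= k; exact: h. Qed.

Lemma expop_sum_inH t v k : inH v ->
  inH (series (fun j => (t ^+ j / j`!%:R) *: iter j P v) k).
Proof. by move=> hv; apply: inH_sum_nat => i; apply: inHZ; exact: iter_inH. Qed.

Section acting.
Context {m : nat} (h : 'I_m -> H) (F : 'M[R]_m).
Hypotheses (hH : forall j, inH (h j)) (hF : acts_by P h F).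

Lemma iter_acts k v y : inH v -> Heq v (synth h y) ->
  Heq (iter k P v) (synth h (F ^+ k *m y)).
Proof.
have [P1 P2 _] := PH.
move=> hv vy; elim: k => [|k IH]; first by rewrite expr0 mul1mx.
rewrite iterS exprS -mulmxA; apply: Heq_trans (hF _).
by apply: P2 => //; [exact: iter_inH|exact: synth_inH].
Qed.

(** Up to almost everywhere equality the partial sums are syntheses of those of the matrix
    exponential, which converge entrywise. *)
Lemma expop_acts_cvg t v y : inH v -> Heq v (synth h y) ->
  Hcvg (series (fun j => (t ^+ j / j`!%:R) *: iter j P v))
    (synth h (mexp F t *m y)).
Proof.
move=> hv vy.
pose s K := \sum_(0 <= k < K) (t ^+ k / k`!%:R) *: (F ^+ k *m y).
apply: (@Hcvg_ae _ _ (fun K => synth h (s K)) _ (synth h (mexp F t *m y))).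
- by move=> K; exact: synth_inH.
- by move=> K; exact: expop_sum_inH.
- exact: synth_inH.
- exact: synth_inH.
- move=> K; rewrite synth_sum_nat /series/=.
  apply: (big_ind2 (@Heq R n)) => [|*|k _]; [exact: Heq_refl|exact: HeqD|].
  by rewrite synthZ; apply: HeqZ; apply: Heq_sym; exact: iter_acts.
- exact: Heq_refl.
rewrite /Hcvg; under eq_fun do rewrite -synthB.
apply: cvg_Hnorm_synth => // j.
under eq_fun do rewrite mxE [X in _ + X]mxE.
rewrite -(subrr ((mexp F t *m y) j 0)).
by apply: cvgB; [exact: cvg_mexp_mulmx|exact: cvg_cst].
Qed.

(** A limit of the series exists, so [xget] returns some limit, and limits in [H] are unique up to
    almost everywhere equality. *)
Lemma expop_acts t v y : inH v -> Heq v (synth h y) ->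
  Heq (expop P t v) (synth h (mexp F t *m y)).
Proof.
move=> hv vy; have ex := expop_acts_cvg t hv vy.
have [e1 e2] : [set w | inH w /\
    Hcvg (series (fun j => (t ^+ j / j`!%:R) *: iter j P v)) w] (expop P t v).
  apply: xgetPex; exists (synth h (mexp F t *m y)).
  by split; [exact: synth_inH|exact: ex].
apply: (@Hcvg_unique _ _ _ _ _ _ e1 (synth_inH hH _) e2 ex) => k.
exact: expop_sum_inH.
Qed.

End acting.

Hypothesis Pfin : locally_finite P.

Lemma expop_spec t v : inH v -> inH (expop P t v) /\
  Hcvg (series (fun j => (t ^+ j / j`!%:R) *: iter j P v)) (expop P t v).
Proof.
move=> hv; have [m [h [F [y [hH hF vy]]]]] := Pfin hv.
suff : [set w | inH w /\
    Hcvg (series (fun j => (t ^+ j / j`!%:R) *: iter j P v)) w] (expop P t v)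
      by [].
apply: xgetPex; exists (synth h (mexp F t *m y)).
by split; [exact: synth_inH|exact: expop_acts_cvg].
Qed.

Lemma expop_inH t v : inH v -> inH (expop P t v).
Proof. by move=> /(expop_spec t)[]. Qed.

Lemma expop_ae t v w : inH v -> inH w -> Heq v w ->
  Heq (expop P t v) (expop P t w).
Proof.
move=> hv hw vw; have [m [h [F [y [hH hF vy]]]]] := Pfin hv.
apply: (Heq_trans (expop_acts hH hF t hv vy)); apply: Heq_sym.
by apply: expop_acts => //; apply: Heq_trans vy; exact: Heq_sym.
Qed.

(** The adjoint of an exponential is the exponential of the adjoint, read on the span of [h] only.
    As [v] is arbitrary in [H], this reaches states outside the span. *)
Lemma expop_coacts m (h : 'I_m -> H) (F : 'M[R]_m) t y v :
  (forall j, inH (h j)) -> coacts_by P h F -> inH v ->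
  Hip (synth h y) (expop P t v) = Hip (synth h (mexp F^T t *m y)) v.
Proof.
move=> hH hF hv; have [e1 e2] := expop_spec t hv.
have hs := Hcvg_Hip (fun k => @expop_sum_inH t v k hv) e1 (synth_inH hH y) e2.
rewrite -(cvg_lim (@Rhausdorff R) hs); apply: cvg_lim => //.
have it k : Hip (synth h y) (iter k P v) = Hip (synth h (F^T ^+ k *m y)) v.
  elim: k y {hs} => [|k IH] y; first by rewrite expr0 mul1mx.
  rewrite iterS hF; last exact: iter_inH.
  by rewrite IH exprSr mulmxA.
have E k : Hip (synth h y) (series (fun j => (t ^+ j / j`!%:R) *: iter j P v)
  k) =
    dotv (\sum_(0 <= j < k) (t ^+ j / j`!%:R) *: (F^T ^+ j *m y)) (moments h v).
  rewrite -Hip_synth//; elim: k => [|k IH].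
    by rewrite /series/= !big_nil synth0 HipC !Hip0l//; exact: synth_inH.
  rewrite /series/= !big_nat_recr//= synthD synthZ HipDr//; last 3 first.
  - exact: expop_sum_inH.
  - by apply: inHZ; exact: iter_inH.
  - exact: synth_inH.
  rewrite HipDl//; [|exact: synth_inH|by apply: inHZ; exact: synth_inH].
  rewrite IH HipZr//; [|exact: iter_inH|exact: synth_inH].
  by rewrite HipZl//; [rewrite it|exact: synth_inH].
rewrite Hip_synth// dotvE; under eq_fun do rewrite E dotvE.
by apply: cvg_sumr => j; apply: cvgM; [exact: cvg_mexp_mulmx|exact: cvg_cst].
Qed.

End exponential.
End families.

Section network_operator.
Context {R : realType} {n : nat}.
Local Notation leb := (@lebesgue_measure R).
Local Notation U := (@unit_itv R).
Local Notation H := (Hvec R n).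

Lemma ip_suml m (v : 'I_m -> R -> R) g : (forall i, L2 (v i)) -> L2 g ->
  ip (\sum_i v i) g = \sum_i ip (v i) g.
Proof.
move=> hv hg; have [] // : L2 (\sum_i v i) /\ ip (\sum_i v i) g =
  \sum_i ip (v i) g.
apply: (big_ind2 (fun x y => L2 x /\ ip x g = y)).
- split; first exact: L2_0.
  by rewrite -(scale0r 0) ipZl ?mul0r//; exact: L2_0.
- move=> x1 x2 y1 y2 [h1 e1] [h2 e2]; split; first exact: L2D.
  by rewrite ipDl// e1 e2.
- by move=> i _; split.
Qed.

Lemma ip_sumr m (v : 'I_m -> R -> R) g : (forall i, L2 (v i)) -> L2 g ->
  ip g (\sum_i v i) = \sum_i ip g (v i).
Proof.
by move=> hv hg; rewrite ipC ip_suml//; apply: eq_bigr => i _; rewrite ipC.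
Qed.

Lemma ipDr (v w g : R -> R) : L2 v -> L2 w -> L2 g ->
  ip g (v + w) = ip g v + ip g w.
Proof. by move=> *; rewrite ipC ipDl// !(ipC g). Qed.

Lemma ipZr (k : R) (v g : R -> R) : L2 v -> L2 g -> ip g (k *: v) = k * ip g v.
Proof. by move=> *; rewrite ipC ipZl// !(ipC g). Qed.

Lemma sum_mxtens (V : nmodType) d m (G : 'I_(d * m) -> V) :
  \sum_j G j = \sum_l \sum_i G (mxtens_index (l, i)).
Proof.
rewrite pair_big/= (reindex (@mxtens_index d m)); last first.
  by exists (@mxtens_unindex d m) => i _; rewrite ?mxtens_indexK
    ?mxtens_unindexK.
by apply: eq_bigr => -[l i].
Qed.

(** The functions [phi_l] times the canonical vectors [e_i], ordered so that [*t] acts on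
    coefficients block by block. *)
Definition tens d (phi : 'I_d -> R -> R) : 'I_(d * n) -> H :=
  fun j a => phi (mxtens_unindex j).1 a *: delta_mx (mxtens_unindex j).2 0.

Lemma vblock_lin d (k : R) (y z : 'cV[R]_(d * n)) l :
  vblock (k *: y + z) l = k *: vblock y l + vblock z l.
Proof. by apply/colP => i; rewrite !mxE. Qed.

Lemma vblock_tens d (N : 'M[R]_d) (L : 'M[R]_n) (y : 'cV[R]_(d * n)) l :
  vblock (N *t L *m y) l = \sum_k N l k *: (L *m vblock y k).
Proof.
apply/colP => i; rewrite !mxE summxE sum_mxtens; apply: eq_bigr => k _.
rewrite !mxE mulr_sumr; apply: eq_bigr => j _.
by rewrite !mxE !mxtens_indexK/= mulrA.
Qed.

Lemma vblock_tens1 d (L : 'M[R]_n) (y : 'cV[R]_(d * n)) l :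
  vblock ((1%:M : 'M[R]_d) *t L *m y) l = L *m vblock y l.
Proof.
rewrite vblock_tens (bigD1 l)//= mxE eqxx scale1r big1 ?addr0// => k kl.
by rewrite mxE eq_sym (negbTE kl) scale0r.
Qed.

Lemma fct_sum_apply (V : nmodType) m (v : 'I_m -> R -> V) a :
  (\sum_i v i) a = \sum_i v i a.
Proof. by rewrite (big_morph (fun g : R -> V => g a) (id1 := 0) (op1 := +%R)).
  Qed.

Lemma scaleHE (k : R) (v : H) a : (k *: v) a = k *: v a.
Proof. by []. Qed.

Lemma synth_tens d (phi : 'I_d -> R -> R) (y : 'cV[R]_(d * n)) (a : R) :
  synth (tens phi) y a = \sum_l phi l a *: vblock y l.
Proof.
rewrite /synth fct_sum_apply sum_mxtens; apply: eq_bigr => l _.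
apply/colP => i; rewrite !mxE summxE (bigD1 i)//= big1 => [|j ji].
  rewrite scaleHE /tens mxtens_indexK/= !mxE !eqxx.
  by rewrite mulr1 addr0 mulrC.
rewrite scaleHE /tens mxtens_indexK/= !mxE.
by rewrite eq_sym (negbTE ji) !mulr0.
Qed.

Section tensor_family.
Context {d : nat} (phi : 'I_d -> R -> R) (phiL2 : forall l, L2 (phi l)).

Lemma coord_fun_tens l i i' :
  coord_fun (tens phi (mxtens_index (l, i))) i' = (i' == i)%:R *: phi l.
Proof.
apply/funext => a; rewrite /coord_fun /tens mxtens_indexK/= !mxE eqxx andbT.
by rewrite mulrC.
Qed.

Lemma tens_inH j : inH (tens phi j).
Proof. by case: (mxtens_indexP j) => l i i'; rewrite coord_fun_tens;
  exact: L2Z. Qed.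

Lemma Hip_tens l i (v : H) : inH v ->
  Hip (tens phi (mxtens_index (l, i))) v = ip (phi l) (coord_fun v i).
Proof.
move=> hv; rewrite /Hip (bigD1 i)//= coord_fun_tens eqxx scale1r big1 ?addr0//.
move=> j ji; rewrite coord_fun_tens (negbTE ji) scale0r.
by rewrite -(scale0r 0) ipZl ?mul0r//; exact: L2_0.
Qed.

Lemma coord_fun_synth_tens y i :
  coord_fun (synth (tens phi) y) i = \sum_l y (mxtens_index (l, i)) 0 *: phi l.
Proof.
apply/funext => a; rewrite /coord_fun synth_tens summxE fct_sum_apply.
by apply: eq_bigr => l _; rewrite !mxE mulrC.
Qed.

End tensor_family.

Section netop.
Variables (L D : 'M[R]_n) (A : R * R -> R) (c : R) (hA : graphon c A).

Lemma coord_fun_netop v i : coord_fun (netop L D A v) i =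
  \sum_j L i j *: coord_fun v j + \sum_j D i j *: graphon_op A (coord_fun v j).
Proof.
apply/funext => a; rewrite /coord_fun /netop !mxE.
rewrite -[RHS]/((\sum_j L i j *: coord_fun v j) a +
  (\sum_j D i j *: graphon_op A (coord_fun v j)) a).
rewrite !fct_sum_apply; congr (_ + _); apply: eq_bigr => j _ //.
by rewrite mxE.
Qed.

Lemma netop_linear : Hlinear (netop L D A).
Proof.
split=> [v hv i|v w hv hw vw|k v w hv hw].
- rewrite coord_fun_netop; apply: L2D; apply: L2_sum => j; apply: L2Z => //.
  exact: (graphon_op_L2 hA).
- apply: filterS (vw) => a vwa Ua; rewrite /netop vwa//; congr (_ + _ *m _).
  apply/colP => i; rewrite !mxE; apply: (graphon_op_ae hA) => //.
  by move/HeqP : vw; exact.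
- apply: eq_Heq => a Ua.
  rewrite -[RHS]/(k *: netop L D A v a + netop L D A w a) /netop.
  rewrite -[(k *: v + w) a]/(k *: v a + w a) mulmxDr -scalemxAr.
  rewrite (_ : \col_i graphon_op A (coord_fun (k *: v + w) i) a =
    k *: (\col_i graphon_op A (coord_fun v i) a) +
    \col_i graphon_op A (coord_fun w i) a).
    by rewrite mulmxDr -scalemxAr scalerDr addrACA.
  by apply/colP => i; rewrite !mxE coord_fun_lin (graphon_op_lin hA).
Qed.

Context {d : nat} (phi : 'I_d -> R -> R) (phiL2 : forall l, L2 (phi l)).
Variable N : 'M[R]_d.
Hypothesis AN : forall l, L2eq (graphon_op A (phi l)) (\sum_k N l k *: phi k).

Let F : 'M[R]_(d * n) := 1%:M *t L + N *t D.

(** Row [l] of [N] expands the image of [phi_l], so coefficients are transformed by [N^T]; symmetry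
    is what allows [N *t D] to be written. *)
Lemma netop_acts : N^T = N -> acts_by (netop L D A) (tens phi) F.
Proof.
move=> symN y.
(* The finitely many almost everywhere identities are merged, so that one null set serves all
   [l]. *)
have h0 : {ae leb, forall a, forall l, U a ->
    graphon_op A (phi l) a = (\sum_k N l k *: phi k) a}.
  exact: filter_forall.
apply: filterS h0 => a ha Ua.
have opE i : graphon_op A (coord_fun (synth (tens phi) y) i) a =
    \sum_l y (mxtens_index (l, i)) 0 * \sum_k N l k * phi k a.
  rewrite coord_fun_synth_tens.
  have [] // : L2 (\sum_l y (mxtens_index (l, i)) 0 *: phi l) /\
    graphon_op A (\sum_l y (mxtens_index (l, i)) 0 *: phi l) a =
    \sum_l y (mxtens_index (l, i)) 0 * \sum_k N l k * phi k a.
  apply: (big_ind2 (fun x z => L2 x /\ graphon_op A x a = z)).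
  - split; first exact: L2_0.
    (* Linearity with the scalar [-1] at [0] gives that the image of [0] vanishes at [a]. *)
    have h := graphon_op_lin hA (-1) Ua (@L2_0 R) (@L2_0 R).
    by rewrite scaler0 addr0 mulN1r addNr in h.
  - move=> x1 x2 z1 z2 [h1 e1] [h2 e2]; split; first exact: L2D.
    by rewrite -[x1]scale1r (graphon_op_lin hA)// e1 e2 mul1r.
  - move=> l _; split; first exact: L2Z.
    rewrite -[_ *: phi l]addr0 (graphon_op_lin hA)//; last exact: L2_0.
    have h := graphon_op_lin hA (-1) Ua (@L2_0 R) (@L2_0 R).
    rewrite scaler0 addr0 mulN1r addNr in h; rewrite h addr0 ha//.
    by rewrite fct_sum_apply.
rewrite /netop !synth_tens mulmx_sumr.
have -> : D *m (\col_i graphon_op A (coord_fun (synth (tens phi) y) i) a) =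
    \sum_l phi l a *: \sum_k N l k *: (D *m vblock y k).
  rewrite (_ : \col_i _ = \sum_l phi l a *: \sum_k N l k *: vblock y k).
    rewrite mulmx_sumr; apply: eq_bigr => l _; rewrite -scalemxAr mulmx_sumr.
    by congr (_ *: _); apply: eq_bigr => k _; rewrite -scalemxAr.
  apply/colP => i; rewrite mxE opE summxE.
  under [RHS]eq_bigr => l _ do rewrite mxE summxE mulr_sumr.
  under [LHS]eq_bigr => l _ do rewrite mulr_sumr.
  rewrite exchange_big; apply: eq_bigr => k _; apply: eq_bigr => l _ /=.
  by rewrite !mxE -[in LHS]symN mxE; ring.
rewrite -big_split; apply: eq_bigr => l _ /=.
rewrite -scalemxAr -scalerDr /F mulmxDl -[1%:M *t L *m y]scale1r vblock_lin
  scale1r.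
by rewrite vblock_tens1 vblock_tens.
Qed.

(** Self-adjointness moves the graphon operator onto [phi_l], where row [l] of [N] expands it. Only
    [A] is moved, since [L] and [D] may fail to be symmetric; hence the transpose of [F] in
    [netop_coacts]. *)
Lemma netop_moments v : inH v ->
  moments (tens phi) (netop L D A v) = F *m moments (tens phi) v.
Proof.
move=> hv; have [PH _ _] := netop_linear; apply/colP => j.
case: (mxtens_indexP j) => l i; rewrite mxE Hip_tens//; last exact: PH.
rewrite coord_fun_netop.
have hgo i' := graphon_op_L2 hA (hv i').
rewrite ipDr//; [|by apply: L2_sum => ?; exact: L2Z|by apply: L2_sum => ?;
  exact: L2Z].
rewrite !ip_sumr//; [|by move=> ?; exact: L2Z|by move=> ?; exact: L2Z].
rewrite /F mulmxDl mxE; congr (_ + _).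
  rewrite mxE sum_mxtens (bigD1 l)//= [X in _ = _ + X]big1 ?addr0.
    apply: eq_bigr => k _; rewrite ipZr// !mxE !mxtens_indexK/= eqxx mul1r.
    by rewrite Hip_tens.
  move=> k kl; rewrite big1// => i' _; rewrite !mxE !mxtens_indexK/=.
  by rewrite eq_sym (negbTE kl) !mul0r.
rewrite mxE sum_mxtens exchange_big; apply: eq_bigr => k _ /=.
rewrite ipZr// -(graphon_op_sa hA)//.
rewrite (@ip_ae _ _ (\sum_k N l k *: phi k)) //; last first.
- exact: L2_measurable (hv k).
- by apply: L2_measurable; apply: L2_sum => ?; exact: L2Z.
- by apply: L2_measurable; exact: (graphon_op_L2 hA).
rewrite ip_suml//; last by move=> ?; exact: L2Z.
rewrite mulr_sumr; apply: eq_bigr => l' _.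
by rewrite ipZl// !mxE !mxtens_indexK/= Hip_tens//; ring.
Qed.

Lemma netop_coacts : coacts_by (netop L D A) (tens phi) F.
Proof.
move=> y v hv; have [PH _ _] := netop_linear.
rewrite !Hip_synth//; try exact: tens_inH; last exact: PH.
by rewrite netop_moments// dotv_trmx.
Qed.

End netop.

Section concatenation.
Context {m1 m2 : nat} (h1 : 'I_m1 -> H) (h2 : 'I_m2 -> H).

Definition catfam (j : 'I_(m1 + m2)) : H :=
  match fintype.split j with inl i => h1 i | inr i => h2 i end.

Lemma synth_cat y1 y2 :
  synth catfam (col_mx y1 y2) = synth h1 y1 + synth h2 y2.
Proof.
rewrite /synth big_split_ord; congr (_ + _); apply: eq_bigr => j _.
  by rewrite col_mxEu /catfam (unsplitK (inl _ j)).
by rewrite col_mxEd /catfam (unsplitK (inr _ j)).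
Qed.

Hypotheses (h1H : forall j, inH (h1 j)) (h2H : forall j, inH (h2 j)).

Lemma catfam_inH j : inH (catfam j).
Proof. by rewrite /catfam; case: fintype.split. Qed.

Variables (P : H -> H) (F1 : 'M[R]_m1) (F2 : 'M[R]_m2).

Lemma acts_cat : Hlinear P -> acts_by P h1 F1 -> acts_by P h2 F2 ->
  acts_by P catfam (block_mx F1 0 0 F2).
Proof.
move=> [P1 P2 P3] hF1 hF2 y; rewrite -[y]vsubmxK mul_block_col !mul0mx.
rewrite addr0 add0r !synth_cat -[synth h1 (usubmx y)]scale1r.
have i1 : inH (synth h1 (usubmx y)) by exact: synth_inH.
have i2 : inH (synth h2 (dsubmx y)) by exact: synth_inH.
apply: (Heq_trans (P3 1 _ _ i1 i2)); rewrite -[synth h1 (F1 *m _)]scale1r.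
by apply: Heq_lin; [exact: hF1|exact: hF2].
Qed.

Lemma coacts_cat : Hlinear P -> coacts_by P h1 F1 -> coacts_by P h2 F2 ->
  coacts_by P catfam (block_mx F1 0 0 F2).
Proof.
move=> [P1 P2 P3] hF1 hF2 y v hv; have hPv := P1 v hv.
rewrite -[y]vsubmxK tr_block_mx mul_block_col !trmx0 !mul0mx.
rewrite addr0 add0r !synth_cat !HipDl//; try exact: synth_inH.
by rewrite hF1// hF2.
Qed.

End concatenation.
End network_operator.

(** * Bochner integrals *)

Import HBSimple.

Section bochner.
Context {R : realType} {n : nat}.
Local Notation leb := (@lebesgue_measure R).
Local Notation H := (Hvec R n).
Variables (D : set (measurableTypeR R)).
Hypotheses (mD : measurable D) (Doo : (leb D < +oo)%E).

(** Couples a function of time with the value of its integral, so that sums can be formed without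
    handling the records [Hsimple]. *)
Definition simple_repr (F : R -> H) (w : H) : Prop :=
  exists s : Hsimple R n, (forall t, hs_fun s t = F t) /\ hs_integral D s = w.

Lemma simple_repr0 : simple_repr (fun=> 0) 0.
Proof.
pose s := @Build_Hsimple R n 0 (fun=> set0) (fun=> 0)
  (fun=> measurable0) (fun=> @inH0 R n).
by exists s; split=> [t|]; rewrite /hs_fun /hs_integral big_ord0.
Qed.

Lemma simple_reprD F1 F2 w1 w2 : simple_repr F1 w1 -> simple_repr F2 w2 ->
  simple_repr (fun t => F1 t + F2 t) (w1 + w2).
Proof.
move=> [[m1 A1 e1 mA1 he1] [E1 I1]] [[m2 A2 e2 mA2 he2] [E2 I2]].
pose A j := match fintype.split j with inl i => A1 i | inr i => A2 i end.
pose e (j : 'I_(m1 + m2)) : H :=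
  match fintype.split j with inl i => e1 i | inr i => e2 i end.
have mA j : measurable (A j) by rewrite /A; case: fintype.split.
have he j : inH (e j) by rewrite /e; case: fintype.split.
exists (Build_Hsimple mA he); split=> [t|].
- rewrite -E1 -E2 /hs_fun /= big_split_ord/=.
  by congr (_ + _); apply: eq_bigr => j _;
    rewrite /A /e ?(unsplitK (inl _ j)) ?(unsplitK (inr _ j)).
- rewrite -I1 -I2 /hs_integral /= big_split_ord/=.
  by congr (_ + _); apply: eq_bigr => j _;
    rewrite /A /e ?(unsplitK (inl _ j)) ?(unsplitK (inr _ j)).
Qed.

Lemma simple_repr_indic A (r : R) (e : H) : measurable A -> inH e ->
  simple_repr (fun t => (r * \1_A t) *: e) ((\int[leb]_(t in D) (r * \1_A t))
    *: e).
Proof.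
move=> mA he.
have hre : inH (r *: e) by exact: inHZ.
pose s := @Build_Hsimple R n 1 (fun=> A) (fun=> r *: e) (fun=> mA) (fun=> hre).
exists s; split=> [t|]; rewrite /hs_fun /hs_integral /= big_ord1 scalerA.
  by rewrite mulrC.
rewrite RintegralZl//.
  rewrite mulrC; congr (_ * fine _ *: _).
  by rewrite integral_indic.
apply: (@rintegrable_le _ _ _ _ _ mD _ (fun=> 1)).
- by apply: measurable_indic.
- exact: rintegrable_cst.
- by move=> t _; rewrite indicE; case: (_ \in _); rewrite ?normr1 ?normr0.
Qed.

Lemma integrable_indic_mul A (r : R) : measurable A ->
  leb.-integrable D (fun t => (r * \1_A t)%:E).
Proof.
move=> mA; apply: (@rintegrable_le _ _ _ _ _ mD _ (fun=> `|r|)).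
- by apply: measurable_funM; [exact: measurable_cst|exact: measurable_indic].
- exact: rintegrable_cst.
- move=> t _; rewrite indicE; case: (_ \in _); rewrite ?mulr1// mulr0 normr0//.
Qed.

Lemma simple_repr_sfun (g : {sfun measurableTypeR R >-> R}) (e : H) : inH e ->
  simple_repr (fun t => g t *: e) ((\int[leb]_(t in D) g t) *: e).
Proof.
move=> he.
pose rs : seq R := finmap.enum_fset (fset_set (range g)).
have gE t : g t = \sum_(r <- rs) r * \1_(g @^-1` [set r]) t.
  by rewrite [LHS]fimfunE fsbig_finite.
have -> : (fun t => g t *: e) =
    (fun t => (\sum_(r <- rs) r * \1_(g @^-1` [set r]) t) *: e).
  by apply/funext => t; rewrite gE.
have -> : \int[leb]_(t in D) g t =
    \int[leb]_(t in D) (\sum_(r <- rs) r * \1_(g @^-1` [set r]) t).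
  by apply: eq_Rintegral => t _; exact: gE.
(* Integrability is carried along the induction on the list of values, because each step uses
   additivity of the integral. *)
suff [] : simple_repr (fun t => (\sum_(r <- rs) r * \1_(g @^-1` [set r]) t) *:
  e)
    ((\int[leb]_(t in D) (\sum_(r <- rs) r * \1_(g @^-1` [set r]) t)) *: e) /\
    leb.-integrable D (fun t => (\sum_(r <- rs) r * \1_(g @^-1` [set r]) t)%:E).
  by [].
elim: rs {gE} => [|r rs [IH1 IH2]].
  under eq_fun do rewrite big_nil scale0r.
  under eq_Rintegral do rewrite big_nil.
  under [X in _ /\ leb.-integrable D X]eq_fun do rewrite big_nil.
  split; last exact: rintegrable0.
  rewrite (_ : \int[leb]_(t in D) 0 = 0) ?scale0r; first exact: simple_repr0.
  by rewrite /Rintegral integral0.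
have mg : measurable (g @^-1` [set r]).
  by rewrite -[X in measurable X]setTI; exact: measurable_funP.
under eq_fun do rewrite big_cons scalerDl.
under eq_Rintegral do rewrite big_cons.
under [X in _ /\ leb.-integrable D X]eq_fun do rewrite big_cons.
have i1 := integrable_indic_mul r mg.
split; last exact: rintegrableD.
rewrite RintegralD// scalerDl.
by apply: simple_reprD => //; exact: simple_repr_indic.
Qed.

Lemma simple_repr_sum m (F : 'I_m -> R -> H) (w : 'I_m -> H) :
  (forall j, simple_repr (F j) (w j)) ->
  simple_repr (fun t => \sum_j F j t) (\sum_j w j).
Proof.
move=> hF; rewrite -[index_enum _]filter_predT.
elim: (index_enum 'I_m) => [|j r IH].
  under eq_fun do rewrite big_nil.
  by rewrite big_nil; exact: simple_repr0.
under eq_fun do rewrite big_cons/=.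
by rewrite big_cons/=; exact: simple_reprD.
Qed.

End bochner.

Section bochner_finite_dimensional.
Context {R : realType} {n : nat}.
Local Notation leb := (@lebesgue_measure R).
Local Notation H := (Hvec R n).
Variables (D : set (measurableTypeR R)).
Hypotheses (mD : measurable D) (Doo : (leb D < +oo)%E).
Context {m : nat} (h : 'I_m -> H) (hH : forall j, inH (h j)).
Variable phi : R -> 'cV[R]_m.
Hypothesis iphi : forall j, leb.-integrable D (fun t => (phi t j 0)%:E).

(** Each real coefficient is approximated by simple functions, pointwise and in [L^1]; synthesizing
    the approximants gives vector-valued simple functions. *)
Lemma simple_approx_synth : exists s : nat -> Hsimple R n, exists g : nat ->
  R -> 'cV[R]_m,
  [/\ forall k t, hs_fun (s k) t = synth h (g k t),
      forall k, hs_integral D (s k) = synth h (\col_j \int[leb]_(t in D) g k t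
        j 0),
      forall t, D t -> forall j, g k t j 0 @[k --> \oo] --> phi t j 0,
      forall k j, leb.-integrable D (fun t => (g k t j 0)%:E) &
      forall j, \int[leb]_(t in D) `|phi t j 0 - g k t j 0| @[k --> \oo] -->
        (0 : R)].
Proof.
have [g hg] := choice (fun j => approximation_sfun_integrable mD (iphi j)).
have gint k j : leb.-integrable D (fun t => (g j k t)%:E).
  by have [h1 _ _] := hg j; exact: h1.
have hs k : simple_repr D (fun t => synth h (\col_j g j k t))
    (synth h (\col_j \int[leb]_(t in D) g j k t)).
  rewrite /synth.
  rewrite (_ : (fun t => _) = (fun t => \sum_j (g j k t) *: h j)); last first.
    by apply/funext => t; apply: eq_bigr => j _; rewrite mxE.
  under [X in simple_repr _ _ X]eq_bigr do rewrite mxE.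
  by apply: simple_repr_sum => j; exact: simple_repr_sfun.
have [s ss] := choice hs.
exists s, (fun k t => \col_j g j k t); split.
- by move=> k t; have [-> _] := ss k.
- move=> k; have [_ ->] := ss k; congr synth; apply/colP => j; rewrite !mxE.
  by apply: eq_Rintegral => t _; rewrite mxE.
- move=> t Dt j; have [_ h2 _] := hg j.
  under eq_fun do rewrite mxE.
  have := h2 t Dt; move/fine_cvgP => [_]; apply: cvg_trans.
  by apply: near_eq_cvg; apply: nearW => k.
- by move=> k j; under eq_fun do rewrite mxE; exact: gint.
- move=> j; have [_ _ /fine_cvgP[_]] := hg j.
  apply: cvg_trans; apply: near_eq_cvg; apply: nearW => k /=.
  by congr fine; apply: eq_integral => t _; rewrite mxE.
Qed.

Variable F : R -> H.
Hypotheses (FH : forall t, D t -> inH (F t))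
  (Fphi : forall t, D t -> Heq (F t) (synth h (phi t))).

Lemma simple_approx_of_synth (s : nat -> Hsimple R n) (g : nat -> R ->
  'cV[R]_m) :
  (forall k t, hs_fun (s k) t = synth h (g k t)) ->
  (forall t, D t -> forall j, g k t j 0 @[k --> \oo] --> phi t j 0) ->
  simple_approx D s F.
Proof.
move=> sg gphi t Dt; split; first exact: FH.
apply: (@Hcvg_ae _ _ (fun k => synth h (g k t)) _ (synth h (phi t))).
- by move=> k; exact: synth_inH.
- by move=> k; rewrite sg; exact: synth_inH.
- exact: synth_inH.
- exact: FH.
- by move=> k; rewrite sg; exact: Heq_refl.
- by apply: Heq_sym; exact: Fphi.
rewrite /Hcvg; under eq_fun do rewrite -synthB.
apply: cvg_Hnorm_synth => // j; under eq_fun do rewrite mxE [X in _ + X]mxE.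
by rewrite -(subrr (phi t j 0)); apply: cvgB; [exact: gphi|exact: cvg_cst].
Qed.

Lemma strongly_measurable_synth : strongly_measurable D F.
Proof.
have [s [g [h1 _ h3 _ _]]] := simple_approx_synth.
by exists s; exact: simple_approx_of_synth h1 h3.
Qed.

(** The norm of the error is at most the sum of the coefficient errors weighted by [Hnorm (h j)], so
    [L^1] convergence of the coefficients suffices. *)
Lemma bochner_integral_synth (w : H) : inH w ->
  Heq w (synth h (\col_j \int[leb]_(t in D) phi t j 0)) ->
  bochner_integral D F w.
Proof.
move=> hw wphi; split=> //.
have [s [g [h1 h2 h3 h4 h5]]] := simple_approx_synth.
exists s; split; first exact: simple_approx_of_synth h1 h3.
- have i1 k j : leb.-integrable D (fun t => `|phi t j 0 - g k t j 0|%:E).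
    exact: (integrable_norm (rintegrableB mD (iphi j) (h4 k j))).
  pose r k := \sum_j \int[leb]_(t in D) `|phi t j 0 - g k t j 0| * Hnorm (h j).
  have r0 : (r k)%:E @[k --> \oo] --> 0%E.
    apply: cvg_EFin; first by apply: nearW.
    have hs : r k @[k --> \oo] --> \sum_j (0 : R) * Hnorm (h j).
      by apply: cvg_sumr => j; apply: cvgM; [exact: h5|exact: cvg_cst].
    by apply: cvg_trans hs _; rewrite big1// => j _; rewrite mul0r.
  apply: (@squeeze_cvge _ _ _ _ (fun=> 0%E) _ (fun k => (r k)%:E)) => //.
    apply: nearW => k; apply/andP; split.
      by apply: integral_ge0 => t _; rewrite lee_fin Hnorm_ge0.
    rewrite /r; under eq_bigr do rewrite -(RintegralZr _ mD (i1 _ _)).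
    rewrite -Rintegral_sum//; last first.
      move=> j; under eq_fun do rewrite mulrC;
        exact: (rintegrableZ mD _ (i1 _ _)).
    rewrite -RintegralE//; last first.
      apply: rintegrable_sum => // j; under eq_fun do rewrite mulrC;
        exact: (rintegrableZ mD _ (i1 _ _)).
    apply: le_integralW => t Dt; rewrite lee_fin h1.
    rewrite (@Hnorm_ae _ _ _ (synth h (phi t - g k t))); last 3 first.
    + by apply: inHB; [exact: FH|exact: synth_inH].
    + exact: synth_inH.
    + by rewrite synthB; apply: HeqB; [exact: Fphi|exact: Heq_refl].
    apply: le_trans (Hnorm_synth_le hH _) _.
    by apply: ler_sum => j _; rewrite !mxE.
  exact: cvg_cst.
- apply: (@Hcvg_ae _ _ (fun k => synth h (\col_j \int[leb]_(t in D) g k t j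
  0)) _
    (synth h (\col_j \int[leb]_(t in D) phi t j 0))).
  + by move=> k; exact: synth_inH.
  + by move=> k; rewrite h2; exact: synth_inH.
  + exact: synth_inH.
  + by [].
  + by move=> k; rewrite h2; exact: Heq_refl.
  + exact: Heq_sym.
  rewrite /Hcvg; under eq_fun do rewrite -synthB.
  apply: cvg_Hnorm_synth => // j; under eq_fun do rewrite !mxE.
  apply/cvgrPdist_le => e e0; have /cvgrPdist_le/(_ _ e0) := h5 j.
  apply: filterS => k; rewrite sub0r normrN ger0_norm; last first.
    by apply: Rintegral_ge0.
  apply: le_trans; rewrite sub0r normrN -normrN opprB -RintegralB//.
  - exact: (le_normr_Rintegral mD (rintegrableB mD (iphi j) (h4 k j))).
  - exact: iphi.
  - exact: h4.
Qed.

End bochner_finite_dimensional.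

Section bochner_weak.
Context {R : realType} {n : nat}.
Local Notation leb := (@lebesgue_measure R).
Local Notation H := (Hvec R n).

Lemma hs_fun_inH (s : Hsimple R n) t : inH (hs_fun s t).
Proof. by apply: inH_sum => j; apply: inHZ; exact: hs_inH. Qed.

Lemma Hip_hs_fun (s : Hsimple R n) g t : inH g ->
  Hip g (hs_fun s t) = \sum_j Hip g (@hs_vec _ _ s j) * \1_(@hs_set _ _ s j) t.
Proof.
move=> hg; rewrite Hip_sumr//; last by move=> j; apply: inHZ; exact: hs_inH.
by apply: eq_bigr => j _; rewrite HipZr 1?mulrC//; exact: hs_inH.
Qed.

Lemma Hip2_hs_fun (s : Hsimple R n) t : Hip (hs_fun s t) (hs_fun s t) =
  \sum_i \sum_j Hip (@hs_vec _ _ s i) (@hs_vec _ _ s j) *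
    (\1_(@hs_set _ _ s i) t * \1_(@hs_set _ _ s j) t).
Proof.
rewrite {1}/hs_fun Hip_suml//; last exact: hs_fun_inH.
  apply: eq_bigr => i _; rewrite HipZl; [|exact: hs_inH|exact: hs_fun_inH].
  rewrite Hip_hs_fun ?mulr_sumr; last exact: hs_inH.
  by apply: eq_bigr => j _; ring.
by move=> j; apply: inHZ; exact: hs_inH.
Qed.

Lemma measurable_fun_sumr d (X : measurableType d) (D : set X) m (f : 'I_m ->
  X -> R) :
  (forall i, measurable_fun D (f i)) -> measurable_fun D (fun x => \sum_i f i
    x).
Proof. by move=> mf; exact: measurable_sum. Qed.

Lemma Hcvg_Hnorm (s : nat -> H) v : (forall k, inH (s k)) -> inH v ->
  Hcvg s v ->
  Hnorm (s k) @[k --> \oo] --> Hnorm v.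
Proof.
move=> hs hv sv; apply/cvgrPdist_le => e e0.
move/cvgrPdist_le : sv => /(_ _ e0); apply: filterS => k.
rewrite sub0r normrN ger0_norm ?Hnorm_ge0//; apply: le_trans.
rewrite ler_norml; apply/andP; split.
  rewrite lerBrDl lerBlDr -[X in Hnorm X <= _](subrK v) addrC.
  by apply: ler_HnormD => //; exact: inHB.
rewrite lerBlDr -[X in Hnorm X <= _](subrK (s k)) HnormB//.
by apply: ler_HnormD => //; exact: inHB.
Qed.

Variables (D : set (measurableTypeR R)).
Hypotheses (mD : measurable D) (Doo : (leb D < +oo)%E).

Section approx.
Variables (s : nat -> Hsimple R n) (F : R -> H).
Hypothesis sF : simple_approx D s F.

Lemma measurable_Hip g : inH g -> measurable_fun D (fun t => Hip g (F t)).
Proof.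
move=> hg; apply: (@measurable_fun_cvg _ _ _ _ (fun k t => Hip g (hs_fun (s k)
  t))).
- move=> k; under eq_fun do rewrite Hip_hs_fun//.
  apply: measurable_fun_sumr => j.
  by apply: measurable_funM; [exact: measurable_cst|apply: measurable_indic;
    exact: hs_measurable].
- move=> t Dt; have [h1 h2] := sF Dt; apply: Hcvg_Hip => // k.
  exact: hs_fun_inH.
Qed.

Lemma measurable_Hip2 : measurable_fun D (fun t => Hip (F t) (F t)).
Proof.
apply: (@measurable_fun_cvg _ _ _ _ (fun k t => Hip (hs_fun (s k) t) (hs_fun
  (s k) t))).
- move=> k; under eq_fun do rewrite Hip2_hs_fun//.
  apply: measurable_fun_sumr => i; apply: measurable_fun_sumr => j.
  by apply: measurable_funM; [exact: measurable_cst|];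
    apply: measurable_funM; apply: measurable_indic; exact: hs_measurable.
- move=> t Dt; have [h1 h2] := sF Dt.
  rewrite -sqr_Hnorm; under eq_fun do rewrite -sqr_Hnorm expr2.
  rewrite expr2; have h3 := Hcvg_Hnorm (fun k => @hs_fun_inH (s k) t) h1 h2.
  exact: cvgM.
Qed.

End approx.

Lemma integrable_hs_fun (s : Hsimple R n) g : inH g ->
  leb.-integrable D (fun t => (Hip g (hs_fun s t))%:E) /\
  \int[leb]_(t in D) Hip g (hs_fun s t) = Hip g (hs_integral D s).
Proof.
move=> hg; under eq_fun do rewrite Hip_hs_fun//.
under eq_Rintegral do rewrite Hip_hs_fun//.
have i1 j := integrable_indic_mul mD Doo (Hip g (@hs_vec _ _ s j))
  (@hs_measurable _ _ s j).
split; first exact: rintegrable_sum.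
rewrite Rintegral_sum// Hip_sumr//; last by move=> j; apply: inHZ;
  exact: hs_inH.
apply: eq_bigr => j _; rewrite HipZr//; last exact: hs_inH.
rewrite RintegralZl//; last first.
  have := integrable_indic_mul mD Doo 1 (@hs_measurable _ _ s j).
  by under eq_fun do rewrite mul1r.
rewrite mulrC; congr (fine _ * _); rewrite integral_indic//.
exact: hs_measurable.
Qed.

(** For [g] in the unit ball, Cauchy-Schwarz bounds the paired error by the norm of the error
    itself. The [L^1] convergence then transfers by squeezing, with no constant to pull out of an
    integral whose integrand has not been shown measurable. *)
Let bochner_integral_weak1 (F : R -> H) w g : bochner_integral D F w ->
  inH g -> Hnorm g <= 1 ->
  leb.-integrable D (fun t => (Hip g (F t))%:E) /\
  \int[leb]_(t in D) Hip g (F t) = Hip g w.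
Proof.
move=> [hw [s [sF L1 Iw]]] hg g1.
have mg := measurable_Hip sF hg.
pose p k t := Hip g (hs_fun (s k) t).
have ip k := (integrable_hs_fun (s k) hg).1.
have bnd k t : D t -> `|Hip g (F t) - p k t| <= Hnorm (F t - hs_fun (s k) t).
  move=> Dt; have [h1 _] := sF _ Dt; have hs := @hs_fun_inH (s k) t.
  rewrite -HipBr//; apply: le_trans (Hip_CS hg (inHB h1 hs)) _.
  by rewrite ler_piMl ?Hnorm_ge0.
have L1' : (\int[leb]_(t in D) `|Hip g (F t) - p k t|%:E)%E @[k --> \oo] -->
  0%E.
  apply: (@squeeze_cvge _ _ _ _ (fun=> 0%E) _ _ _ _ _ L1); last exact: cvg_cst.
  apply: nearW => k; apply/andP; split; first by apply: integral_ge0.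
  by apply: le_integralW => t Dt; rewrite lee_fin bnd.
have mp k : measurable_fun D (fun t => Hip g (F t) - p k t).
  by apply: measurable_funB => //; exact: rintegrable_measurable (ip k).
(* Convergence to [0] makes some error integral finite; adding back the integrable simple pairing at
   that index [N] gives integrability. *)
have ig : leb.-integrable D (fun t => (Hip g (F t))%:E).
  have /fine_cvgP[[N _ HN] _] := L1'.
  have iN : leb.-integrable D (fun t => (Hip g (F t) - p N t)%:E).
    apply/integrableP; split; first exact/measurable_EFinP.
    by rewrite ltey_eq HN//=.
  have := rintegrableD mD iN (ip N); under eq_fun do rewrite subrK.
  by [].
split => //.
have h1 : \int[leb]_(t in D) p k t @[k --> \oo] --> \int[leb]_(t in D) Hip g
  (F t).
  have /fine_cvgP[_ L1r] := L1'.
  apply/cvgrPdist_le => e e0; move/cvgrPdist_le : L1r => /(_ _ e0).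
  apply: filterS => k /=; rewrite sub0r normrN ger0_norm; last first.
    by apply: fine_ge0; apply: integral_ge0.
  apply: le_trans; rewrite -RintegralB//; last exact: ip.
  exact: (le_normr_Rintegral mD (rintegrableB mD ig (ip k))).
have h2 : \int[leb]_(t in D) p k t @[k --> \oo] --> Hip g w.
  under eq_fun do rewrite (integrable_hs_fun (s _) hg).2.
  apply: Hcvg_Hip => // k.
  by apply: inH_sum => j; apply: inHZ; exact: hs_inH.
by rewrite -(cvg_lim (@Rhausdorff R) h1); apply: cvg_lim.
Qed.

Lemma bochner_integral_weak (F : R -> H) w g : bochner_integral D F w ->
  inH g ->
  leb.-integrable D (fun t => (Hip g (F t))%:E) /\
  \int[leb]_(t in D) Hip g (F t) = Hip g w.
Proof.
move=> bF hg; have [hw [s [sF _ _]]] := bF.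
(* The added [1] keeps the normalizing constant positive when [Hnorm g] is zero. *)
pose K := Hnorm g + 1; have K0 : 0 < K by rewrite ltr_wpDl ?Hnorm_ge0.
pose g' := K^-1 *: g; have hg' : inH g' by exact: inHZ.
have g'1 : Hnorm g' <= 1.
  rewrite HnormZ// gtr0_norm ?invr_gt0// mulrC ler_pdivrMr// mul1r /K.
  by rewrite lerDl.
have gE v : inH v -> Hip g v = K * Hip g' v.
  by move=> hv; rewrite HipZl// mulrA divff ?mul1r// gt_eqF.
have [i1 i2] := bochner_integral_weak1 bF hg' g'1.
have gF t : t \in D -> Hip g (F t) = K * Hip g' (F t).
  by rewrite inE => Dt; apply: gE; have [] := sF t Dt.
split.
  have := rintegrableZ mD K i1; apply: eq_integrable => // t Dt.
  by rewrite gF.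
by rewrite (eq_Rintegral _ gF) RintegralZl// i2 -gE.
Qed.

End bochner_weak.

Section real_analysis.
Context {R : realType}.
Local Notation leb := (@lebesgue_measure R).

Lemma leb_itv_lty (a b : R) : (leb `[a, b]%classic < +oo)%E.
Proof.
rewrite lebesgue_measure_itv/=; case: ifPn => _; last exact: ltry.
by rewrite -EFinB ltry.
Qed.

Lemma continuous_integrable_itv (f : R -> R) (a b : R) : continuous f ->
  leb.-integrable `[a, b]%classic (fun t => (f t)%:E).
Proof.
move=> cf; apply: continuous_compact_integrable; first exact: segment_compact.
exact: continuous_subspaceT.
Qed.

Lemma Rintegral_derive (g f : R -> R) (a b : R) : a <= b -> continuous f ->
  (forall s, is_derive s (1 : R) g (f s)) ->
  \int[leb]_(s in `[a, b]) f s = g b - g a.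
Proof.
rewrite le_eqVlt => /predU1P[<-|ab] cf gf.
  by rewrite set_itv1 Rintegral_set1 subrr.
apply: EFin_inj; rewrite -RintegralE//; last exact: continuous_integrable_itv.
rewrite (@continuous_FTC2 R f g)//.
- exact: continuous_subspaceT.
- split=> [s _||].
  + by case: (gf s).
  + apply: cvg_at_right_filter; exact: is_derive_continuous (gf a).
  + apply: cvg_at_left_filter; exact: is_derive_continuous (gf b).
- by move=> s _; rewrite derive1E; exact: (derive_val (is_derive := gf s)).
Qed.

(* Fubini for the indicator of [s <= r]; [eta] is only absolutely
   continuous. *)
Lemma integration_by_parts_primitive (th chi ka eta : R ->
  R) (T : R) : 0 <= T ->
  leb.-integrable `[0, T]%classic (fun s => (th s)%:E) ->
  continuous ka -> (forall s, is_derive s (1 : R) chi (ka s)) ->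
  (forall t, 0 <= t <= T -> eta t = \int[leb]_(s in `[0, t]) th s) ->
  [/\ leb.-integrable `[0, T]%classic (fun s => (th s * chi s)%:E),
      leb.-integrable `[0, T]%classic (fun s => (ka s * eta s)%:E) &
      chi T * eta T = \int[leb]_(s in `[0, T]) (th s * chi s) +
                      \int[leb]_(s in `[0, T]) (ka s * eta s)].
Proof.
move=> T0 ith cka dchi etaE.
have mI : measurable (`[0, T]%classic : set (measurableTypeR R)).
  exact: measurable_itv.
have cchi : continuous chi by move=> s; exact: is_derive_continuous (dchi s).
have ithchi : leb.-integrable `[0, T]%classic (fun s => (th s * chi s)%:E).
  have [s0 _ hs] := @EVT_max R (fun s => `|chi s|) 0 T T0 (continuous_subspaceT
    (fun s => cvg_norm (cchi s))).
  apply: (@rintegrable_le _ _ _ _ _ mI _ (fun s => `|chi s0| * `|th s|)).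
  - apply: measurable_funM; first exact: rintegrable_measurable ith.
    by apply: measurable_funTS; exact: continuous_measurable_fun.
  - exact: (rintegrableZ mI _ (integrable_norm ith)).
  - by move=> s sI; rewrite normrM mulrC ler_wpM2r//; exact: hs.
pose k (z : measurableTypeR R * measurableTypeR R) : R := if z.2 <= z.1 then 1
  else 0.
have mk : measurable_fun setT k.
  apply: measurable_fun_ifT; try exact: measurable_cst.
  exact: measurable_fun_ler measurable_snd measurable_fst.
have kC z : `|k z| <= 1 by rewrite /k; case: ifP; rewrite ?normr1 ?normr0.
have ith' : leb.-integrable setT (EFin \o (th \_ `[0, T])).
  by rewrite -restrict_EFin; exact: (integrable_mkcond _ mI).1 ith.
have ika := continuous_integrable_itv 0 T cka.
have ika' : leb.-integrable setT (EFin \o (ka \_ `[0, T])).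
  by rewrite -restrict_EFin; exact: (integrable_mkcond _ mI).1 ika.
(* Integrated in [s] against [th], the indicator yields [eta r]; integrated in [r] against [ka], it
   yields [chi T - chi s]. Equating the two orders of integration is the formula. *)
have in1 r : 0 <= r <= T -> \int[leb]_s (k (r, s) * (th \_ `[0, T]) s) = eta r.
  move=> /andP[r0 rT]; rewrite etaE ?r0// [RHS]Rintegral_mkcond.
  apply: eq_Rintegral => s _; rewrite !patchE /k /=.
  rewrite !mem_setE !in_itv/=; case: (leP s r) => sr; rewrite ?mul0r ?mul1r.
    by rewrite andbT (le_trans sr rT) andbT.
  by rewrite andbF.
have in2 s : 0 <= s <= T -> \int[leb]_r (k (r, s) * (ka \_ `[0, T]) r) =
  chi T - chi s.
  move=> /andP[s0 sT]; rewrite -(Rintegral_derive sT cka dchi)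
    [RHS]Rintegral_mkcond.
  apply: eq_Rintegral => r _; rewrite !patchE /k /=.
  rewrite !mem_setE !in_itv/=; case: (leP s r) => sr; rewrite ?mul0r ?mul1r//.
  by rewrite (le_trans s0 sr).
have E1 r : (ka \_ `[0, T]) r * \int[leb]_s (k (r, s) * (th \_ `[0, T]) s) =
    ((fun r => ka r * eta r) \_ `[0, T]) r.
  rewrite !patchE; case: ifPn => rI; last by rewrite mul0r.
  by rewrite in1//; move: rI; rewrite inE/= in_itv.
have ikaeta : leb.-integrable `[0, T]%classic (fun s => (ka s * eta s)%:E).
  apply/(integrable_mkcond _ mI).2.
  have := integrable_kernel_integral mk kC ika' ith'.
  under eq_fun do rewrite E1.
  move=> hE; rewrite (_ : _ \_ _ = EFin \o ((fun r => ka r * eta r) \_ `[0,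
    T])).
    exact: hE.
  exact: restrict_EFin.
split => //.
have := kernel_fubini mk kC ika' ith'.
under eq_Rintegral do rewrite E1.
rewrite -Rintegral_mkcond => ->.
have -> : \int[leb]_s ((th \_ `[0, T]) s * \int[leb]_r (k (r,
  s) * (ka \_ `[0, T]) r)) =
    \int[leb]_(s in `[0, T]) (chi T * th s - th s * chi s).
  rewrite [RHS]Rintegral_mkcond; apply: eq_Rintegral => s _.
  rewrite !patchE; case: ifPn => sI; last by rewrite mul0r.
  by rewrite in2; [ring|move: sI; rewrite inE/= in_itv].
rewrite RintegralB//; last exact: rintegrableZ.
by rewrite RintegralZl// -etaE ?T0 ?lexx// addrC subrK.
Qed.

End real_analysis.

(** * The linear-quadratic problem on a finite family *)

Lemma RintegralN d (X : measurableType d) (R : realType)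
    (mu : {measure set X -> \bar R}) (D : set X) (f : X -> R) : measurable D ->
  mu.-integrable D (fun x => (f x)%:E) ->
  \int[mu]_(x in D) (- f x) = - \int[mu]_(x in D) f x.
Proof.
move=> mD fi; rewrite -mulN1r -RintegralZl//.
by apply: eq_Rintegral => x _; rewrite mulN1r.
Qed.

(** Arithmetic of the pointwise bound: [a] and [a'] are the state costs of the candidate and of the
    competitor, [q] is the cross term of the state, and [b], [c], [d] are [|u|^2], [<u, du>],
    [|du|^2]. *)
Fact running_cost_ge (R : realFieldType) (a q a' b c d : R) :
  a + 2 * q <= a' -> a + b + (2 * (c + q) + d) <= a' + (b + 2 * c + d).
Proof. by move=> ?; lra. Qed.

(** Here [a + b + c] is half the first variation, from control, state and terminal terms; [e] and
    [f] are the running and terminal costs of the candidate, and [d] is the integral of [|du|^2]. *)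
Fact total_cost_ge (R : realFieldType) (a b c d e f : R) : a + b + c = 0 ->
  e + f + d <= e + (2 * (a + b) + d) + (f + 2 * c).
Proof. by move=> ?; lra. Qed.

Section linear_quadratic.
Context {R : realType} {n : nat}.
Local Notation leb := (@lebesgue_measure R).
Local Notation H := (Hvec R n).
Variables (T : R) (T_gt0 : 0 < T).
Variables (opA opB opQ opQT : H -> H).
Hypotheses (A_lin : Hlinear opA) (B_lin : Hlinear opB) (Q_lin : Hlinear opQ)
  (QT_lin : Hlinear opQT) (A_fin : locally_finite opA).
Hypotheses (Q_sa : self_adjoint opQ) (Q_ge0 : nonneg_op opQ)
  (QT_sa : self_adjoint opQT) (QT_ge0 : nonneg_op opQT).
Context {m : nat} (h : 'I_m -> H) (hH : forall j, inH (h j)).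
Variables (F G M K : 'M[R]_m).
Hypotheses (AF : acts_by opA h F) (AF' : coacts_by opA h F)
  (BG : acts_by opB h G) (BG' : coacts_by opB h G)
  (QM : acts_by opQ h M) (QTK : acts_by opQT h K).
Variables (xi psi : R -> 'cV[R]_m) (x0 : H) (x0_H : inH x0).
Hypotheses
  (dxi : forall t, is_derive t (1 : R) xi (F *m xi t - G *m (G^T *m psi t)))
  (dpsi : forall t, is_derive t (1 : R) psi (- (M *m xi t) - F^T *m psi t))
  (psiT : psi T = K *m xi T)
  (xi0 : Heq (synth h (xi 0)) x0).

Local Notation I := (`[0%R, T]%classic : set (measurableTypeR R)).
Local Notation Phi := (synth h).

(** By [BG'], the vector [Phi (G^T *m psi t)] has the same pairings as the adjoint of [opB] applied
    to the costate [Phi (psi t)]; this is the usual stationarity condition on the control. *)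
Let upsilon t : 'cV[R]_m := - (G^T *m psi t).
Let u (t : R) : H := Phi (upsilon t).
Let x (t : R) : H := Phi (xi t).

Let T_ge0 : 0 <= T. Proof. exact: ltW. Qed.

Let PhiH y : inH (Phi y). Proof. exact: synth_inH. Qed.

Let uH t : inH (u t). Proof. exact: PhiH. Qed.

Let xH t : inH (x t). Proof. exact: PhiH. Qed.

Let mI : measurable I. Proof. exact: measurable_itv. Qed.

Let dupsilon t : is_derive t (1 : R) upsilon
  (- (G^T *m (- (M *m xi t) - F^T *m psi t))).
Proof. by apply: is_deriveN; apply: is_derive_mulmxl; exact: dpsi. Qed.

Lemma HipNl (v g : H) : inH v -> inH g -> Hip (- v) g = - Hip v g.
Proof. by move=> hv hg; rewrite -(scaleN1r v) HipZl// mulN1r. Qed.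

Lemma Hip_sqrD (v g : H) : inH v -> inH g ->
  Hip (v + g) (v + g) = Hip v v + 2 * Hip v g + Hip g g.
Proof.
move=> hv hg; rewrite HipDl//; last exact: inHD.
by rewrite !HipDr// [Hip g v]HipC; ring.
Qed.

(** Convexity: the expansion differs from its tangent at [v] by the nonnegative term
    [Hip w (P w)]. *)
Lemma quadratic_ge (P : H -> H) v w : Hlinear P -> self_adjoint P ->
  nonneg_op P -> inH v -> inH w ->
  Hip v (P v) + 2 * Hip (P v) w <= Hip (v + w) (P (v + w)).
Proof.
move=> [P1 P2 P3] Psa Pge0 hv hw.
have hPv := P1 v hv; have hPw := P1 w hw.
have Plin : Heq (P (v + w)) (P v + P w).
  by have := P3 1 v w hv hw; rewrite !scale1r.
rewrite (Hip_aeR _ _ _ Plin); [|exact/P1/inHD|exact: inHD|exact: inHD].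
rewrite HipDl//; last exact: inHD.
rewrite !HipDr// [Hip w (P v)]HipC -(Psa v w)//.
have := Pge0 w hw; lra.
Qed.

Lemma Hip_synth2 (y z : 'cV[R]_m) :
  Hip (Phi y) (Phi z) = dotv y (\matrix_(i, j) Hip (h i) (h j) *m z).
Proof.
rewrite Hip_synth//; congr dotv; apply/colP => i; rewrite !mxE.
rewrite Hip_sumr//; last by move=> j; exact: inHZ.
by apply: eq_bigr => j _; rewrite HipZr// mxE mulrC.
Qed.

Lemma continuous_Hip_synth2 (y z dy dz : R -> 'cV[R]_m) :
  (forall t, is_derive t (1 : R) y (dy t)) ->
  (forall t, is_derive t (1 : R) z (dz t)) ->
  continuous (fun t => Hip (Phi (y t)) (Phi (z t))).
Proof.
move=> hy hz; under eq_fun do rewrite Hip_synth2.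
by move=> t; exact: is_derive_continuous (is_derive_dotv (hy t)
  (is_derive_mulmxl _ (hz t))).
Qed.

Lemma derive_coord_continuous (y dy : R -> 'cV[R]_m) j :
  (forall t, is_derive t (1 : R) y (dy t)) -> continuous (fun t => y t j 0).
Proof.
move=> hy t; have /is_derive_mxP/(_ j 0) := hy t; exact: is_derive_continuous.
Qed.

Lemma L2_time_synth (y dy : R -> 'cV[R]_m) :
  (forall t, is_derive t (1 : R) y (dy t)) -> L2_time T (fun t => Phi (y t)).
Proof.
move=> hy; split.
  apply: (strongly_measurable_synth mI (leb_itv_lty 0 T) hH (phi := y)) => //.
  - by move=> j; apply: continuous_integrable_itv;
    exact: derive_coord_continuous hy.
  - by move=> t _; exact: Heq_refl.
under eq_integral do rewrite sqr_Hnorm.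
rewrite RintegralE ?ltry//.
by apply: continuous_integrable_itv; exact: (continuous_Hip_synth2 hy hy).
Qed.

Lemma is_derive_mexp_affine (E : 'M[R]_m) (a b t : R) :
  is_derive t (1 : R) (fun s => mexp E (a * s + b))
    (a *: (E *m mexp E (a * t + b))).
Proof. exact: is_derive_comp_affine (is_derive_mexp _ _). Qed.

(** For fixed [t], the [F]-terms cancel in the derivative of [mexp F (t - s) *m xi s], leaving the
    coefficients of the integrand. The mild equation is then the fundamental theorem of calculus in
    each coordinate. *)
Lemma mild_solution_synth : mild_solution T opA opB u x.
Proof.
have [A1 A2 A3] := A_lin; have [B1 B2 B3] := B_lin.
split=> [t _|a t a0 at_ tT]; first exact: PhiH.
have mD : measurable (`[a, t]%classic : set (measurableTypeR R)) by exact: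
  measurable_itv.
pose phi s := mexp F (t - s) *m (G *m upsilon s).
have dE s : is_derive s (1 : R) (fun s => mexp F (t - s)) (- (F *m mexp F (t -
  s))).
  have := is_derive_mexp_affine F (-1) t s.
  rewrite mulN1r scaleN1r (addrC (- s)).
  by apply: is_derive_ext => // z; rewrite mulN1r addrC.
have dphi s := is_derive_mulmx (dE s) (is_derive_mulmxl G (dupsilon s)).
have dTh s : is_derive s (1 : R) (fun s => mexp F (t - s) *m xi s) (phi s).
  apply: is_derive_ext (is_derive_mulmx (dE s) (dxi s)) => //.
  by rewrite /phi /upsilon mulmxBr !mulmxN mulNmx mexp_comm -!mulmxA addKr.
have cphi j : continuous (fun s => phi s j 0).
  exact: derive_coord_continuous dphi.
apply: (bochner_integral_synth mD (leb_itv_lty a t) hH (phi := phi)).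
- by move=> j; exact: continuous_integrable_itv.
- by move=> s _; apply: expop_inH => //; exact: B1 (PhiH _).
- by move=> s _; apply: expop_acts => //; [exact: B1 (PhiH _)|exact: BG].
- by apply: inHB; [exact: PhiH|exact: (expop_inH A_lin A_fin _ (PhiH _))].
rewrite (_ : \col_j _ = xi t - mexp F (t - a) *m xi a).
  rewrite synthB; apply: HeqB; first exact: Heq_refl.
  by apply: expop_acts => //; exact: Heq_refl.
apply/colP => j; rewrite mxE.
have dThj s := (is_derive_mxP _ _ _).1 (dTh s) j 0.
rewrite [LHS](Rintegral_derive at_ (cphi j) dThj).
by rewrite subrr mexp0 mul1mx [RHS]mxE; congr (_ + _); rewrite [RHS]mxE.
Qed.

Lemma admissible_synth : admissible_pair T opA opB x0 u x.
Proof.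
split; [exact: L2_time_synth dupsilon|exact: mild_solution_synth|exact: xi0].
Qed.

Section comparison.
Variables (u' x' : R -> H).
Hypothesis adm : admissible_pair T opA opB x0 u' x'.

Let u'_I t : I t -> inH (u' t).
Proof. by have [[[s su] _] _ _] := adm; move=> /su[]. Qed.

Let x'_I t : 0 <= t <= T -> inH (x' t).
Proof. by have [_ [h1 _] _] := adm; exact: h1. Qed.

Lemma weak_mild g t : inH g -> 0 <= t <= T ->
  leb.-integrable `[0, t]%classic
    (fun s => (Hip g (expop opA (t - s) (opB (u' s))))%:E) /\
  \int[leb]_(s in `[0, t]) Hip g (expop opA (t - s) (opB (u' s))) =
    Hip g (x' t) - Hip g (expop opA t (x' 0)).
Proof.
move=> hg /andP[t0 tT]; have [_ [h1 h2] _] := adm.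
have mD : measurable (`[0, t]%classic : set (measurableTypeR R)) by exact:
  measurable_itv.
have := bochner_integral_weak mD (leb_itv_lty 0 t) (h2 0 t (lexx 0) t0 tT) hg.
rewrite subr0 HipBr//; first by apply: x'_I; rewrite t0.
by apply: expop_inH => //; apply: h1; rewrite lexx.
Qed.

(** Canonical vectors carried by the backward adjoint flow. Tested against [wcoef j t], the
    integrand of the mild equation on [[0, t]] loses its dependence on [t]. *)
Let wcoef (j : 'I_m) (s : R) : 'cV[R]_m := mexp F^T (- s) *m delta_mx j 0.

Lemma weak_coef j t : 0 <= t <= T ->
  leb.-integrable `[0, t]%classic
    (fun s => (Hip (Phi (G^T *m wcoef j s)) (u' s))%:E) /\
  \int[leb]_(s in `[0, t]) Hip (Phi (G^T *m wcoef j s)) (u' s) =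
    Hip (Phi (wcoef j t)) (x' t) - Hip (Phi (delta_mx j 0)) x0.
Proof.
move=> tT; have [B1 B2 B3] := B_lin.
have [_ [h1 _] x'0] := adm.
have x'0H : inH (x' 0) by apply: h1; rewrite lexx.
have [i1 i2] := weak_mild (PhiH (wcoef j t)) tT.
have E s : s \in `[0, t]%classic ->
    Hip (Phi (wcoef j t)) (expop opA (t - s) (opB (u' s))) =
    Hip (Phi (G^T *m wcoef j s)) (u' s).
  rewrite inE/= in_itv/= => /andP[s0 st].
  have hu : inH (u' s).
    apply: u'_I; rewrite /= in_itv/= s0 (le_trans st)//.
    by case/andP : tT.
  rewrite (expop_coacts A_lin A_fin _ _ hH AF')//; last exact: B1 hu.
  rewrite /wcoef mulmxA -mexpD (_ : t - s - t = - s); last by ring.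
  by rewrite BG'.
have mD : measurable (`[0, t]%classic : set (measurableTypeR R)) by exact:
  measurable_itv.
split.
  by apply: eq_integrable i1 => // s st; rewrite E.
have /= <- := eq_Rintegral leb E; rewrite i2; congr (_ - _).
rewrite (expop_coacts A_lin A_fin _ _ hH AF')//.
rewrite /wcoef mulmxA mexpVr mul1mx.
by apply: Hip_aeR.
Qed.

End comparison.

Section optimality.
Variables (u' x' : R -> H).
Hypothesis adm : admissible_pair T opA opB x0 u' x'.

Let u'H t : 0 <= t <= T -> inH (u' t).
Proof.
by move=> tT; have [[[s su] _] _ _] := adm; have /su[] : I t by rewrite /=
  in_itv.
Qed.

Let x'H t : 0 <= t <= T -> inH (x' t).
Proof. by have [_ [h1 _] _] := adm; exact: h1. Qed.

Let du t : H := u' t - u t.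
Let dx t : H := x' t - x t.

Let duH t : 0 <= t <= T -> inH (du t).
Proof. by move=> tT; apply: inHB; [exact: u'H|exact: PhiH]. Qed.

Let dxH t : 0 <= t <= T -> inH (dx t).
Proof. by move=> tT; apply: inHB; [exact: x'H|exact: PhiH]. Qed.

Let w (j : 'I_m) (s : R) : 'cV[R]_m := mexp F^T (- s) *m delta_mx j 0.
Let th (j : 'I_m) (s : R) : R := Hip (Phi (G^T *m w j s)) (du s).
Let eta (j : 'I_m) (t : R) : R := Hip (Phi (w j t)) (dx t).
(** Coordinates of the costate in the moving frame: the [w j t] weighted by [chi t j 0] add up to
    [psi t]. In this frame the costate equation loses its [F^T] term, and only the source [kap]
    remains. *)
Let chi (t : R) : 'cV[R]_m := mexp F^T t *m psi t.
Let kap (t : R) : 'cV[R]_m := - (mexp F^T t *m (M *m xi t)).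

(** Both pairs start from [x0], so the initial terms cancel when the two weak equations are
    subtracted. *)
Let th_eta j t : 0 <= t <= T ->
  leb.-integrable `[0, t]%classic (fun s => (th j s)%:E) /\
  eta j t = \int[leb]_(s in `[0, t]) th j s.
Proof.
move=> tT; have mD : measurable (`[0, t]%classic : set (measurableTypeR R)).
  exact: measurable_itv.
have [i1 e1] := weak_coef adm j tT.
have [i2 e2] := weak_coef admissible_synth j tT.
have E s : s \in `[0, t]%classic -> th j s =
    Hip (Phi (G^T *m w j s)) (u' s) - Hip (Phi (G^T *m w j s)) (u s).
  rewrite inE/= in_itv/= => /andP[s0 st]; rewrite /th HipBr//.
  by apply: u'H; rewrite s0 (le_trans st)//; case/andP : tT.
split.
  have := rintegrableB mD i1 i2; apply: eq_integrable => // s st.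
  by rewrite E.
have /= -> := eq_Rintegral leb E; rewrite RintegralB// e1 e2 /eta HipBr//;
  last exact: x'H.
by rewrite opprB addrA subrK.
Qed.

Let sum_w (y : 'cV[R]_m) s : \sum_j y j 0 *: w j s = mexp F^T (- s) *m y.
Proof.
rewrite [in RHS](matrix_sum_delta y) mulmx_sumr; apply: eq_bigr => j _.
by rewrite big_ord1 -scalemxAr.
Qed.

Let Hip_w (y : 'cV[R]_m) s v : inH v ->
  \sum_j y j 0 * Hip (Phi (w j s)) v = Hip (Phi (mexp F^T (- s) *m y)) v.
Proof.
move=> hv; rewrite -sum_w Hip_synth// dotvE.
under eq_bigr do rewrite Hip_synth// dotvE mulr_sumr.
rewrite exchange_big; apply: eq_bigr => i _ /=.
by rewrite summxE mulr_suml; apply: eq_bigr => j _; rewrite [in RHS]mxE mulrA.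
Qed.

Let Hip_Gw (y : 'cV[R]_m) s v : inH v ->
  \sum_j y j 0 * Hip (Phi (G^T *m w j s)) v =
  Hip (Phi (G^T *m (mexp F^T (- s) *m y))) v.
Proof.
move=> hv; rewrite -sum_w mulmx_sumr Hip_synth// dotvE.
under eq_bigr do rewrite Hip_synth// dotvE mulr_sumr.
rewrite exchange_big; apply: eq_bigr => i _ /=.
rewrite summxE mulr_suml; apply: eq_bigr => j _.
by rewrite -scalemxAr [in RHS]mxE mulrA.
Qed.

Let dchi t : is_derive t (1 : R) chi (kap t).
Proof.
apply: is_derive_ext (is_derive_mulmx (is_derive_mexp F^T t) (dpsi t)) => //.
by rewrite /kap mexp_comm mulmxBr mulmxN -!mulmxA addrCA subrr addr0.
Qed.

Let dkap t : is_derive t (1 : R) kap (- (F^T *m mexp F^T t *m (M *m xi t) +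
   mexp F^T t *m (M *m (F *m xi t - G *m (G^T *m psi t))))).
Proof.
apply: is_deriveN; apply: is_derive_mulmx; first exact: is_derive_mexp.
exact: is_derive_mulmxl.
Qed.

(* First-order optimality: the costate [Phi (psi t)] pairs [dx] with [du]. *)
Lemma first_order :
  [/\ leb.-integrable I (fun t => (Hip (u t) (du t))%:E),
      leb.-integrable I (fun t => (Hip (opQ (x t)) (dx t))%:E) &
      \int[leb]_(t in I) Hip (u t) (du t) +
      \int[leb]_(t in I) Hip (opQ (x t)) (dx t) +
      Hip (opQT (x T)) (dx T) = 0].
Proof.
have TI : 0 <= T <= T by rewrite T_ge0 lexx.
have [Q1 _ _] := Q_lin; have [QT1 _ _] := QT_lin.
have P j := integration_by_parts_primitive T_ge0 (th_eta j TI).1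
  (derive_coord_continuous (j := j) dkap)
  (fun s => (is_derive_mxP _ _ _).1 (dchi s) j 0)
  (fun t tT => (th_eta j tT).2).
have i1 j : leb.-integrable I (fun s => (th j s * chi s j 0)%:E) by have [] :=
  P j.
have i2 j : leb.-integrable I (fun s => (kap s j 0 * eta j s)%:E) by have []
  := P j.
have e3 j : chi T j 0 * eta j T = \int[leb]_(s in I) (th j s * chi s j 0) +
  \int[leb]_(s in I) (kap s j 0 * eta j s) by have [] := P j.
(* Summing over [j] leaves the moving frame: the two integrands become the control and state cross
   terms with a minus sign, and the boundary term becomes the terminal one through [psiT]. *)
have E1 t : t \in I -> \sum_j th j t * chi t j 0 = - Hip (u t) (du t).
  rewrite inE/= in_itv/= => tT.
  under eq_bigr do rewrite mulrC.
  rewrite (Hip_Gw _ _ (duH tT)) /chi [mexp _ (- _) *m _]mulmxA mexpVl mul1mx.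
  by rewrite /u /upsilon synthN HipNl ?opprK//; exact: duH.
have E2 t : t \in I -> \sum_j kap t j 0 * eta j t = - Hip (opQ (x t)) (dx t).
  rewrite inE/= in_itv/= => tT.
  rewrite (Hip_w _ _ (dxH tT)) /kap mulmxN [mexp _ (- _) *m _]mulmxA mexpVl
    mul1mx.
  rewrite synthN HipNl//; last exact: dxH.
  congr (- _); apply: Hip_aeL => //; [exact: Q1|exact: dxH|].
  by apply: Heq_sym; exact: QM.
have E3 : \sum_j chi T j 0 * eta j T = Hip (opQT (x T)) (dx T).
  rewrite (Hip_w _ _ (dxH TI)) /chi [mexp _ (- _) *m _]mulmxA mexpVl mul1mx
    psiT.
  apply: Hip_aeL => //; [exact: QT1|exact: dxH|].
  by apply: Heq_sym; exact: QTK.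
have j1 : leb.-integrable I (fun t => (Hip (u t) (du t))%:E).
  have := rintegrableZ mI (-1) (rintegrable_sum mI i1).
  by apply: eq_integrable => // t tI; rewrite E1// mulrNN mul1r.
have j2 : leb.-integrable I (fun t => (Hip (opQ (x t)) (dx t))%:E).
  have := rintegrableZ mI (-1) (rintegrable_sum mI i2).
  by apply: eq_integrable => // t tI; rewrite E2// mulrNN mul1r.
split => //.
have hu : \sum_j \int[leb]_(t in I) (th j t * chi t j 0) =
    - \int[leb]_(t in I) Hip (u t) (du t).
  rewrite -(Rintegral_sum mI i1).
  exact: etrans (eq_Rintegral leb E1) (RintegralN mI j1).
have hx : \sum_j \int[leb]_(t in I) (kap t j 0 * eta j t) =
    - \int[leb]_(t in I) Hip (opQ (x t)) (dx t).
  rewrite -(Rintegral_sum mI i2).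
  exact: etrans (eq_Rintegral leb E2) (RintegralN mI j2).
rewrite -E3; under eq_bigr do rewrite e3.
by rewrite big_split/= hu hx -opprD subrr.
Qed.

Let cont_run : continuous (fun t => Hip (x t) (opQ (x t)) + Hip (u t) (u t)).
Proof.
have [Q1 _ _] := Q_lin.
have -> : (fun t => Hip (x t) (opQ (x t)) + Hip (u t) (u t)) =
    (fun t => Hip (Phi (xi t)) (Phi (M *m xi t)) +
      Hip (Phi (upsilon t)) (Phi (upsilon t))).
  by apply/funext => t; rewrite (Hip_aeR _ _ _ (QM (xi t)))//; exact: Q1.
move=> t; apply: cvgD.
  exact: (continuous_Hip_synth2 dxi (fun t => is_derive_mulmxl M (dxi t))).
exact: (continuous_Hip_synth2 dupsilon dupsilon).
Qed.

Let int_run : leb.-integrable I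
  (fun t => (Hip (x t) (opQ (x t)) + Hip (u t) (u t))%:E).
Proof. exact: continuous_integrable_itv. Qed.

Lemma cost_synth : lq_cost T opQ opQT u x =
  (\int[leb]_(t in I) (Hip (x t) (opQ (x t)) + Hip (u t) (u t)) +
   Hip (x T) (opQT (x T)))%:E.
Proof. by rewrite /lq_cost (RintegralE mI int_run). Qed.

Lemma integrable_Hip_u' : leb.-integrable I (fun t => (Hip (u' t) (u' t))%:E).
Proof.
have [[[s su] uoo] _ _] := adm.
apply/integrableP; split.
  by apply/measurable_EFinP; exact: (measurable_Hip2 su).
apply: le_lt_trans uoo; apply: le_integralW => t _.
by rewrite sqr_Hnorm gee0_abs// lee_fin Hip_ge0.
Qed.

Let int_uu : leb.-integrable I (fun t => (Hip (u t) (u t))%:E).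
Proof.
apply: continuous_integrable_itv.
exact: (continuous_Hip_synth2 dupsilon dupsilon).
Qed.

(** Expanding [|u + du|^2] writes [|du|^2] as a combination of [|u'|^2], [|u|^2] and the cross term,
    whose integrability comes from [first_order]. *)
Lemma integrable_Hip_du : leb.-integrable I (fun t => (Hip (du t) (du t))%:E).
Proof.
have [j1 _ _] := first_order.
have i3 := rintegrableB mI (rintegrableB mI integrable_Hip_u' (rintegrableZ mI
  2 j1)) int_uu.
apply: eq_integrable i3 => // t; rewrite inE/= in_itv/= => tT; congr EFin.
have hu' := u'H tT; have hu := uH t; have hd := duH tT.
have -> : Hip (u' t) (u' t) =
    Hip (u t) (u t) + 2 * Hip (u t) (du t) + Hip (du t) (du t).
  by rewrite -(Hip_sqrD hu hd) /du addrC subrK.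
ring.
Qed.

(* [x'] is only known to be weakly measurable at this point, so the quadratic
   term in [dx] is dropped pointwise, before integrating. *)
Lemma cost_ge : (lq_cost T opQ opQT u x +
  (\int[leb]_(t in I) Hip (du t) (du t))%:E <= lq_cost T opQ opQT u' x')%E.
Proof.
have [j1 j2 j3] := first_order.
have TI : 0 <= T <= T by rewrite T_ge0 lexx.
pose low t := Hip (x t) (opQ (x t)) + Hip (u t) (u t) +
  (2 * (Hip (u t) (du t) + Hip (opQ (x t)) (dx t)) + Hip (du t) (du t)).
have j4 := rintegrableZ mI 2 (rintegrableD mI j1 j2).
have j5 := rintegrableD mI j4 integrable_Hip_du.
have ilow : leb.-integrable I (fun t => (low t)%:E) by exact: (rintegrableD mI
  int_run j5).
have Elow : \int[leb]_(t in I) low t =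
    \int[leb]_(t in I) (Hip (x t) (opQ (x t)) + Hip (u t) (u t)) +
    (2 * (\int[leb]_(t in I) Hip (u t) (du t) +
          \int[leb]_(t in I) Hip (opQ (x t)) (dx t)) +
     \int[leb]_(t in I) Hip (du t) (du t)).
  rewrite [LHS](RintegralD mI int_run j5); congr (_ + _).
  rewrite [LHS](RintegralD mI j4 integrable_Hip_du); congr (_ + _).
  rewrite [LHS](RintegralZl _ mI (rintegrableD mI j1 j2)); congr (_ * _).
  exact: (RintegralD mI j1 j2).
have low_le t : I t -> ((low t)%:E <=
    (Hip (x' t) (opQ (x' t)) + Hip (u' t) (u' t))%:E)%E.
  rewrite /= in_itv/= => tT; rewrite lee_fin.
  have hu := uH t; have hd := duH tT.
  have := quadratic_ge Q_lin Q_sa Q_ge0 (xH t) (dxH tT).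
  rewrite (_ : x t + dx t = x' t); last by rewrite /dx addrC subrK.
  have -> : Hip (u' t) (u' t) =
      Hip (u t) (u t) + 2 * Hip (u t) (du t) + Hip (du t) (du t).
    by rewrite -(Hip_sqrD hu hd) /du addrC subrK.
  exact: running_cost_ge.
have hT : Hip (x T) (opQT (x T)) + 2 * Hip (opQT (x T)) (dx T) <=
    Hip (x' T) (opQT (x' T)).
  have := quadratic_ge QT_lin QT_sa QT_ge0 (xH T) (dxH TI).
  by rewrite (_ : x T + dx T = x' T)//; rewrite /dx addrC subrK.
rewrite cost_synth /lq_cost.
apply: le_trans (leeD (le_integralW leb low_le) (_ : (_%:E <= _%:E)%E));
  last first.
  by rewrite lee_fin; exact: hT.
rewrite (RintegralE mI ilow) Elow -!EFinD lee_fin.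
exact: total_cost_ge j3.
Qed.

(** The weak mild equations at time [t] are tested on the difference [g] of the two states itself;
    their right-hand sides agree, so [Hip g g] is zero. *)
Lemma state_eq : {ae leb, forall t, I t -> Heq (u' t) (u t)} ->
  forall t, 0 <= t <= T -> Heq (x' t) (x t).
Proof.
move=> u'u t tT.
have mD : measurable (`[0, t]%classic : set (measurableTypeR R)) by exact:
  measurable_itv.
have [B1 B2 B3] := B_lin.
have hx' := x'H tT; have hx := xH t.
have TI : 0 <= (0 : R) <= T by rewrite lexx T_ge0.
have hx'0 := x'H TI.
have h0 : Heq (x' 0) (x 0).
  have [_ _ e1] := adm; apply: Heq_trans e1 _; apply: Heq_sym; exact: xi0.
pose g := x' t - x t; have hg : inH g by exact: inHB.
have [i1 e1] := weak_mild adm hg tT.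
have [i2 e2] := weak_mild admissible_synth hg tT.
have E : \int[leb]_(s in `[0, t]) Hip g (expop opA (t - s) (opB (u' s))) =
    \int[leb]_(s in `[0, t]) Hip g (expop opA (t - s) (opB (u s))).
  apply: (congr1 fine).
  apply: (@ae_eq_integral _ _ _ leb _ _ _ mD (measurable_int _ i1)
    (measurable_int _ i2)).
  - apply: filterS u'u => s us; rewrite /= in_itv/= => /andP[s0 st].
    have sT : 0 <= s <= T by rewrite s0 (le_trans st)//; case/andP : tT.
    have hu' := u'H sT; have hu := uH s.
    have us' : Heq (u' s) (u s) by apply: us; rewrite /= in_itv.
    apply: (congr1 EFin); apply: (Hip_aeR _ _ hg).
    + exact: (expop_inH A_lin A_fin _ (B1 _ hu')).
    + exact: (expop_inH A_lin A_fin _ (B1 _ hu)).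
    + exact: (expop_ae A_lin A_fin _ (B1 _ hu') (B1 _ hu) (B2 _ _ hu' hu us')).
have E0 : Hip g (expop opA t (x' 0)) = Hip g (expop opA t (x 0)).
  apply: (Hip_aeR _ _ hg).
  - exact: (expop_inH A_lin A_fin _ hx'0).
  - exact: (expop_inH A_lin A_fin _ (xH 0)).
  - exact: (expop_ae A_lin A_fin _ hx'0 (xH 0) h0).
have e3 : Hip g (x' t) - Hip g (expop opA t (x' 0)) =
    Hip g (x t) - Hip g (expop opA t (x' 0)).
  exact: (etrans (esym e1) (etrans E (etrans e2
    (congr1 (fun z => Hip g (x t) - z) (esym E0))))).
apply: Heq_subr0; apply: (Hip_eq0 hg).
apply: (etrans (HipBr hx' hx hg)).
have e4 : Hip g (x' t) = Hip g (x t) := addIr _ e3.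
exact: (etrans (congr1 (fun z => z - Hip g (x t)) e4) (subrr _)).
Qed.

(** The gap in [cost_ge] is the integral of [|du|^2]. A competitor that costs no more makes it zero,
    because the cost of the candidate is finite and can be cancelled. *)
Lemma control_eq : (lq_cost T opQ opQT u' x' <= lq_cost T opQ opQT u x)%E ->
  {ae leb, forall t, I t -> Heq (u' t) (u t)}.
Proof.
move=> /(le_trans cost_ge); rewrite cost_synth -EFinD lee_fin gerDl => d0.
have dE : \int[leb]_(t in I) Hip (du t) (du t) = 0.
  by apply/le_anti; rewrite d0; apply: Rintegral_ge0 => t _; exact: Hip_ge0.
have : (\int[leb]_(t in I) `|(Hip (du t) (du t))%:E| = 0)%E.
  apply: etrans (etrans (RintegralE mI integrable_Hip_du) (congr1 EFin dE)).
  by apply: eq_integral => t _; rewrite gee0_abs// lee_fin Hip_ge0.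
move=> h1; have := (ae_eq_integral_abs leb mI (measurable_int _
  integrable_Hip_du)).1 h1.
apply: filterS => t h0 tI.
have h2 : Hip (du t) (du t) = 0 := EFin_inj (h0 tI).
have tT : 0 <= t <= T by move: tI; rewrite /= in_itv.
exact: Heq_subr0 (Hip_eq0 (duH tT) h2).
Qed.

End optimality.

Lemma optimal_synth : optimal_pair T opA opB opQ opQT x0 u x.
Proof.
split=> [|u' x' adm]; first exact: admissible_synth.
apply: le_trans (cost_ge adm); rewrite leeDl// lee_fin.
by apply: Rintegral_ge0 => t _; exact: Hip_ge0.
Qed.

Lemma optimal_unique u' x' : optimal_pair T opA opB opQ opQT x0 u' x' ->
  {ae leb, forall t, 0 <= t <= T -> Heq (u' t) (u t)} /\
  (forall t, 0 <= t <= T -> Heq (x' t) (x t)).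
Proof.
move=> [adm opt].
have h1 := control_eq adm (opt _ _ admissible_synth).
split; last exact: (state_eq adm h1).
by apply: filterS h1 => t ut tT; apply: ut; rewrite /= in_itv.
Qed.

End linear_quadratic.

(** * Reduction of the network problem *)

Section semidefinite.
Context {R : realType} {n : nat}.
Local Notation H := (Hvec R n).

Lemma dotv_delta m (N : 'M[R]_m) i j :
  dotv (delta_mx i 0) (N *m delta_mx j 0) = N i j.
Proof.
rewrite -colE dotvE (bigD1 i)//= !mxE !eqxx mul1r big1 ?addr0// => k ki.
by rewrite mxE (negbTE ki) mul0r.
Qed.

(** An isometric [Phi] carries the quadratic form of [P] on its range to that of [M]. It is used on
    the span of the basis of [S] and on multiples of one function orthogonal to [S]. *)
Lemma psd_of_op m (P : H -> H) (Phi : 'cV[R]_m -> H) (M : 'M[R]_m) :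
  Hlinear P -> self_adjoint P -> nonneg_op P -> (forall y, inH (Phi y)) ->
  (forall y z, Hip (Phi y) (Phi z) = dotv y z) ->
  (forall y, Heq (P (Phi y)) (Phi (M *m y))) -> psd M.
Proof.
move=> [P1 _ _] Psa Pge0 PhiH orth hP.
have E y z : Hip (Phi y) (P (Phi z)) = dotv y (M *m z).
  by rewrite -orth; apply: Hip_aeR => //; exact: P1.
split.
  apply/matrixP => i j; rewrite mxE -!dotv_delta -!E -Psa//.
  exact: HipC.
by move=> y; rewrite -E; exact: Pge0.
Qed.

Lemma sum_vblock d (y z : 'cV[R]_(d * n)) :
  dotv y z = \sum_l dotv (vblock y l) (vblock z l).
Proof.
rewrite dotvE sum_mxtens; apply: eq_bigr => l _; rewrite dotvE.
by apply: eq_bigr => i _; rewrite !mxE.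
Qed.

Lemma psd_tens1 d (L : 'M[R]_n) : psd L -> psd ((1%:M : 'M[R]_d) *t L).
Proof.
move=> [symL posL]; split; first by rewrite trmx_tens trmx1 symL.
move=> y; rewrite sum_vblock; apply: sumr_ge0 => l _.
by rewrite vblock_tens1; exact: posL.
Qed.

(** Tensoring with the identity is linear and continuous and respects products and transposes. The
    lifted equation governs [d] independent copies of the [n]-dimensional problem. *)
Lemma riccati_sol_tens1 d (T : R) (F G M K : 'M[R]_n) P :
  riccati_sol T F G M K P ->
  riccati_sol T (1%:M *t F) (1%:M *t G) (1%:M *t M) (1%:M *t K)
    (fun t => (1%:M : 'M[R]_d) *t P t).
Proof.
move=> [cP dP PT]; split; last by rewrite PT.
- apply: (@continuous_comp_within _ _ _ _ P
    (fun N : 'M[R]_n => (1%:M : 'M[R]_d) *t N)) => //.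
  apply/continuous_mxP => i j N; rewrite /continuous_at mxE.
  under eq_fun do rewrite mxE.
  apply: (@cvgM _ _ _ (nbhs_filter N)); first exact: cvg_cst.
  exact: coord_continuous.
- move=> t tT; have /is_derive_mxP dPt := dP t tT.
  rewrite trmx_tens trmx1 !trmx_tens !trmx1 !tensmx_mul !mulmx1.
  apply/is_derive_mxP => i j.
  set D := - _ in dPt; have -> : - (1%:M *t (F^T *m P t) + 1%:M *t (P t *m F) -
    1%:M *t (P t *m G *m G^T *m P t) + 1%:M *t M) = (1%:M : 'M[R]_d) *t D.
    by apply/matrixP => k l; rewrite !mxE; ring.
  have := is_derive_Mr (is_derive_cst
    ((1%:M : 'M[R]_d) (mxtens_unindex i).1 (mxtens_unindex j).1) t (1 : R))
    (dPt (mxtens_unindex i).2 (mxtens_unindex j).2).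
  by apply: is_derive_ext => [s|]; rewrite ?mxE// mul0r add0r.
Qed.

End semidefinite.

Section invariant_subspace.
Context {R : realType} {n : nat}.
Local Notation leb := (@lebesgue_measure R).
Local Notation U := (@unit_itv R).
Local Notation H := (Hvec R n).
Variables (S : set (R -> R)) (d : nat) (f : 'I_d -> R -> R).
Hypotheses (S_sub : is_subspace S) (f_onb : orthonormal_basis S f).

Lemma basis_L2 l : L2 (f l).
Proof. by have [h _ _ _] := S_sub; have [[hf _ _] _] := f_onb; exact/h/hf. Qed.

Lemma basis_expansion v : S v -> L2eq v (\sum_k ip v (f k) *: f k).
Proof.
have fL2 := basis_L2; have [SL2 _ _ _] := S_sub.
have [[_ _ gen] orth] := f_onb => Sv; have [k vk] := gen v Sv.
have kE j : ip v (f j) = k j.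
  rewrite (@ip_ae _ _ (\sum_i k i *: f i))//; last 3 first.
  - exact: L2_measurable (SL2 _ Sv).
  - by apply: L2_measurable; apply: L2_sum => i; exact: L2Z.
  - exact: L2_measurable (fL2 j).
  rewrite ip_suml//; last by move=> i; exact: L2Z.
  rewrite (bigD1 j)//= ipZl// orth eqxx mulr1 big1 ?addr0// => i ij.
  by rewrite ipZl// orth (negbTE ij) mulr0.
by under eq_bigr do rewrite kE.
Qed.

Lemma ortho_complP v : ortho_compl S v <-> L2 v /\ forall l, ip v (f l) = 0.
Proof.
have fL2 := basis_L2; have [SL2 _ _ _] := S_sub; have [[Sf _ _] _] := f_onb.
split=> [[hv h]|[hv h]]; split => //; first by move=> l; exact: h.
move=> w Sw; rewrite ipC (@ip_ae _ _ (\sum_k ip w (f k) *: f k)).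
- rewrite ip_suml//; last by move=> i; exact: L2Z.
  by rewrite big1// => i _; rewrite ipZl// (ipC (f i)) h mulr0.
- exact: L2_measurable (SL2 _ Sw).
- by apply: L2_measurable; apply: L2_sum => i; exact: L2Z.
- exact: L2_measurable hv.
- exact: basis_expansion.
Qed.

Lemma subspace_sum m (k : 'I_m -> R) (v : 'I_m -> R -> R) :
  (forall i, S (v i)) -> S (\sum_i k i *: v i).
Proof.
have [_ S0 Slin _] := S_sub => Sv.
apply: (big_ind S) => // [x y Sx Sy|i _].
  by rewrite -[x]scale1r; exact: Slin.
by rewrite -[_ *: _]addr0; exact: Slin.
Qed.

Lemma ortho_compl_sum m (k : 'I_m -> R) (v : 'I_m -> R -> R) :
  (forall i, ortho_compl S (v i)) -> ortho_compl S (\sum_i k i *: v i).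
Proof.
have fL2 := basis_L2 => vS.
have vL2 i : L2 (v i) by have [] := vS i.
apply/ortho_complP; split; first by apply: L2_sum => i; exact: L2Z.
move=> l; rewrite ip_suml//; last by move=> i; exact: L2Z.
rewrite big1// => i _; rewrite ipZl//.
by have /ortho_complP[_ ->] := vS i; rewrite mulr0.
Qed.

Lemma gram_expansion A c : graphon c A -> invariant_under S A ->
  forall l, L2eq (graphon_op A (f l)) (\sum_k gram_mx A f l k *: f k).
Proof.
move=> hA Sinv l; have [[Sf _ _] _] := f_onb.
rewrite (eq_bigr (fun k => ip (graphon_op A (f l)) (f k) *: f k)) => [|k _].
  exact: basis_expansion (Sinv _ (Sf l)).
by rewrite mxE.
Qed.

Lemma gram_sym A c : graphon c A -> (gram_mx A f)^T = gram_mx A f.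
Proof.
move=> hA; apply/matrixP => i j; rewrite !mxE.
by rewrite (graphon_op_sa hA) ?(ipC (f j))//; exact: basis_L2.
Qed.

Lemma proj_coordE (v : H) : inH v -> proj_coord f v = moments (tens f) v.
Proof.
move=> hv; apply/colP => j; case: (mxtens_indexP j) => l i.
rewrite !mxE Hip_tens ?mxtens_indexK ?(ipC (f l))//.
Qed.

Lemma moments_synth_basis y : moments (tens (n := n) f) (synth (tens f) y) = y.
Proof.
have fL2 := basis_L2; have [_ orth] := f_onb.
have fH := tens_inH fL2.
apply/colP => j; case: (mxtens_indexP j) => l i.
rewrite mxE Hip_tens//; last exact: synth_inH.
rewrite coord_fun_synth_tens ip_sumr//; last by move=> k; exact: L2Z.
rewrite (bigD1 l)//= ipZr// orth eqxx mulr1 big1 ?addr0// => k kl.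
by rewrite ipZr// orth eq_sym (negbTE kl) mulr0.
Qed.

Lemma moments_ortho (v : H) : Hpow (ortho_compl S) v -> moments (tens f) v = 0.
Proof.
move=> vS; have hv : inH v by move=> i; have [] := vS i.
apply/colP => j; case: (mxtens_indexP j) => l i.
rewrite !mxE Hip_tens ?(ipC (f l))//.
by have /ortho_complP[_ ->] := vS i.
Qed.

Lemma Hip_synth_basis (y z : 'cV[R]_(d * n)) :
  Hip (synth (tens f) y) (synth (tens f) z) = dotv y z.
Proof.
have fH := tens_inH (n := n) basis_L2.
by rewrite Hip_synth ?moments_synth_basis//; exact: synth_inH.
Qed.

Definition breve (v : H) : H := v - synth (tens f) (proj_coord f v).

Lemma breve_ortho v : inH v -> Hpow (ortho_compl S) (breve v).
Proof.
have fL2 := basis_L2; have fH := tens_inH (n := n) fL2.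
move=> hv i; have hb : inH (breve v) by apply: inHB => //; exact: synth_inH.
apply/ortho_complP; split; first exact: hb.
move=> l; rewrite ipC -Hip_tens// HipBr//; last exact: synth_inH.
have /colP/(_ (mxtens_index (l, i))) := moments_synth_basis (proj_coord f v).
rewrite mxE => ->; rewrite proj_coordE// mxE.
by rewrite subrr.
Qed.

(** The identity matrix written as a vector: coefficients of [v] as the sum of its coordinate
    functions [v_i] times [e_i]. *)
Definition unit_coef : 'cV[R]_(n * n) :=
  \col_j ((mxtens_unindex j).1 == (mxtens_unindex j).2)%:R.

Lemma synth_coord (v : H) : synth (tens (coord_fun v)) unit_coef = v.
Proof.
apply/funext => a; rewrite synth_tens; apply/colP => i.
rewrite summxE (bigD1 i)//= !mxE !mxtens_indexK/= eqxx mulr1 big1 ?addr0//.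
by move=> l li; rewrite !mxE !mxtens_indexK/= (negbTE li) mulr0.
Qed.

Lemma decomp_synth v : v = synth (catfam (tens f) (tens (coord_fun (breve v))))
  (col_mx (proj_coord f v) unit_coef).
Proof. by rewrite synth_cat synth_coord /breve addrC subrK. Qed.

Section network.
Variables (L D : 'M[R]_n) (A : R * R -> R) (c : R).
Hypotheses (hA : graphon c A) (S_inv : invariant_under S A)
  (S_orth : forall v, ortho_compl S v -> L2eq (graphon_op A v) 0).

Local Notation Fp := (1%:M *t L + gram_mx A f *t D : 'M[R]_(d * n)).
Local Notation Fb := (1%:M *t L : 'M[R]_(n * n)).

(** Coordinates orthogonal to [S] are annihilated, so the general action lemmas apply with expansion
    matrix zero, and the [D]-part disappears. *)
Let ortho_expansion v : Hpow (ortho_compl S) v -> forall k,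
  L2eq (graphon_op A (coord_fun v k)) (\sum_l (0 : 'M[R]_n) k l *: coord_fun v
    l).
Proof.
move=> vS k; have := S_orth (vS k); rewrite big1// => l _.
by rewrite mxE scale0r.
Qed.

Let tens_D0 : (0 : 'M[R]_n) *t D = 0.
Proof. exact: tens0mx. Qed.

Lemma netop_acts_cat v : Hpow (ortho_compl S) v ->
  acts_by (netop L D A) (catfam (tens f) (tens (coord_fun v)))
    (block_mx Fp 0 0 Fb).
Proof.
move=> vS; have vL2 i : L2 (coord_fun v i) by have [] := vS i.
apply: acts_cat.
- exact: tens_inH basis_L2.
- exact: tens_inH.
- exact: netop_linear hA.
- exact: (netop_acts L D hA basis_L2 (gram_expansion hA S_inv) (gram_sym hA)).
- have := netop_acts L D hA vL2 (ortho_expansion vS) (trmx0 _ _ _).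
  by rewrite tens_D0 addr0.
Qed.

Lemma netop_coacts_cat v : Hpow (ortho_compl S) v ->
  coacts_by (netop L D A) (catfam (tens f) (tens (coord_fun v)))
    (block_mx Fp 0 0 Fb).
Proof.
move=> vS; have vL2 i : L2 (coord_fun v i) by have [] := vS i.
apply: coacts_cat.
- exact: tens_inH basis_L2.
- exact: tens_inH.
- exact: netop_linear hA.
- exact: (netop_coacts L D hA basis_L2 (gram_expansion hA S_inv)).
- have := netop_coacts L D hA vL2 (ortho_expansion vS).
  by rewrite tens_D0 addr0.
Qed.

(** The family varies with [v]: the basis of [S] is completed by the coordinates of the orthogonal
    component of [v] itself. *)
Lemma netop_locally_finite : locally_finite (netop L D A).
Proof.
move=> v hv; have vS := breve_ortho hv.
have vL2 i : L2 (coord_fun (breve v) i) by have [] := vS i.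
exists (d * n + n * n)%N, (catfam (tens f) (tens (coord_fun (breve v)))),
  (block_mx Fp 0 0 Fb), (col_mx (proj_coord f v) unit_coef); split.
- by apply: catfam_inH; [exact: tens_inH basis_L2|exact: tens_inH].
- exact: netop_acts_cat.
- by rewrite -decomp_synth; exact: Heq_refl.
Qed.

Hypotheses (P_sa : self_adjoint (netop L D A)) (P_ge0 : nonneg_op (netop L D
  A)).

Lemma psd_proj : psd Fp.
Proof.
apply: (psd_of_op (netop_linear L D hA) P_sa P_ge0 (Phi := synth (tens f))).
- by move=> y; apply: synth_inH; exact: tens_inH basis_L2.
- exact: Hip_synth_basis.
- exact: (netop_acts L D hA basis_L2 (gram_expansion hA S_inv) (gram_sym hA)).
Qed.

(** On functions [g] times a constant vector the graphon part vanishes and the operator reduces to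
    [L]; this transfers symmetry and nonnegativity to the matrix. *)
Lemma psd_breve g : ortho_compl S g -> ip g g = 1 -> psd L.
Proof.
move=> gS g1; have gL2 : L2 g by have [] := gS.
pose Phi (y : 'cV[R]_n) : H := fun a => g a *: y.
have coordE y i : coord_fun (Phi y) i = y i 0 *: g.
  by apply/funext => a; rewrite /coord_fun /Phi mxE mulrC.
have PhiH y : inH (Phi y) by move=> i; rewrite coordE; exact: L2Z.
apply: (psd_of_op (netop_linear L D hA) P_sa P_ge0 (Phi := Phi) PhiH).
- move=> y z; rewrite /Hip dotvE; apply: eq_bigr => i _.
  by rewrite !coordE ipZl ?ipZr ?g1 ?mulr1//; exact: L2Z.
- move=> y; have := S_orth gS; apply: filterS => a ga Ua.
  rewrite /netop (_ : \col_i _ = 0) ?mulmx0 ?addr0; first by rewrite -scalemxAr.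
  apply/colP => i; rewrite !mxE coordE -[_ *: g]addr0.
  rewrite (graphon_op_lin hA)//; last exact: L2_0.
  have h := graphon_op_lin hA (-1) Ua (@L2_0 R) (@L2_0 R).
  rewrite scaler0 addr0 mulN1r addNr in h; rewrite h addr0 ga//.
  by rewrite mulr0.
Qed.

End network.
End invariant_subspace.

Section orthogonal_direction.
Context {R : realType}.
Local Notation leb := (@lebesgue_measure R).
Local Notation U := (@unit_itv R).
Variables (S : set (R -> R)) (d : nat) (f : 'I_d -> R -> R).
Hypotheses (S_sub : is_subspace S) (f_onb : orthonormal_basis S f).

(** Half-open for disjointness. One slice more than [dim S] provides the direction orthogonal to
    [S]. *)
Let slice (k : 'I_d.+1) : set (measurableTypeR R) :=
  `]k%:R / d.+1%:R, k.+1%:R / d.+1%:R]%classic.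

Let e (k : 'I_d.+1) : R -> R := \1_(slice k).

Let d1_gt0 : 0 < d.+1%:R :> R. Proof. exact: ltr0Sn. Qed.

Let mslice k : measurable (slice k). Proof. exact: measurable_itv. Qed.

Let leb_slice k : leb (slice k) =
  (k.+1%:R / d.+1%:R - k%:R / d.+1%:R)%:E.
Proof.
by rewrite lebesgue_measure_itv/= lte_fin ltr_pM2r ?invr_gt0// ltr_nat ltnSn.
Qed.

Let eL2 k : L2 (e k).
Proof.
apply: (@bounded_L2 _ _ 1); first by apply: measurable_funTS;
  exact: measurable_indic.
by move=> a _; rewrite /e indicE; case: (_ \in _); rewrite ?normr1 ?normr0.
Qed.

Let ip_slice k j : ip (e k) (e j) = (k == j)%:R / d.+1%:R.
Proof.
have [<-|kj] := eqVneq k j; last first.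
  rewrite mul0r; transitivity (\int[leb]_(a in U) (0 : R)); last first.
    by rewrite /Rintegral integral0.
  apply: eq_Rintegral => a _; rewrite /e !indicE /slice !mem_setE !in_itv/=.
  have [/andP[k1 k2]|_] := boolP (k%:R / d.+1%:R < a <= k.+1%:R / d.+1%:R);
    last by rewrite mul0r.
  have [/andP[j1 j2]|_] := boolP (j%:R / d.+1%:R < a <= j.+1%:R / d.+1%:R);
    last by rewrite mulr0.
  have := lt_le_trans k1 j2; have := lt_le_trans j1 k2.
  rewrite !ltr_pM2r ?invr_gt0// !ltr_nat !ltnS => jk kj'.
  by move: kj; rewrite -(inj_eq val_inj)/= eqn_leq jk kj'.
transitivity (\int[leb]_(a in U) e k a).
  by apply: eq_Rintegral => a _; rewrite /e indicE; case: (_ \in _);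
    rewrite ?mulr1 ?mulr0.
rewrite /Rintegral /e integral_indic//; last exact: measurable_unit_itv.
rewrite setIidl.
  apply: etrans (congr1 fine (leb_slice k)) _.
  by rewrite /= -mulrBl -natrB ?leqnSn// subSnn.
move=> a; rewrite /slice /unit_itv /= !in_itv/= => /andP[a1 a2].
rewrite (le_trans _ (ltW a1)) ?divr_ge0//= (le_trans a2)//.
by rewrite ler_pdivrMr// mul1r ler_nat.
Qed.

(* A combination of [d + 1] slices is orthogonal to the [d] basis functions. *)
Lemma exists_unit_ortho : exists g, ortho_compl S g /\ ip g g = 1.
Proof.
have fL2 := basis_L2 S_sub f_onb.
pose N : 'M[R]_(d.+1, d) := \matrix_(k, l) ip (e k) (f l).
have [c c0 cN] : exists2 c : 'rV[R]_d.+1, c != 0 & c *m N = 0.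
  (* The rank of [N] is at most [d], which is less than its number of rows, so some nonzero row
     vector annihilates it. *)
  have : kermx N != 0.
    by rewrite kermx_eq0 /row_free neq_ltn (leq_ltn_trans (rank_leq_col N)).
  move=> /rowV0Pn[c cK c0]; exists c => //.
  exact/sub_kermxP.
pose g := \sum_k c 0 k *: e k.
have gL2 : L2 g by apply: L2_sum => k; exact: L2Z.
have gf l : ip g (f l) = 0.
  rewrite ip_suml//; last by move=> k; exact: L2Z.
  have cNl : (c *m N) 0 l = 0 by rewrite cN mxE.
  apply: etrans cNl; rewrite mxE; apply: eq_bigr => k _.
  by rewrite ipZl// mxE.
have gg : ip g g = (\sum_k c 0 k ^+ 2) / d.+1%:R.
  rewrite {1}/g ip_suml//; last by move=> k; exact: L2Z.
  rewrite mulr_suml; apply: eq_bigr => k _.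
  rewrite ipZl// ip_sumr//; last by move=> j; exact: L2Z.
  rewrite (bigD1 k)//= ipZr// ip_slice eqxx big1 ?addr0;
    first by rewrite mul1r expr2 !mulrA.
  by move=> j jk; rewrite ipZr// ip_slice eq_sym (negbTE jk) mul0r mulr0.
have gg0 : 0 < ip g g.
  rewrite gg divr_gt0// lt_def; apply/andP; split; last first.
    by apply: sumr_ge0 => k _; exact: sqr_ge0.
  rewrite psumr_eq0; last by move=> k _; exact: sqr_ge0.
  apply: contra c0 => /allP h; apply/eqP/rowP => k; rewrite mxE.
  by have := h k (mem_index_enum _); rewrite /= sqrf_eq0 => /eqP.
exists ((Num.sqrt (ip g g))^-1 *: g); split.
  apply/(ortho_complP S_sub f_onb); split; first exact: L2Z.
  by move=> l; rewrite ipZl// gf mulr0.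
rewrite ipZl//; last exact: L2Z.
rewrite ipZr// mulrA -expr2 exprVn sqr_sqrtr ?mulVf// ?gt_eqF//.
exact: ltW.
Qed.

End orthogonal_direction.

Section block_trajectories.
Context {R : realType}.

Lemma is_derive_col_mx p q r (y : R -> 'M[R]_(p, r)) (z : R ->
  'M[R]_(q, r)) t dy dz :
  is_derive t (1 : R) y dy -> is_derive t (1 : R) z dz ->
  is_derive t (1 : R) (fun s => col_mx (y s) (z s)) (col_mx dy dz).
Proof.
move=> /is_derive_mxP hy /is_derive_mxP hz; apply/is_derive_mxP => i j.
rewrite -(splitK i); case: (fintype.split i) => k /=.
  by apply: is_derive_ext (hy k j) => [s|]; rewrite ?col_mxEu.
by apply: is_derive_ext (hz k j) => [s|]; rewrite ?col_mxEd.
Qed.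

End block_trajectories.

Theorem corollary3 (R : realType) (T c : R) (n : nat)
  (T_gt0 : 0 < T) (c_gt0 : 0 < c) (n_ge1 : (1 <= n)%N)
  (La Da Lb Db Lq Dq LqT DqT : 'M[R]_n)
  (A B Q QT : R * R -> R)
  (hA : graphon c A) (hB : graphon c B) (hQ : graphon c Q) (hQT : graphon c QT)
  (Q_sa : self_adjoint (netop Lq Dq Q))
  (Q_ge0 : nonneg_op (netop Lq Dq Q))
  (QT_sa : self_adjoint (netop LqT DqT QT))
  (QT_ge0 : nonneg_op (netop LqT DqT QT))
  (S : set (R -> R)) (d : nat) (S_sub : is_subspace S) (S_dim : has_dim S d)
  (S_invA : invariant_under S A) (S_invB : invariant_under S B)
  (S_invQ : invariant_under S Q) (S_invQT : invariant_under S QT)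
  (S_orth : forall v, ortho_compl S v ->
     [/\ L2eq (graphon_op A v) 0, L2eq (graphon_op B v) 0,
         L2eq (graphon_op Q v) 0 & L2eq (graphon_op QT v) 0])
  (f : 'I_d -> R -> R) (f_onb : orthonormal_basis S f)
  (x0 : Hvec R n) (x0_H : inH x0) :
  let Fp : 'M[R]_(d * n) := 1%:M *t La + gram_mx A f *t Da in
  let Gp : 'M[R]_(d * n) := 1%:M *t Lb + gram_mx B f *t Db in
  let Mp : 'M[R]_(d * n) := 1%:M *t Lq + gram_mx Q f *t Dq in
  let Kp : 'M[R]_(d * n) := 1%:M *t LqT + gram_mx QT f *t DqT in
  let is_optimal := optimal_pair T (netop La Da A) (netop Lb Db B)
                      (netop Lq Dq Q) (netop LqT DqT QT) x0 in
  [/\ exists Pi_, riccati_sol T Fp Gp Mp Kp Pi_,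
      exists pi_, riccati_sol T La Lb Lq LqT pi_ &
      forall Pi_ pi_, riccati_sol T Fp Gp Mp Kp Pi_ -> riccati_sol T La Lb Lq LqT pi_ ->
      exists u x : R -> Hvec R n,
      [/\ is_optimal u x,
          (forall u' x', is_optimal u' x' ->
             {ae lebesgue_measure, forall t, 0 <= t <= T -> Heq (u' t) (u t)} /\
             (forall t, 0 <= t <= T -> Heq (x' t) (x t))) &
          exists (uf ub xf xb : R -> Hvec R n) (up : R -> 'cV[R]_(d * n)),
          [/\ forall t, 0 <= t <= T ->
                is_decomp S (u t) (uf t) (ub t) /\
                is_decomp S (x t) (xf t) (xb t),
              forall t, 0 <= t <= T -> up t = - (Gp^T *m Pi_ t *m proj_coord f (x t)) &
              {ae lebesgue_measure, forall g, unit_itv g -> forall t, 0 <= t <= T ->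
                 u t g = ub t g + \sum_(l < d) f l g *: vblock (up t) l /\
                 ub t g = - (Lb^T *m pi_ t *m xb t g)}]]].
Proof.
move=> Fp Gp Mp Kp is_optimal.
have T_ge0 : 0 <= T by exact: ltW.
have orthA v : ortho_compl S v -> L2eq (graphon_op A v) 0 by move=> /S_orth[].
have orthB v : ortho_compl S v -> L2eq (graphon_op B v) 0 by move=> /S_orth[].
have orthQ v : ortho_compl S v -> L2eq (graphon_op Q v) 0 by move=> /S_orth[].
have orthQT v : ortho_compl S v -> L2eq (graphon_op QT v) 0 by move=> /S_orth[].
have [g [gS g1]] := exists_unit_ortho S_sub f_onb.
have psdM : psd Mp := psd_proj S_sub f_onb hQ S_invQ Q_sa Q_ge0.
have psdK : psd Kp := psd_proj S_sub f_onb hQT S_invQT QT_sa QT_ge0.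
have psdq : psd Lq := psd_breve hQ orthQ Q_sa Q_ge0 gS g1.
have psdqT : psd LqT := psd_breve hQT orthQT QT_sa QT_ge0 gS g1.
split.
- by exists (riccati_flow T Fp Gp Mp Kp); exact: riccati_flow_sol.
- by exists (riccati_flow T La Lb Lq LqT); exact: riccati_flow_sol.
move=> Pi_ pi_ Pisol pisol.
have fL2 := basis_L2 S_sub f_onb.
pose b0 := breve f x0.
have b0S : Hpow (ortho_compl S) b0 := breve_ortho S_sub f_onb x0_H.
have bL2 k : L2 (coord_fun b0 k) by have [] := b0S k.
have [xi1 [psi1 [dxi1 dpsi1 xi10 psi1T psi1E]]] :=
  hamiltonian_pair psdM psdK (proj_coord f x0) T_ge0 Pisol.
(* The initial coefficients are always [unit_coef]: on the orthogonal side the dependence on [x0]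
   sits in the family built from [b0]. *)
have [xi2 [psi2 [dxi2 dpsi2 xi20 psi2T psi2E]]] :=
  hamiltonian_pair (psd_tens1 n psdq) (psd_tens1 n psdqT)
    (unit_coef (R := R) (n := n)) T_ge0 (riccati_sol_tens1 n pisol).
pose h : 'I_(d * n + n * n) -> Hvec R n := catfam (tens f) (tens (coord_fun
  b0)).
have hH j : inH (h j) by apply: catfam_inH; exact: tens_inH.
pose xi t := col_mx (xi1 t) (xi2 t); pose psi t := col_mx (psi1 t) (psi2 t).
pose F := block_mx Fp 0 0 (1%:M *t La : 'M[R]_(n * n)).
pose G := block_mx Gp 0 0 (1%:M *t Lb : 'M[R]_(n * n)).
pose M := block_mx Mp 0 0 (1%:M *t Lq : 'M[R]_(n * n)).
pose K := block_mx Kp 0 0 (1%:M *t LqT : 'M[R]_(n * n)).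
have GTE t : G^T *m psi t = col_mx (Gp^T *m psi1 t) ((1%:M *t Lb)^T *m psi2 t).
  by rewrite /G /psi tr_block_mx mul_block_col !trmx0 !mul0mx addr0 add0r.
have dxi t : is_derive t (1 : R) xi (F *m xi t - G *m (G^T *m psi t)).
  apply: is_derive_ext (is_derive_col_mx (dxi1 t) (dxi2 t)) => //.
  rewrite GTE /F /G /xi !mul_block_col !mul0mx !addr0 !add0r.
  by rewrite opp_col_mx add_col_mx.
have dpsi t : is_derive t (1 : R) psi (- (M *m xi t) - F^T *m psi t).
  apply: is_derive_ext (is_derive_col_mx (dpsi1 t) (dpsi2 t)) => //.
  rewrite /M /F /xi /psi tr_block_mx !mul_block_col !trmx0 !mul0mx !addr0
    !add0r.
  by rewrite !opp_col_mx add_col_mx.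
have psiT : psi T = K *m xi T.
  by rewrite /K /psi /xi mul_block_col !mul0mx addr0 add0r psi1T psi2T.
have xi0 : Heq (synth h (xi 0)) x0.
  rewrite /xi xi10 xi20 [X in Heq _ X](decomp_synth f x0); exact: Heq_refl.
have opt := optimal_synth T_gt0 (netop_linear La Da hA) (netop_linear Lb Db hB)
  (netop_linear Lq Dq hQ) (netop_linear LqT DqT hQT)
  (netop_locally_finite S_sub f_onb La Da hA S_invA orthA)
  Q_sa Q_ge0 QT_sa QT_ge0 hH
  (netop_acts_cat S_sub f_onb La Da hA S_invA orthA b0S)
  (netop_coacts_cat S_sub f_onb La Da hA S_invA orthA b0S)
  (netop_acts_cat S_sub f_onb Lb Db hB S_invB orthB b0S)
  (netop_coacts_cat S_sub f_onb Lb Db hB S_invB orthB b0S)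
  (netop_acts_cat S_sub f_onb Lq Dq hQ S_invQ orthQ b0S)
  (netop_acts_cat S_sub f_onb LqT DqT hQT S_invQT orthQT b0S)
  x0_H dxi dpsi psiT xi0.
have uniq := optimal_unique T_gt0 (netop_linear La Da hA) (netop_linear Lb Db
  hB)
  (netop_linear Lq Dq hQ) (netop_linear LqT DqT hQT)
  (netop_locally_finite S_sub f_onb La Da hA S_invA orthA)
  Q_sa Q_ge0 QT_sa QT_ge0 hH
  (netop_acts_cat S_sub f_onb La Da hA S_invA orthA b0S)
  (netop_coacts_cat S_sub f_onb La Da hA S_invA orthA b0S)
  (netop_acts_cat S_sub f_onb Lb Db hB S_invB orthB b0S)
  (netop_coacts_cat S_sub f_onb Lb Db hB S_invB orthB b0S)
  (netop_acts_cat S_sub f_onb Lq Dq hQ S_invQ orthQ b0S)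
  (netop_acts_cat S_sub f_onb LqT DqT hQT S_invQT orthQT b0S)
  x0_H dxi dpsi psiT xi0.
exists (fun t => synth h (- (G^T *m psi t))), (fun t => synth h (xi t)).
split; [exact: opt|exact: uniq|].
exists (fun t => synth (tens (n := n) f) (- (Gp^T *m psi1 t))),
  (fun t => synth (tens (n := n) (coord_fun b0)) (- ((1%:M *t Lb)^T *m psi2
    t))),
  (fun t => synth (tens (n := n) f) (xi1 t)),
  (fun t => synth (tens (n := n) (coord_fun b0)) (xi2 t)),
  (fun t => - (Gp^T *m Pi_ t *m proj_coord f (synth h (xi t)))).
have SfH (y : 'cV[R]_(d * n)) : Hpow S (synth (tens (n := n) f) y).
  move=> i; rewrite coord_fun_synth_tens; apply: (subspace_sum S_sub).
  by have [[]] := f_onb.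
have SbH (y : 'cV[R]_(n * n)) : Hpow (ortho_compl S) (synth (tens (n := n)
  (coord_fun b0)) y).
  move=> i; rewrite coord_fun_synth_tens; exact: (ortho_compl_sum S_sub f_onb).
have uE t : synth h (- (G^T *m psi t)) = synth (tens (n := n) f) (- (Gp^T *m
  psi1 t)) +
    synth (tens (n := n) (coord_fun b0)) (- ((1%:M *t Lb)^T *m psi2 t)).
  by rewrite GTE opp_col_mx synth_cat.
(* The orthogonal part has zero moments against the basis, so projecting the state recovers the
   coefficients on [S]; this lets [psi1E] be read as feedback on the projected state. *)
have projE t : proj_coord f (synth h (xi t)) = xi1 t.
  have fH := tens_inH (n := n) fL2.
  rewrite proj_coordE; last exact: synth_inH.
  rewrite /xi synth_cat; apply/colP => j.
  rewrite mxE HipDr//; [|exact: synth_inH|by apply: synth_inH; exact: tens_inH].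
  have /colP/(_ j) := moments_synth_basis S_sub f_onb (xi1 t).
  have /colP/(_ j) := moments_ortho S_sub f_onb (SbH (xi2 t)).
  by rewrite !mxE => -> ->; rewrite addr0.
split => [t tT|t tT //|].
- split; split => //.
    by rewrite uE; exact: Heq_refl.
  by rewrite /xi synth_cat; exact: Heq_refl.
(* For these representatives the nodewise formulas hold at every node and time. *)
- apply: aeW => a Ua t tT; split.
    rewrite uE -[LHS]/(_ a + _ a) addrC; congr (_ + _).
    by rewrite synth_tens projE -mulmxA -psi1E.
  (* State and control share the scalar factor given by the [l]-th coordinate of [b0] at [a], so the
     feedback matrix acts on each block separately and passes to the nodal value. *)
  rewrite !synth_tens psi2E// mulmx_sumr -sumrN; apply: eq_bigr => l _.
  rewrite -!scalemxAr -scalerN; congr (_ *: _).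
  have -> (y : 'cV[R]_(n * n)) : vblock (- y) l = - vblock y l.
    by apply/colP => i; rewrite !mxE.
  by rewrite trmx_tens trmx1 !vblock_tens1 mulmxA.
Qed.
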